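(* Let $q\geq 0$ and $1\leq t\leq 2^q$ be integers, let $m=2^{q+1}-t$, and let $\mathcal{F}_1,\dots,\mathcal{F}_m$ be finite families of nonempty compact convex sets in $\mathbb{R}^d$. (a) Let $k\geq 2$ and $d=2^q(k+1)-t$. If no four members of any $\mathcal{F}_i$ are pairwise disjoint, then there exist $k$ hyperplanes in $\mathbb{R}^d$ such that any two of them pierce every $\mathcal{F}_i$. (b) Let $d=7\cdot 2^q-2t$. If no eight members of any $\mathcal{F}_i$ are pairwise disjoint, then there exist $4$ hyperplanes in $\mathbb{R}^d$ such that any three of them pierce every $\mathcal{F}_i$.
   Context: A collection of hyperplanes pierces a family $\mathcal{F}$ of sets if the union of the hyperplanes intersects every member of $\mathcal{F}$. ''Any $\ell$ of them pierce $\mathcal{F}_i$'' means every $\ell$-element subcollection of the hyperplanes pierces $\mathcal{F}_i$. *)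

(* Defs.v *)
From HB Require Import structures.
From mathcomp Require Import all_boot all_order all_algebra.
From mathcomp Require Import all_classical all_reals all_analysis.
Set Implicit Arguments. Unset Strict Implicit. Unset Printing Implicit Defensive.
Import Order.TTheory GRing.Theory Num.Theory.
Import numFieldNormedType.Exports.
Local Open Scope classical_set_scope.
Local Open Scope ring_scope.

Definition dotv (R : realType) (d : nat) (a x : 'rV[R]_d) : R :=
  \sum_(i < d) a 0 i * x 0 i.

Definition is_hyperplane (R : realType) (d : nat) (H : set 'rV[R]_d) : Prop :=
  exists (a : 'rV[R]_d) (b : R), a != 0 /\ H = [set x | dotv a x = b].

Definition convex_set (R : realType) (d : nat) (A : set 'rV[R]_d) : Prop :=
  forall x y, A x -> A y -> forall l : R, 0 <= l -> l <= 1 ->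
    A (l *: x + (1 - l) *: y).

Definition good_family (R : realType) (d : nat) (F : set (set 'rV[R]_d)) : Prop :=
  finite_set F /\
  (forall A, F A -> [/\ A !=set0, compact A & convex_set A]).

Definition no_n_pairwise_disjoint (T : Type) (n : nat) (F : set (set T)) : Prop :=
  ~ exists f : 'I_n -> set T,
      (forall i, F (f i)) /\ (forall i j, i != j -> f i `&` f j = set0).

Definition pierces (T : Type) (k : nat) (H : 'I_k -> set T) (S : {set 'I_k})
  (F : set (set T)) : Prop :=
  forall A, F A -> exists2 i, i \in S & A `&` H i !=set0.

Definition any_pierce (T : Type) (k l : nat) (H : 'I_k -> set T)
  (F : set (set T)) : Prop :=
  forall S : {set 'I_k}, #|S| = l -> pierces H S F.

(* Main.v *)
Require Import Defs.
From HB Require Import structures.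
From mathcomp Require Import all_boot all_order all_algebra.
From mathcomp Require Import all_classical all_reals all_analysis.
From mathcomp Require Import perm zify ring lra.
From mathcomp Require Import -(notations) mpoly.
Import Order.TTheory GRing.Theory Num.Theory.
Import numFieldNormedType.Exports.
Local Open Scope classical_set_scope.
Local Open Scope ring_scope.

Set Implicit Arguments.
Unset Strict Implicit.
Unset Printing Implicit Defensive.

(** A hyperplane is a nonzero row (b, a) of R^(d+1), so k hyperplanes are a point
    of a product of k spheres, on which (Z/2)^k acts by signs.  A set A lies
    strictly on the positive side of a row v iff min_A v > 0.  Taking products of
    positive parts of these minima over the l-element sets T of rows and summing
    over A gives, for each family, a weight on the faces of codimension l of the
    cube {+,-}^k.  Its Fourier coefficients of degree 1..l are equivariant, and if
    they all vanish then either no member is missed by l of the hyperplanes, or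
    2^l pairwise disjoint faces carry members: for l = 2 by a positivity
    argument, for l = 3 and k = 4 because the faces are the edges of the 4-cube
    and a fractional perfect matching yields a perfect matching.

    A common zero exists when the product of the characters, as a product of
    linear forms over F_2, has an odd coefficient at (x_1 ... x_k)^d.  This
    multi-parameter Borsuk-Ulam theorem comes from the operators [D, s_chi] on
    functions on the cells of a cubical grid, D being the boundary operator and
    s_chi a sign function of character chi: their composition, integrated over a
    fundamental domain, depends only on the characters, and equals that
    coefficient.  The coefficient is computed by writing the product of all
    x_a + x_b as a Vandermonde determinant and squaring repeatedly.

    There is room in the degree to make all hyperplanes but one pass through a
    given point p.  If two of them coincide (or one is at infinity) one obtains
    hyperplanes through p with a stronger piercing property, and varying p
    produces distinct ones. *)

(** The constants of the statement come from the parity computation. The characters of degree 2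
    contribute the Vandermonde product to the power [m = 2 ^ q.+1 - t]; the [t - 1] vacuous copies
    raise it to [2 ^ q.+1 - 1]. These exponents arise from 1 by doubling and adding 1: a square
    times one more Vandermonde factor, a step that keeps the relevant coefficients odd. Such a power
    is alternating, hence has coefficient 0 wherever two exponents agree, in particular at equal
    exponents. Passage through [p] is therefore imposed with distinct multiplicities 0, 1, ..., k -
    1: the resulting monomial separates the exponents, and its degree ['C(k, 2)] is exactly what is
    missing from [k * d]. Multiplicity 0 explains why one hyperplane is not tied to [p]. The
    topological side uses only functions on finitely many cells; continuity enters through Lipschitz
    bounds, and the exact zero is recovered by minimising over a compact cube. *)

(** * One-coordinate updates and cancellation in characteristic 2 *)

Lemma addF2 (x : 'F_2) : x + x = 0.
Proof. by case: x => [[|[|?]] ?] //; apply/val_inj. Qed.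

Definition fupd (I : finType) (T : Type) (x : {ffun I -> T}) (i : I) (v : T) :
  {ffun I -> T} := [ffun j => if j == i then v else x j].

Lemma fupdE (I : finType) (T : Type) (x : {ffun I -> T}) i v j :
  fupd x i v j = if j == i then v else x j.
Proof. by rewrite ffunE. Qed.

Lemma fupd_eq (I : finType) (T : Type) (x : {ffun I -> T}) i v :
  fupd x i v i = v.
Proof. by rewrite ffunE eqxx. Qed.

Lemma fupd_neq (I : finType) (T : Type) (x : {ffun I -> T}) i v j :
  j != i -> fupd x i v j = x j.
Proof. by rewrite ffunE => /negPf ->. Qed.

Lemma fupd_id (I : finType) (T : Type) (x : {ffun I -> T}) i :
  fupd x i (x i) = x.
Proof. by apply/ffunP => j; rewrite ffunE; case: eqP => // ->. Qed.

Lemma fupd_fupd (I : finType) (T : Type) (x : {ffun I -> T}) i v w :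
  fupd (fupd x i v) i w = fupd x i w.
Proof. by apply/ffunP => j; rewrite !ffunE; case: eqP. Qed.

Lemma fupd_comm (I : finType) (T : Type) (x : {ffun I -> T}) i j v w :
  i != j -> fupd (fupd x i v) j w = fupd (fupd x j w) i v.
Proof.
move=> ij; apply/ffunP => l; rewrite !ffunE.
by case: (eqVneq l j) => [->|//]; rewrite eq_sym (negPf ij).
Qed.

Lemma sum_fupd_exchange (I : finType) (T : finType) (V : nmodType) (i : I)
    (F : {ffun I -> T} -> T -> V) :
  \sum_x \sum_v F x v = \sum_x \sum_v F (fupd x i v) (x i).
Proof.
rewrite !pair_bigA /=.
rewrite (reindex_onto (fun p => (fupd p.1 i p.2, p.1 i))
                      (fun p => (fupd p.1 i p.2, p.1 i))) /=; last first.
  by move=> [x v] _ /=; rewrite fupd_fupd fupd_eq fupd_id.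
apply: eq_bigl => -[x v] /=.
by rewrite fupd_fupd fupd_eq fupd_id eqxx.
Qed.

Lemma sum_char2_sym (F : nmodType) (I : finType) (T : I -> I -> F) :
  (forall x : F, x + x = 0) -> (forall i j, T i j = T j i) -> (forall i, T i i = 0) ->
  \sum_i \sum_j T i j = 0.
Proof.
move=> ch2 Tsym T0.
have -> : \sum_i \sum_j T i j =
    \sum_i (\sum_(j | (enum_rank i < enum_rank j)%N) T i j
          + \sum_(j | (enum_rank j < enum_rank i)%N) T i j).
  apply: eq_bigr => i _.
  rewrite (bigD1 i) //= T0 add0r.
  rewrite (bigID (fun j => (enum_rank i < enum_rank j)%N)) /=; congr (_ + _).
    apply: eq_bigl => j; case: ltngtP; rewrite ?andbF ?andbT //.
    by move=> h; apply/eqP => e; move: h; rewrite e ltnn.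
  apply: eq_bigl => j.
  rewrite -leqNgt leq_eqVlt.
  case: (eqVneq j i) => [->|ne] /=; first by rewrite ltnn.
  case: eqP => // /ord_inj/enum_rank_inj e; by rewrite e eqxx in ne.
rewrite big_split /= [X in _ + X](exchange_big_dep predT) /=; last by [].
set A := \sum_i _; set B := \sum_j _; suff -> : B = A by rewrite ch2.
by apply: eq_bigr => i _; apply: eq_bigr => j _; rewrite Tsym.
Qed.

(** * The boundary operator and its commutators on a product of complexes *)

(** With [M x y] the incidence of a cell [x] and its facet [y], this is, on functions, the mod 2
    coboundary of the product complex, one factor at a time. *)
Definition bdry (F : comNzRingType) (B : finType) (k : nat) (M : B -> B -> F)
    (f : {ffun 'I_k -> B} -> F) (x : {ffun 'I_k -> B}) : F :=
  \sum_b \sum_y M (x b) y * f (fupd x b y).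

(** The factor [s x + s y] survives only across a jump of [s]. This form, rather than the commutator
    of [comm_bdryE], is what later localises a nonzero composite near sign changes. *)
Definition comm_bdry (F : comNzRingType) (B : finType) (k : nat) (M : B -> B -> F)
    (s f : {ffun 'I_k -> B} -> F) (x : {ffun 'I_k -> B}) : F :=
  \sum_b \sum_y M (x b) y * ((s x + s (fupd x b y)) * f (fupd x b y)).

Definition comm_chain (F : comNzRingType) (B : finType) (k : nat) (M : B -> B -> F)
    (l : seq ({ffun 'I_k -> B} -> F)) (f : {ffun 'I_k -> B} -> F) :=
  foldr (@comm_bdry F B k M) f l.

Lemma comm_bdryE (F : comNzRingType) (B : finType) k (M : B -> B -> F) (s f : {ffun 'I_k -> B} -> F) x :
  comm_bdry M s f x = bdry M (fun y => s y * f y) x + s x * bdry M f x.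
Proof.
rewrite /bdry mulr_sumr -big_split /=; apply: eq_bigr => b _.
by rewrite mulr_sumr -big_split /=; apply: eq_bigr => y _; ring.
Qed.

Lemma eq_bdry (F : comNzRingType) (B : finType) k (M : B -> B -> F) (f g : {ffun 'I_k -> B} -> F) :
  f =1 g -> bdry M f =1 bdry M g.
Proof.
by move=> fg x; apply: eq_bigr => b _; apply: eq_bigr => y _; rewrite fg.
Qed.

Lemma eq_comm_bdry (F : comNzRingType) (B : finType) k (M : B -> B -> F) (s t f g : {ffun 'I_k -> B} -> F) :
  s =1 t -> f =1 g -> comm_bdry M s f =1 comm_bdry M t g.
Proof.
move=> st fg x; apply: eq_bigr => b _; apply: eq_bigr => y _.
by rewrite fg !st.
Qed.

Lemma eq_comm_chain (F : comNzRingType) (B : finType) k (M : B -> B -> F) l (f g : {ffun 'I_k -> B} -> F) :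
  f =1 g -> comm_chain M l f =1 comm_chain M l g.
Proof. by move=> fg; elim: l => //= s l IH; apply: eq_comm_bdry. Qed.

Lemma bdryD (F : comNzRingType) (B : finType) k (M : B -> B -> F) (f g : {ffun 'I_k -> B} -> F) x :
  bdry M (fun y => f y + g y) x = bdry M f x + bdry M g x.
Proof.
rewrite /bdry -big_split /=; apply: eq_bigr => b _.
by rewrite -big_split /=; apply: eq_bigr => y _; rewrite mulrDr.
Qed.

Lemma comm_bdryD (F : comNzRingType) (B : finType) k (M : B -> B -> F) (s f g : {ffun 'I_k -> B} -> F) x :
  comm_bdry M s (fun y => f y + g y) x = comm_bdry M s f x + comm_bdry M s g x.
Proof.
rewrite /comm_bdry -big_split /=; apply: eq_bigr => b _.
by rewrite -big_split /=; apply: eq_bigr => y _; rewrite !mulrDr.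
Qed.

Lemma comm_chainD (F : comNzRingType) (B : finType) k (M : B -> B -> F) l (f g : {ffun 'I_k -> B} -> F) x :
  comm_chain M l (fun y => f y + g y) x = comm_chain M l f x + comm_chain M l g x.
Proof.
elim: l x => //= s l IH x.
by rewrite -comm_bdryD; apply: eq_comm_bdry.
Qed.

Lemma comm_bdry_sum (F : comNzRingType) (B : finType) k (M : B -> B -> F) (s : {ffun 'I_k -> B} -> F)
    (J : Type) (r : seq J) (f : J -> {ffun 'I_k -> B} -> F) x :
  comm_bdry M s (fun y => \sum_(j <- r) f j y) x = \sum_(j <- r) comm_bdry M s (f j) x.
Proof.
rewrite /comm_bdry [RHS]exchange_big /=; apply: eq_bigr => b _.
rewrite [RHS]exchange_big /=; apply: eq_bigr => y _.
by rewrite !mulr_sumr.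
Qed.

Lemma comm_bdry_suml (F : comNzRingType) (B : finType) k (M : B -> B -> F) (f : {ffun 'I_k -> B} -> F)
    (J : Type) (r : seq J) (s : J -> {ffun 'I_k -> B} -> F) x :
  comm_bdry M (fun y => \sum_(j <- r) s j y) f x = \sum_(j <- r) comm_bdry M (s j) f x.
Proof.
rewrite /comm_bdry [RHS]exchange_big /=; apply: eq_bigr => b _.
rewrite [RHS]exchange_big /=; apply: eq_bigr => y _.
by rewrite -big_split /= mulr_suml mulr_sumr.
Qed.

Lemma bdry_cst (F : comNzRingType) (B : finType) k (M : B -> B -> F) (x : {ffun 'I_k -> B}) :
  (forall x, \sum_y M x y = 0) -> bdry M (fun=> 1) x = 0.
Proof.
by move=> M1; apply: big1 => b _; under eq_bigr do rewrite mulr1; apply: M1.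
Qed.

(** Steps in two different factors commute, so the two orders cancel mod 2; two steps in the same
    factor cancel by the hypothesis on [M]. *)
Lemma bdry_bdry (F : comNzRingType) (B : finType) k (M : B -> B -> F) (f : {ffun 'I_k -> B} -> F) x :
  (forall x : F, x + x = 0) ->
  (forall x z, \sum_y M x y * M y z = 0) -> bdry M (bdry M f) x = 0.
Proof.
move=> ch2 MM; rewrite /bdry.
have -> : \sum_b \sum_y M (x b) y *
      (\sum_c \sum_z M (fupd x b y c) z * f (fupd (fupd x b y) c z)) =
    \sum_b \sum_c \sum_y \sum_z
      M (x b) y * (M (fupd x b y c) z * f (fupd (fupd x b y) c z)).
  apply: eq_bigr => b _; rewrite exchange_big /=; apply: eq_bigr => y _.
  by rewrite mulr_sumr; apply: eq_bigr => c _; rewrite mulr_sumr.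
rewrite (eq_bigr (fun b => \sum_c if b == c then 0 else \sum_y \sum_z
      M (x b) y * (M (x c) z * f (fupd (fupd x b y) c z)))); last first.
  move=> b _; apply: eq_bigr => c _; case: eqVneq => [<-|bc].
    rewrite exchange_big /= big1 // => z _.
    under eq_bigr do rewrite fupd_eq fupd_fupd mulrA.
    by rewrite -mulr_suml MM mul0r.
  by apply: eq_bigr => y _; apply: eq_bigr => z _; rewrite (fupd_neq _ _ (i:=b)) // eq_sym.
apply: (sum_char2_sym ch2) => [b c|b]; last by rewrite eqxx.
rewrite eq_sym; case: eqVneq => // bc.
rewrite exchange_big /=; apply: eq_bigr => y _; apply: eq_bigr => z _.
by rewrite mulrCA fupd_comm // eq_sym.
Qed.

(** As the square of D is 0, both D (D s + s D) and (D s + s D) D reduce to D s D. *)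
Lemma bdry_comm_bdry (F : comNzRingType) (B : finType) k (M : B -> B -> F) (s f : {ffun 'I_k -> B} -> F) x :
  (forall x : F, x + x = 0) ->
  (forall x z, \sum_y M x y * M y z = 0) ->
  bdry M (comm_bdry M s f) x = comm_bdry M s (bdry M f) x.
Proof.
move=> ch2 MM; rewrite (eq_bdry M (comm_bdryE M s f)) bdryD bdry_bdry // add0r.
by rewrite comm_bdryE bdry_bdry // mulr0 addr0.
Qed.

Lemma bdry_comm_chain (F : comNzRingType) (B : finType) k (M : B -> B -> F) l (f : {ffun 'I_k -> B} -> F) x :
  (forall x : F, x + x = 0) ->
  (forall x z, \sum_y M x y * M y z = 0) ->
  bdry M (comm_chain M l f) x = comm_chain M l (bdry M f) x.
Proof.
move=> ch2 MM; elim: l x => //= s l IH x.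
by rewrite bdry_comm_bdry //; apply: eq_comm_bdry.
Qed.

(** * Equivariance under the sign group and integration over a fundamental domain *)

Definition flip_at (B : finType) (k : nat) (nu : B -> B) (b : 'I_k)
    (x : {ffun 'I_k -> B}) : {ffun 'I_k -> B} := fupd x b (nu (x b)).

Definition on_cells (B : finType) (k : nat) (K : pred B) (x : {ffun 'I_k -> B}) :=
  [forall b, K (x b)].

Definition flip_inv (F : comNzRingType) (B : finType) (k : nat) (K : pred B) (nu : B -> B)
    (f : {ffun 'I_k -> B} -> F) :=
  forall x b, on_cells K x -> f (flip_at nu b x) = f x.

(** The sign group acts through the character indexed by [S], written additively. *)
Definition flip_equiv (F : comNzRingType) (B : finType) (k : nat) (K : pred B) (nu : B -> B)
    (S : {set 'I_k}) (f : {ffun 'I_k -> B} -> F) :=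
  forall x b, on_cells K x -> f (flip_at nu b x) = f x + (b \in S)%:R.

(** In each factor [s] keeps one cell of every antipodal pair of the class [kap], so this is an
    integral over the quotient by all flips. *)
Definition orient_sum (F : comNzRingType) (B : finType) (k : nat) (kap : B -> F) (s : pred B)
    (f : {ffun 'I_k -> B} -> F) : F :=
  \sum_(x : {ffun 'I_k -> B}) (\prod_b (kap (x b) * (s (x b))%:R)) * f x.

Lemma eq_orient_sum (F : comNzRingType) (B : finType) k (kap : B -> F) (s : pred B) (f g : {ffun 'I_k -> B} -> F) :
  (forall x : {ffun 'I_k -> B}, (forall b, kap (x b) != 0) -> f x = g x) ->
  orient_sum kap s f = orient_sum kap s g.
Proof.
move=> fg; apply: eq_bigr => x _.
case: (boolP [forall b, kap (x b) != 0]) => [/forallP h|]; first by rewrite fg.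
rewrite negb_forall => /existsP[b]; rewrite negbK => /eqP kb.
by rewrite (bigD1 b) //= kb !mul0r.
Qed.
(* An abstract antipodal cell complex: M is the incidence matrix mod 2, K the
   subcomplex carrying the free involution nu, kap its top class, and s selects
   one cell of each antipodal pair. *)
Record antipodal (F : comNzRingType) (B : finType) (M : B -> B -> F)
    (K : pred B) (nu : B -> B) (kap : B -> F) (s : pred B) : Prop := Antipodal {
  anti_M1 : forall x, \sum_y M x y = 0;
  anti_MM : forall x z, \sum_y M x y * M y z = 0;
  anti_kM : forall y, \sum_x kap x * M x y = 0;
  anti_MK : forall x y, M x y != 0 -> K x -> K y;
  anti_kK : forall x, kap x != 0 -> K x;
  anti_nuK : forall x, nu (nu x) = x;
  anti_Knu : forall x, K (nu x) = K x;
  anti_Mnu : forall x y, M (nu x) (nu y) = M x y;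
  anti_knu : forall x, kap (nu x) = kap x;
  anti_snu : forall x, K x -> s (nu x) = ~~ s x }.

Lemma flip_atK (B : finType) k (nu : B -> B) (b : 'I_k) :
  involutive nu -> involutive (flip_at nu b).
Proof.
move=> nuK x; rewrite /flip_at fupd_fupd fupd_eq nuK; exact: fupd_id.
Qed.

Lemma on_cells_fupd (B : finType) k (K : pred B) (x : {ffun 'I_k -> B}) b y :
  on_cells K x -> K y -> on_cells K (fupd x b y).
Proof.
move=> /forallP Kx Ky; apply/forallP => c.
by rewrite fupdE; case: eqP.
Qed.

Lemma comm_bdry_inv (F : comNzRingType) (B : finType) k (M : B -> B -> F)
    K nu kap s (t f : {ffun 'I_k -> B} -> F) (S : {set 'I_k}) :
  (forall x : F, x + x = 0) ->
  antipodal M K nu kap s -> flip_equiv K nu S t -> flip_inv K nu f ->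
  flip_inv K nu (comm_bdry M t f).
Proof.
move=> ch2 [_ _ _ MK _ nuK Knu Mnu _ _] te fi x b Kx.
apply: eq_bigr => c _.
have aux (y u v : B) : M u v = M (x c) y ->
    fupd (flip_at nu b x) c v = flip_at nu b (fupd x c y) ->
    M u v * ((t (flip_at nu b x) + t (fupd (flip_at nu b x) c v)) *
      f (fupd (flip_at nu b x) c v)) =
    M (x c) y * ((t x + t (fupd x c y)) * f (fupd x c y)).
  move=> Meq ->; rewrite Meq.
  have [->|Mn] := eqVneq (M (x c) y) 0; first by rewrite !mul0r.
  have Ky : on_cells K (fupd x c y).
    by apply: on_cells_fupd => //; apply: MK Mn _; apply: (forallP Kx).
  rewrite fi // !te //; congr (_ * (_ * _)).
  by rewrite addrACA ch2 addr0.
case: (eqVneq b c) aux => [<-|bc] aux.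
  rewrite (reindex_inj (inv_inj nuK)) /=; apply: eq_bigr => y _.
  apply: aux; first by rewrite /flip_at fupd_eq Mnu.
  by rewrite /flip_at !fupd_fupd fupd_eq.
apply: eq_bigr => y _; apply: aux; first by rewrite /flip_at fupd_neq // eq_sym.
by rewrite /flip_at fupd_comm // fupd_neq.
Qed.

Lemma comm_chain_inv (F : comNzRingType) (B : finType) k (M : B -> B -> F)
    K nu kap s (l : seq ({set 'I_k} * ({ffun 'I_k -> B} -> F)))
    (f : {ffun 'I_k -> B} -> F) :
  (forall x : F, x + x = 0) -> antipodal M K nu kap s ->
  List.Forall (fun p => flip_equiv K nu p.1 p.2) l ->
  flip_inv K nu f -> flip_inv K nu (comm_chain M (map snd l) f).
Proof.
move=> ch2 anti; elim: l => [//|[S t] l IH] /List.Forall_cons_iff[et el] fi /=.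
apply: (comm_bdry_inv (S := S) ch2 anti); first exact: et.
exact: IH.
Qed.

Lemma sum_free_invol (F : comNzRingType) (X : finType) (phi : X -> X)
    (P : pred X) (g : X -> F) :
  (forall x : F, x + x = 0) -> involutive phi ->
  (forall x, g (phi x) = g x) -> (forall x, g x != 0 -> P (phi x) = ~~ P x) ->
  \sum_x g x = 0.
Proof.
move=> ch2 phiK gphi Pphi.
have -> : \sum_x g x = \sum_(x | g x != 0) g x.
  by rewrite [RHS]big_mkcond; apply: eq_bigr => x _; case: eqP => // ->.
rewrite (bigID P) /= [X in _ + X](reindex_inj (inv_inj phiK)) /=.
rewrite [X in _ + X](eq_bigl (fun x => (g x != 0) && P x)) /=; last first.
  move=> x; rewrite gphi; have [//|gx] := eqVneq (g x) 0.
  by rewrite Pphi // negbK.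
by under [X in _ + X]eq_bigr do rewrite gphi; rewrite ch2.
Qed.

(** Stokes on the quotient: what remains at the edge of the fundamental domain is flip invariant and
    cancels in antipodal pairs. *)
Lemma orient_sum_bdry (F : comNzRingType) (B : finType) k (M : B -> B -> F)
    K nu kap s (f : {ffun 'I_k -> B} -> F) :
  (forall x : F, x + x = 0) -> antipodal M K nu kap s -> flip_inv K nu f ->
  orient_sum kap s (bdry M f) = 0.
Proof.
move=> ch2 anti fi; have [_ _ kM MK kK nuK Knu Mnu knu snu] := anti.
rewrite /orient_sum /bdry; under eq_bigr do rewrite mulr_sumr.
rewrite exchange_big /= big1 // => b _.
have sflip x : K x -> (s (nu x))%:R = (s x)%:R + 1 :> F.
  by move=> /snu ->; case: (s x); rewrite ?add0r // ch2.
pose w (x : {ffun 'I_k -> B}) : F := \prod_(a | a != b) (kap (x a) * (s (x a))%:R).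
have wE (x : {ffun 'I_k -> B}) y : w (fupd x b y) = w x.
  by apply: eq_bigr => a ab; rewrite fupd_neq.
pose g (x : {ffun 'I_k -> B}) : F := w x * kap (x b) *
  (\sum_y M (x b) y * (((s (x b))%:R + (s y)%:R) * f (fupd x b y))).
(* Split [s (x b)] as [s y] plus the jump across the facet. The first sum dies because [kap] is a
   cycle, once [x b] and [y] are exchanged; the second, [g], by pairing [x] with its flip. *)
have -> : \sum_(x : {ffun 'I_k -> B}) \prod_a (kap (x a) * (s (x a))%:R) *
      (\sum_y M (x b) y * f (fupd x b y)) =
    \sum_(x : {ffun 'I_k -> B}) \sum_y
      w x * kap (x b) * M (x b) y * ((s y)%:R * f (fupd x b y)) + \sum_(x : {ffun 'I_k -> B}) g x.
  apply: etrans (big_split _ _ _ _ _); apply: eq_bigr => x _ /=.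
  rewrite (bigD1 b) //= -/(w x) /g !mulr_sumr -big_split /=; apply: eq_bigr => y _.
  move: (s (x b))%:R (s y)%:R => sx sy.
  have h := ch2 (w x * kap (x b) * M (x b) y * sy * f (fupd x b y)).
  by rewrite -[LHS]addr0 -h; ring.
rewrite (@sum_fupd_exchange 'I_k B F b) big1 ?add0r; last first.
  move=> x _; rewrite (eq_bigr (fun y => w x * ((s (x b))%:R * f x) * (kap y * M y (x b)))).
    by rewrite -mulr_sumr kM mulr0.
  by move=> y _; rewrite wE fupd_eq fupd_fupd fupd_id; ring.
have Kg x : g x != 0 -> on_cells K x.
  move=> gx; apply/forallP => a; apply: kK; apply: contraNneq gx => ka.
  rewrite /g; have [->|ab] := eqVneq b a; first by rewrite ka mulr0 mul0r.
  by rewrite /w (bigD1 a) /= 1?eq_sym // ka !mul0r.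
have gflip x : on_cells K x -> g (flip_at nu b x) = g x.
  move=> Kx; rewrite /g /flip_at wE fupd_eq knu; congr (_ * _).
  rewrite (reindex_inj (inv_inj nuK)) /=; apply: eq_bigr => y _; rewrite Mnu.
  have [->|Mn] := eqVneq (M (x b) y) 0; first by rewrite !mul0r.
  have Kb : K (x b) by apply: (forallP Kx).
  have Ky : K y by apply: MK Mn _.
  rewrite !sflip // fupd_fupd; congr (_ * (_ * _)); first by rewrite addrACA ch2 addr0.
  rewrite -[RHS](fi _ b); last exact: on_cells_fupd.
  by rewrite /flip_at !fupd_fupd fupd_eq.
apply: (sum_free_invol ch2 (phi := flip_at nu b) (P := fun x => s (x b))).
- exact: flip_atK.
- move=> x; have [Kx|nKx] := boolP (on_cells K x); first exact: gflip.
  have [->|/Kg gx] := eqVneq (g x) 0; last by rewrite gx in nKx.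
  apply/eqP; apply: contraNT nKx => /Kg; rewrite -{2}(flip_atK b nuK x).
  move=> h; apply: on_cells_fupd => //.
  by rewrite Knu; apply: (forallP h).
- by move=> x /Kg/forallP Kx; rewrite /flip_at fupd_eq snu.
Qed.

Lemma orient_sumD (F : comNzRingType) (B : finType) k (kap : B -> F) (s : pred B)
    (f g : {ffun 'I_k -> B} -> F) :
  orient_sum kap s (fun x => f x + g x) = orient_sum kap s f + orient_sum kap s g.
Proof. by rewrite -big_split /=; apply: eq_bigr => x _; rewrite mulrDr. Qed.

(* Replacing t by a cohomologous u changes the chain by comm_bdry c with
   c = t + u invariant, and comm_bdry c f = d (c f) + c (d f) where d commutes
   with everything, kills 1 on the right and dies under orient_sum. *)
Lemma orient_sum_swap (F : comNzRingType) (B : finType) k (M : B -> B -> F)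
    K nu kap s (l1 : seq ({set 'I_k} * ({ffun 'I_k -> B} -> F)))
    (l2 : seq ({set 'I_k} * ({ffun 'I_k -> B} -> F)))
    (t u : {ffun 'I_k -> B} -> F) (S : {set 'I_k}) :
  (forall x : F, x + x = 0) -> antipodal M K nu kap s ->
  List.Forall (fun p => flip_equiv K nu p.1 p.2) l1 ->
  List.Forall (fun p => flip_equiv K nu p.1 p.2) l2 ->
  flip_equiv K nu S t -> flip_equiv K nu S u ->
  orient_sum kap s (comm_chain M (map snd l1)
    (comm_bdry M t (comm_chain M (map snd l2) (fun=> 1)))) =
  orient_sum kap s (comm_chain M (map snd l1)
    (comm_bdry M u (comm_chain M (map snd l2) (fun=> 1)))).
Proof.
move=> ch2 anti e1 e2 et eu; have MM := anti_MM anti.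
set f := comm_chain M (map snd l2) _.
have fi : flip_inv K nu f by apply: (comm_chain_inv ch2 anti e2).
pose c x := t x + u x.
have ci : flip_inv K nu c.
  by move=> x b Kx; rewrite /c et // eu // addrACA ch2 addr0.
have tE x : comm_bdry M t f x = comm_bdry M u f x + comm_bdry M c f x.
  rewrite /comm_bdry -big_split /=; apply: eq_bigr => b _.
  rewrite -big_split /=; apply: eq_bigr => y _; rewrite -mulrDr -mulrDl /c.
  have := ch2 (u x); have := ch2 (u (fupd x b y)).
  move: (u x) (u (fupd x b y)) => v w vv ww.
  rewrite (_ : v + w + _ = (v + v) + (w + w) + (t x + t (fupd x b y))); last by ring.
  by rewrite vv ww !add0r.
have bdf x : bdry M f x = 0.
  rewrite bdry_comm_chain // -(_ : comm_chain M (map snd l2) (fun=> 0) x = 0); last first.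
    elim: (map snd l2) x => //= v l IH x.
    by apply: big1 => b _; apply: big1 => y _; rewrite IH !mulr0.
  by apply: eq_comm_chain => y; apply: bdry_cst; apply: anti_M1 anti.
have cE x : comm_bdry M c f x = bdry M (fun y => c y * f y) x.
  by rewrite comm_bdryE bdf mulr0 addr0.
have cfi : flip_inv K nu (fun y => c y * f y).
  by move=> x b Kx; rewrite ci // fi.
rewrite (@eq_orient_sum _ _ _ kap s _ (fun x =>
    comm_chain M (map snd l1) (comm_bdry M u f) x +
    bdry M (comm_chain M (map snd l1) (fun y => c y * f y)) x)).
  rewrite orient_sumD (orient_sum_bdry ch2 anti) ?addr0 //.
  exact: (comm_chain_inv ch2 anti e1).
move=> x _; rewrite bdry_comm_chain // -comm_chainD.
by apply: eq_comm_chain => y; rewrite tE cE.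
Qed.

(** The model sign function of character [S]. Being a sum of signs of single coordinates, it lets a
    chain of commutators expand into words. *)
Definition char_sign (F : comNzRingType) (B : finType) k (s : pred B)
    (S : {set 'I_k}) (x : {ffun 'I_k -> B}) : F := \sum_(a in S) (s (x a))%:R.

Lemma char_sign_equiv (F : comNzRingType) (B : finType) k (M : B -> B -> F)
    K nu kap s (S : {set 'I_k}) :
  (forall x : F, x + x = 0) -> antipodal M K nu kap s ->
  flip_equiv K nu S (@char_sign F B k s S).
Proof.
move=> ch2 anti x b /forallP Kx; rewrite /char_sign.
have [bS|bS] := boolP (b \in S).
  rewrite (bigD1 b) //= [in RHS](bigD1 b) //= /flip_at fupd_eq (anti_snu anti) //.
  rewrite addrAC; congr (_ + _); first by case: (s _); rewrite ?add0r // ch2.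
  by apply: eq_bigr => a /andP[_ ab]; rewrite fupd_neq.
rewrite addr0; apply: eq_bigr => a aS; rewrite fupd_neq //.
by apply: contraNneq bS => <-.
Qed.

Lemma orient_sum_chain (F : comNzRingType) (B : finType) k (M : B -> B -> F)
    K nu kap s (l : seq ({set 'I_k} * ({ffun 'I_k -> B} -> F))) :
  (forall x : F, x + x = 0) -> antipodal M K nu kap s ->
  List.Forall (fun p => flip_equiv K nu p.1 p.2) l ->
  orient_sum kap s (comm_chain M (map snd l) (fun=> 1)) =
  orient_sum kap s (comm_chain M (map (@char_sign F B k s) (map fst l)) (fun=> 1)).
Proof.
move=> ch2 anti el.
(* [l1] holds the outer operators, already replaced by model signs; the head of [l2] is swapped and
   moved there. *)
have gen (l1 l2 : seq ({set 'I_k} * ({ffun 'I_k -> B} -> F))) :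
  List.Forall (fun p => flip_equiv K nu p.1 p.2) l1 ->
  List.Forall (fun p => flip_equiv K nu p.1 p.2) l2 ->
  orient_sum kap s (comm_chain M (map snd l1) (comm_chain M (map snd l2) (fun=> 1))) =
  orient_sum kap s (comm_chain M (map snd l1)
     (comm_chain M (map (@char_sign F B k s) (map fst l2)) (fun=> 1))).
  elim: l2 l1 => [//|[S t] l2 IH] l1 e1 /List.Forall_cons_iff[et e2] /=.
  rewrite (orient_sum_swap ch2 anti e1 e2 et (char_sign_equiv S ch2 anti)).
  have := IH (rcons l1 (S, @char_sign F B k s S)).
  rewrite /comm_chain map_rcons !foldr_rcons; apply=> //.
  rewrite -cats1; apply/List.Forall_app; split => //.
  by constructor => //; apply: char_sign_equiv anti.
by have := gen [::] l (List.Forall_nil _) el.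
Qed.

(** * Evaluating model signs: words and products of linear forms *)

Definition mmon (k : nat) (e : 'I_k -> nat) : multinom k :=
  Multinom (mktuple e).

Lemma mmonE k (e : 'I_k -> nat) a : mmon e a = e a.
Proof. exact: mnmE. Qed.

Fixpoint choice_words (k : nat) (l : seq {set 'I_k}) : seq (seq 'I_k) :=
  if l is A :: l' then [seq a :: w | a <- enum A, w <- choice_words l'] else [:: [::]].

Lemma size_choice_words k (l : seq {set 'I_k}) w :
  w \in choice_words l -> size w = size l.
Proof.
elim: l w => [|S l IH] w /=; first by rewrite inE => /eqP ->.
by move=> /allpairsP[[a v] /= [_ /IH <- ->]].
Qed.

Definition linear_forms (F : comNzRingType) (k : nat) (l : seq {set 'I_k}) : mpoly k F :=
  \prod_(S <- l) \sum_(a in S) mpolyX F (mnm1 a).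

Lemma linear_forms_words (F : comNzRingType) k (l : seq {set 'I_k}) :
  linear_forms F l = \sum_(w <- choice_words l) \prod_(a <- w) mpolyX F (mnm1 a).
Proof.
rewrite /linear_forms; elim: l => [|S l IH] /=; first by rewrite !(big_nil, big_seq1).
rewrite big_cons IH big_allpairs_dep /= mulr_suml big_enum /=.
apply: eq_bigr => a _; rewrite mulr_sumr; apply: eq_bigr => w _.
by rewrite big_cons.
Qed.

Lemma prod_mpolyX (F : comNzRingType) k (w : seq 'I_k) :
  \prod_(a <- w) mpolyX F (mnm1 a) = mpolyX F (mmon (fun a => count_mem a w)).
Proof.
elim: w => [|b w IH].
  by rewrite big_nil -mpolyX0; congr mpolyX; apply/mnmP => a; rewrite mmonE mnm0E.
rewrite big_cons IH -mpolyXD; congr mpolyX; apply/mnmP => a.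
by rewrite mnmDE mnm1E !mmonE.
Qed.

Definition sign_iter (F : comNzRingType) (B : finType) (M : B -> B -> F) (s : pred B)
    (n : nat) : B -> F :=
  iter n (fun f y => \sum_z M y z * (((s y)%:R + (s z)%:R) * f z)) (fun=> 1).

(** A sign of factor [a] jumps only along steps in factor [a], so each letter acts on its own factor
    and the composite splits as a product. *)
Lemma comm_chain_word (F : comNzRingType) (B : finType) k (M : B -> B -> F)
    (s : pred B) (w : seq 'I_k) (x : {ffun 'I_k -> B}) :
  (forall x : F, x + x = 0) ->
  comm_chain M [seq (fun y : {ffun 'I_k -> B} => (s (y a))%:R) | a <- w] (fun=> 1) x =
  \prod_a sign_iter M s (count_mem a w) (x a).
Proof.
move=> ch2; elim: w x => [|a w IH] x /=; first by rewrite big1.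
rewrite (eq_comm_bdry M (frefl _) IH) /comm_bdry (bigD1 a) //=.
rewrite [X in _ + X]big1 ?addr0; last first.
  move=> b ba; apply: big1 => y _.
  by rewrite fupd_neq 1?eq_sym // ch2 mul0r mulr0.
rewrite [RHS](bigD1 a) //= eqxx add1n /= mulr_suml; apply: eq_bigr => y _.
rewrite (bigD1 a) //= fupd_eq -!mulrA; congr (_ * (_ * (_ * _))).
apply: eq_bigr => b ba.
by rewrite fupd_neq // eq_sym (negPf ba).
Qed.

Lemma comm_chain_char (F : comNzRingType) (B : finType) k (M : B -> B -> F)
    (s : pred B) (l : seq {set 'I_k}) (x : {ffun 'I_k -> B}) :
  (forall x : F, x + x = 0) ->
  comm_chain M (map (@char_sign F B k s) l) (fun=> 1) x =
  \sum_(w <- choice_words l) \prod_a sign_iter M s (count_mem a w) (x a).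
Proof.
move=> ch2; rewrite (eq_bigr (fun w => comm_chain M
  [seq (fun y : {ffun 'I_k -> B} => (s (y a))%:R) | a <- w] (fun=> 1) x)); last first.
  by move=> w _; rewrite comm_chain_word.
elim: l x => [|S l IH] x /=; first by rewrite big_seq1.
rewrite (eq_comm_bdry M (s := char_sign F s S)
  (t := fun y => \sum_(a <- enum S) (s (y a))%:R) _ (frefl _)); last first.
  by move=> y; rewrite /char_sign big_enum.
rewrite comm_bdry_suml big_allpairs_dep /=; apply: eq_bigr => a _.
by rewrite (eq_comm_bdry M (frefl _) IH) comm_bdry_sum.
Qed.

Lemma count_mem_sum k (w : seq 'I_k) : (\sum_a count_mem a w = size w)%N.
Proof.
elim: w => [|b w IH] /=; first by rewrite big1.
by rewrite big_split /= IH (bigD1 b) //= eqxx big1 ?addn0 // => a /negPf; rewrite eq_sym => ->.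
Qed.

(** The letter counts of a word add up to [k * d]. Unless all equal [d], one of them exceeds [d] and
    its factor evaluates to 0; hence evaluations from [d] upwards suffice. *)
Lemma orient_sum_char (F : comNzRingType) (B : finType) k d (M : B -> B -> F)
    (kap : B -> F) (s : pred B) (l : seq {set 'I_k}) :
  (forall x : F, x + x = 0) ->
  (forall n, (d <= n)%N ->
     \sum_x kap x * (s x)%:R * sign_iter M s n x = (n == d)%:R) ->
  size l = (k * d)%N ->
  orient_sum kap s (comm_chain M (map (@char_sign F B k s) l) (fun=> 1)) =
  mcoeff (mmon (fun=> d)) (linear_forms F l).
Proof.
move=> ch2 ev sl.
rewrite linear_forms_words raddf_sum /orient_sum /=.
under eq_bigr do rewrite comm_chain_char // mulr_sumr.
rewrite exchange_big /=; apply: eq_big_seq => w /size_choice_words sw.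
rewrite prod_mpolyX mcoeffX.
under eq_bigr do rewrite -big_split /=.
rewrite -(bigA_distr_bigA (fun a y => kap y * (s y)%:R * sign_iter M s (count_mem a w) y)).
have [all_d|/forallPn[a ad]] := boolP [forall a, count_mem a w == d].
  have -> : mmon (fun a => count_mem a w) == mmon (fun=> d).
    by apply/eqP/mnmP => a; rewrite !mmonE; apply/eqP; apply: (forallP all_d).
  by apply: big1 => a _; rewrite (eqP (forallP all_d a)) ev // eqxx.
rewrite (_ : _ == _ = false); last first.
  by apply: contraNF ad => /eqP/mnmP/(_ a); rewrite !mmonE => ->.
suff [b bd] : exists b, (d < count_mem b w)%N.
  by rewrite (bigD1 b) //= ev ?(ltnW bd) // gtn_eqF ?mul0r.
apply/existsP; apply: contraT => /existsPn h.
have : (\sum_(b < k) count_mem b w < \sum_(b < k) d)%N.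
  rewrite (bigD1 a) //= [X in (_ < X)%N](bigD1 a) //= -addSn leq_add //.
    by rewrite ltn_neqAle ad leqNgt h.
  by apply: leq_sum => b _; rewrite leqNgt h.
by rewrite count_mem_sum sw sl sum_nat_const card_ord ltnn.
Qed.

(** * The cubical grid on the surface of a cube *)

Definition block (n d : nat) := {ffun 'I_d.+1 -> 'I_(4 * n).+1}.

Definition below (m : nat) (v : 'I_m.+1) : 'I_m.+1 := inord v.-1.
Definition above (m : nat) (v : 'I_m.+1) : 'I_m.+1 := inord v.+1.

(* Cells of the grid on the cube [-n, n]^(d+1), refined by doubling and shifted
   by 2n: an even coordinate is a point, an odd one an open unit interval. *)
Definition grid_M (F : comNzRingType) (n d : nat) (x y : block n d) : F :=
  \sum_i if odd (x i) then (y == fupd x i (below (x i)))%:R +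
                           (y == fupd x i (above (x i)))%:R else 0.

Definition grid_K (n d : nat) (x : block n d) : bool :=
  [exists i, (x i == 0 :> nat) || (x i == 4 * n :> nat)%N].

Definition grid_nu (n d : nat) (x : block n d) : block n d :=
  [ffun i => rev_ord (x i)].

Definition all_odd (n d : nat) (x : block n d) : bool := [forall i, odd (x i)].

(** Taken as the boundary of the sum of all top cells, so that being a cycle follows from [grid_MM];
    [grid_kapE] identifies it with the facets on the surface. *)
Definition grid_kap (F : comNzRingType) (n d : nat) (x : block n d) : F :=
  \sum_y (all_odd y)%:R * grid_M F y x.

(* The sign of the last coordinate that differs from the centre 2n. *)
Definition grid_s (n d : nat) (x : block n d) : bool :=
  [exists i, (2 * n < x i)%N && [forall j : 'I_d.+1, (i < j)%N ==> (x j == 2 * n :> nat)%N]].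

Lemma val_below m (v : 'I_m.+1) : below v = v.-1 :> nat.
Proof. by rewrite inordK //; have := ltn_ord v; lia. Qed.

Lemma val_above m (v : 'I_m.+1) : (v < m)%N -> above v = v.+1 :> nat.
Proof. by move=> h; rewrite inordK. Qed.

Lemma odd_below m (v : 'I_m.+1) : odd v -> odd (below v) = false.
Proof. by rewrite val_below; case: (nat_of_ord v) => //= u /negPf. Qed.

Lemma odd_lt n (v : 'I_(4 * n).+1) : odd v -> (v < 4 * n)%N.
Proof. by move=> ov; have := ltn_ord v; move: ov; lia. Qed.

Lemma odd_above n (v : 'I_(4 * n).+1) : odd v -> odd (above v) = false.
Proof. by move=> ov; rewrite val_above ?odd_lt //= ov. Qed.

Lemma val_rev n (v : 'I_(4 * n).+1) : rev_ord v = (4 * n - v)%N :> nat.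
Proof. by rewrite /= subSS. Qed.

Lemma rev_below n (v : 'I_(4 * n).+1) : odd v -> rev_ord (below v) = above (rev_ord v).
Proof.
move=> ov; have lv := odd_lt ov; apply/ord_inj.
rewrite val_rev val_above ?val_rev ?val_below; lia.
Qed.

Lemma rev_above n (v : 'I_(4 * n).+1) : odd v -> rev_ord (above v) = below (rev_ord v).
Proof.
move=> ov; have lv := odd_lt ov; apply/ord_inj.
rewrite val_rev val_below val_above ?val_rev; lia.
Qed.

Lemma odd_rev n (v : 'I_(4 * n).+1) : odd (rev_ord v) = odd v.
Proof. by have := ltn_ord v; rewrite val_rev; lia. Qed.

Lemma grid_M_sum (F : comNzRingType) n d (x : block n d) (g : block n d -> F) :
  \sum_y grid_M F x y * g y =
  \sum_i if odd (x i) then g (fupd x i (below (x i))) + g (fupd x i (above (x i))) else 0.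
Proof.
under eq_bigr do rewrite mulr_suml.
rewrite exchange_big /=; apply: eq_bigr => i _.
case: ifP => oi; last by apply: big1 => y _; rewrite mul0r.
under eq_bigr do rewrite mulrDl.
have one (z : block n d) : \sum_y (y == z)%:R * g y = g z.
  rewrite (bigD1 z) //= eqxx mul1r big1 ?addr0 // => y /negPf ->.
  by rewrite mul0r.
by rewrite big_split /= !one.
Qed.

Lemma grid_M_neq0 (F : comNzRingType) n d (x y : block n d) :
  grid_M F x y != 0 -> exists2 i, odd (x i) &
    y = fupd x i (below (x i)) \/ y = fupd x i (above (x i)).
Proof.
move=> Mn; apply: contrapT => h; case/eqP: Mn; apply: big1 => i _.
case: ifP => // oi; case: eqP => [e|_]; first by case: h; exists i => //; left.
case: eqP => [e|_]; first by case: h; exists i => //; right.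
by rewrite addr0.
Qed.

Lemma grid_MM (F : comNzRingType) n d (x z : block n d) :
  (forall x : F, x + x = 0) -> \sum_y grid_M F x y * grid_M F y z = 0.
Proof.
move=> ch2; rewrite grid_M_sum.
pose G (y : block n d) j := if odd (y j) then (z == fupd y j (below (y j)))%:R +
                           (z == fupd y j (above (y j)))%:R else 0 : F.
pose T i j := if odd (x i) then G (fupd x i (below (x i))) j +
                                G (fupd x i (above (x i))) j else 0.
rewrite (eq_bigr (fun i => \sum_j T i j)); last first.
  move=> i _; rewrite /T; case: ifP => oi; first by rewrite big_split.
  by rewrite big1.
apply: (sum_char2_sym ch2) => [i j|i]; last first.
  by rewrite /T /G !fupd_eq; case: ifP => // oi; rewrite odd_below // odd_above // addr0.
have [->//|ij] := eqVneq i j.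
have ji : j != i by rewrite eq_sym.
rewrite /T /G !(fupd_neq _ _ ji) !(fupd_neq _ _ ij).
case: ifP => oi; case: ifP => oj; rewrite ?addr0 //.
by rewrite addrACA; congr (_ + _ + (_ + _)); rewrite (fupd_comm _ _ _ ij).
Qed.

Lemma grid_kM (F : comNzRingType) n d (z : block n d) :
  (forall x : F, x + x = 0) -> \sum_x grid_kap F x * grid_M F x z = 0.
Proof.
move=> ch2; under eq_bigr do rewrite mulr_suml.
rewrite exchange_big big1 //= => y _.
under eq_bigr do rewrite -mulrA.
by rewrite -mulr_sumr grid_MM // mulr0.
Qed.

Lemma grid_MK (F : comNzRingType) n d (x y : block n d) :
  grid_M F x y != 0 -> grid_K x -> grid_K y.
Proof.
move=> /grid_M_neq0[i oi yE] /existsP[j xj]; apply/existsP; exists j.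
have ij : j != i.
  by apply: contraTneq oi => <-; case/orP: xj => /eqP ->; rewrite // mulnC oddM andbF.
by case: yE => ->; rewrite fupd_neq.
Qed.

(** An even coordinate strictly inside the range lies between two odd ones, giving two top cells
    that cancel; at 0 or [4 * n] there is only one. *)
Lemma grid_kapE (F : comNzRingType) n d (x : block n d) :
  (0 < n)%N -> (forall x : F, x + x = 0) ->
  grid_kap F x = \sum_i ([forall j, (j != i) ==> odd (x j)] &&
    ((x i == 0 :> nat) || (x i == 4 * n :> nat)%N))%:R.
Proof.
move=> n0 ch2; rewrite /grid_kap.
under eq_bigr do rewrite mulr_sumr.
rewrite exchange_big /=; apply: eq_bigr => i _.
set C := [forall j, _].
have Cupd (v : 'I_(4 * n).+1) : odd v -> C = all_odd (fupd x i v).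
  move=> ov; apply/forallP/forallP => h j; have := h j; rewrite fupdE; case: eqP => //= _; exact.
(* [v] is the move to a facet, [w] its only odd preimage of [x i], and [b] says whether that
   preimage exists. *)
have key (v : 'I_(4 * n).+1 -> 'I_(4 * n).+1) (w : 'I_(4 * n).+1) (b : bool) :
    (forall u : 'I_(4 * n).+1, odd u -> (x i == v u) = b && (u == w)) -> (b -> odd w) ->
    \sum_y (all_odd y)%:R * (x == fupd y i (v (y i)))%:R = (C && b)%:R :> F.
  move=> vE bw; have [bt|bf] := boolP b; last first.
    rewrite andbF big1 // => y _; have [/forallP oy|] := boolP (all_odd y); last by rewrite mul0r.
    case: eqP => [e|]; last by rewrite mulr0.
    by have := vE _ (oy i); rewrite {1}e fupd_eq eqxx (negPf bf).
  rewrite andbT (bigD1 (fupd x i w)) //= fupd_fupd fupd_eq big1 ?addr0; last first.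
    move=> y yn; have [/forallP oy|] := boolP (all_odd y); last by rewrite mul0r.
    case: eqP => [e|]; last by rewrite mulr0.
    have := vE _ (oy i); rewrite {1}e fupd_eq eqxx bt => /esym/eqP ew.
    by move: yn; rewrite e fupd_fupd -ew fupd_id eqxx.
  rewrite -(Cupd w) ?bw //.
  by have := vE w (bw bt); rewrite bt eqxx => /eqP <-; rewrite fupd_id eqxx mulr1.
rewrite (eq_bigr (fun y : block n d =>
    (all_odd y)%:R * (x == fupd y i (below (y i)))%:R +
    (all_odd y)%:R * (x == fupd y i (above (y i)))%:R)); last first.
  move=> y _; have [/forallP oy|] := boolP (all_odd y); last by rewrite !mul0r addr0.
  by rewrite oy mulrDr.
have xn := ltn_ord (x i).
rewrite big_split /= (key (@below _) (above (x i)) (~~ odd (x i) && (x i < 4 * n)%N)); first last.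
- by case/andP => ox xl; rewrite val_above.
- move=> u ou; rewrite -!val_eqE /= val_below; have ul := odd_lt ou.
  have [xl|xl] := ltnP (x i) (4 * n); last by rewrite andbF /=; apply/negbTE/eqP; lia.
  rewrite val_above // andbT; move: (nat_of_ord (x i)) (nat_of_ord u) ou ul => a b ob bl.
  by apply/eqP/andP => [->|[oa /eqP ->//]]; case: b ob {bl} => //= b; rewrite eqxx.
rewrite (key (@above _) (below (x i)) (~~ odd (x i) && (0 < x i)%N)); first last.
- by case/andP => ox xl; rewrite val_below; lia.
- move=> u ou; rewrite -!val_eqE /= val_above ?odd_lt // val_below.
  move: (nat_of_ord (x i)) (nat_of_ord u) ou => a b ob.
  by apply/eqP/andP => [->|[/andP[_ a0] /eqP ->]]; rewrite ?prednK //= ob.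
case: C {Cupd key}; rewrite ?addr0 //=.
have [->|x0] := eqVneq (x i : nat) 0%N; first by rewrite muln_gt0 n0 addr0.
have [->|x1] := eqVneq (x i : nat) (4 * n)%N.
  by rewrite ltnn andbF add0r muln_gt0 n0 oddM.
rewrite lt0n x0 (_ : (x i < 4 * n)%N) ?ch2 //; lia.
Qed.

Lemma grid_kK (F : comNzRingType) n d (x : block n d) :
  (0 < n)%N -> (forall x : F, x + x = 0) -> grid_kap F x != 0 -> grid_K x.
Proof.
move=> n0 ch2; rewrite grid_kapE //; apply: contraNT => /existsPn h.
by apply/eqP; apply: big1 => i _; rewrite (negPf (h i)) andbF.
Qed.

Lemma grid_nuK n d : involutive (@grid_nu n d).
Proof. by move=> x; apply/ffunP => i; rewrite !ffunE rev_ordK. Qed.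

Lemma grid_Knu n d (x : block n d) : grid_K (grid_nu x) = grid_K x.
Proof.
apply: eq_existsb => i; rewrite ffunE val_rev; have := ltn_ord (x i) => xn.
by apply/orP/orP => -[] /eqP h; [right|left|right|left]; apply/eqP; lia.
Qed.

Lemma grid_nu_fupd n d (x : block n d) i v :
  grid_nu (fupd x i v) = fupd (grid_nu x) i (rev_ord v).
Proof. by apply/ffunP => j; rewrite !ffunE; case: eqP. Qed.

Lemma grid_Mnu (F : comNzRingType) n d (x y : block n d) :
  grid_M F (grid_nu x) (grid_nu y) = grid_M F x y.
Proof.
apply: eq_bigr => i _; rewrite !ffunE odd_rev; case: ifP => // oi.
rewrite addrC -rev_below // -rev_above // -!grid_nu_fupd.
by rewrite !(inj_eq (can_inj (@grid_nuK n d))).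
Qed.

Lemma grid_knu (F : comNzRingType) n d (x : block n d) :
  grid_kap F (grid_nu x) = grid_kap F x.
Proof.
rewrite /grid_kap (reindex_inj (inv_inj (@grid_nuK n d))) /=.
apply: eq_bigr => y _; rewrite grid_Mnu; congr (_%:R * _); congr (nat_of_bool _).
by apply: eq_forallb => i; rewrite ffunE odd_rev.
Qed.

Lemma grid_s_last n d (x : block n d) (i : 'I_d.+1) :
  (x i != 2 * n :> nat)%N -> (forall j : 'I_d.+1, (i < j)%N -> x j = (2 * n)%N :> nat) ->
  grid_s x = (2 * n < x i)%N.
Proof.
move=> xi h; apply/existsP/idP => [[j /andP[xj /forallP hj]]|xl].
  have [ij|ji|/ord_inj ->//] := ltngtP i j; first by rewrite h // ltnn in xj.
  by have := hj i; rewrite ji (negPf xi).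
by exists i; rewrite xl; apply/forallP => j; apply/implyP => ij; rewrite h.
Qed.

Lemma grid_K_last n d (x : block n d) : (0 < n)%N -> grid_K x ->
  exists2 i : 'I_d.+1, (x i != 2 * n :> nat)%N &
    forall j : 'I_d.+1, (i < j)%N -> x j = (2 * n)%N :> nat.
Proof.
move=> n0 /existsP[i0 hi0].
have x0 : (x i0 != 2 * n :> nat)%N by apply/eqP; case/orP: hi0 => /eqP ->; lia.
case: (@arg_maxnP _ i0 (fun i => (x i != 2 * n :> nat)%N) (fun i => i)) => // i xi h.
exists i => // j ij; apply/eqP; apply: contraTT ij => xj; rewrite -leqNgt; exact: h.
Qed.

Lemma grid_snu n d (x : block n d) : (0 < n)%N -> grid_K x ->
  grid_s (grid_nu x) = ~~ grid_s x.
Proof.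
move=> n0 /(grid_K_last n0)[i xi h].
rewrite (grid_s_last xi h) (@grid_s_last _ _ _ i); first last.
- by move=> j /h e; rewrite ffunE val_rev e; lia.
- by rewrite ffunE val_rev; have := ltn_ord (x i); move: xi; lia.
by rewrite ffunE val_rev; have := ltn_ord (x i); move: xi; lia.
Qed.

Lemma grid_antipodal (F : comNzRingType) n d :
  (0 < n)%N -> (forall x : F, x + x = 0) ->
  antipodal (@grid_M F n d) (@grid_K n d) (@grid_nu n d) (@grid_kap F n d) (@grid_s n d).
Proof.
move=> n0 ch2; split.
- move=> x; have := grid_M_sum x (fun=> 1 : F).
  under eq_bigr do rewrite mulr1; move=> ->; apply: big1 => i _; by rewrite ch2 if_same.
- by move=> *; apply: grid_MM.
- by move=> *; apply: grid_kM.
- exact: grid_MK.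
- by move=> x; apply: grid_kK.
- exact: grid_nuK.
- exact: grid_Knu.
- exact: grid_Mnu.
- exact: grid_knu.
- by move=> x; apply: grid_snu.
Qed.

(** * Counting sign changes on the grid *)

(* The unique cell (up to sign e) reached by m sign changes starting from a
   facet: alternating signs in the coordinates 0..m, centre afterwards. *)
Definition staircase (n d m : nat) (e : bool) : block n d :=
  [ffun i : 'I_d.+1 => inord (if i == 0 :> nat then (if e then 4 * n else 0)%N
     else if (i <= m)%N then (if e (+) odd i then (2 * n).+1 else (2 * n).-1)
     else (2 * n)%N)].

Lemma staircaseE n d m e (i : 'I_d.+1) : (0 < n)%N ->
  staircase n d m e i = (if i == 0 :> nat then (if e then 4 * n else 0)%N
     else if (i <= m)%N then (if e (+) odd i then (2 * n).+1 else (2 * n).-1)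
     else (2 * n)%N) :> nat.
Proof.
move=> n0; rewrite ffunE inordK //.
case: ifP => _; first by case: e; lia.
by case: ifP => _; [case: ifP => _|]; lia.
Qed.

Lemma staircase_neq n d m e (i : 'I_d.+1) : (0 < n)%N ->
  (staircase n d m e i != 2 * n :> nat)%N = (i <= m)%N.
Proof.
move=> n0; rewrite staircaseE //; have [->|i0] := eqVneq (i : nat) 0%N.
  by case: e; lia.
by case: ifP => // im; [case: ifP|rewrite eqxx]; lia.
Qed.

Lemma staircase_lt n d m e (i : 'I_d.+1) : (0 < n)%N -> (i <= m)%N ->
  (2 * n < staircase n d m e i)%N = e (+) odd i.
Proof.
move=> n0 im; rewrite staircaseE // im; have [->|i0] := eqVneq (i : nat) 0%N.
  by case: e => /=; lia.
by case: (_ (+) _); lia.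
Qed.

Lemma grid_s_staircase n d m e : (0 < n)%N -> (m <= d)%N ->
  grid_s (staircase n d m e) = e (+) odd m.
Proof.
move=> n0 md; have mE : (inord m : 'I_d.+1) = m :> nat by rewrite inordK.
rewrite (@grid_s_last _ _ _ (inord m)) ?staircase_neq // ?mE //.
  by rewrite staircase_lt ?mE.
move=> j mj; apply/eqP; apply: contraTT mj.
by rewrite staircase_neq // leqNgt.
Qed.

(** The sign is read off the last coordinate away from the centre, so only moving that one can
    change it; a unit step from an odd value cannot jump over [2 * n] and must land on it. *)
Lemma grid_s_change n d (x : block n d) i v :
  (0 < n)%N -> grid_K x -> odd (x i) -> v = below (x i) \/ v = above (x i) ->
  grid_s x != grid_s (fupd x i v) ->
  v = (2 * n)%N :> nat /\ forall j : 'I_d.+1, (i < j)%N -> x j = (2 * n)%N :> nat.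
Proof.
move=> n0 Kx oi vE; have [L xL h] := grid_K_last n0 Kx.
have [iL|Li|/ord_inj iL] := ltngtP i L.
- rewrite (grid_s_last xL h) (@grid_s_last _ _ (fupd x i v) L).
  + by rewrite fupd_neq ?eqxx // -(inj_eq val_inj) /= gtn_eqF.
  + by rewrite fupd_neq // -(inj_eq val_inj) /= gtn_eqF.
  by move=> j Lj; rewrite fupd_neq ?h // -(inj_eq val_inj) /= gtn_eqF // (ltn_trans iL).
- by move: oi; rewrite h // mulnC oddM andbF.
subst L; move=> sne; split=> //; apply/eqP; apply: contraNT sne => v2.
rewrite (grid_s_last xL h) (@grid_s_last _ _ (fupd x i v) i) ?fupd_eq //; last first.
  by move=> j ij; rewrite fupd_neq ?h // -(inj_eq val_inj) /= gtn_eqF.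
have xl := odd_lt oi.
have : (v = (x i).-1 :> nat \/ v = (x i).+1 :> nat).
  by case: vE => ->; [left; rewrite val_below|right; rewrite val_above].
move: (nat_of_ord (x i)) (nat_of_ord v) oi xL v2 {xl vE} => a b oa an bn h1.
by apply/eqP; lia.
Qed.

(** Induction on [m]: a contributing step must move coordinate [m.+1] onto the centre, leaving a
    cell of the previous stage. At [m = 0] membership in the surface forces coordinate 0 to be
    extreme, and beyond [d] no coordinate is left to move. *)
Lemma sign_iter_grid (F : comNzRingType) n d m (x : block n d) :
  (0 < n)%N -> (forall x : F, x + x = 0) -> grid_K x ->
  (forall j : 'I_d.+1, (m < j)%N -> x j = (2 * n)%N :> nat) ->
  sign_iter (@grid_M F n d) (@grid_s n d) m x =
  ((m <= d)%N && ((x == staircase n d m true) || (x == staircase n d m false)))%:R.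
Proof.
move=> n0 ch2; elim: m x => [|m IH] x Kx hx.
  rewrite /=; have [i xi hi] := grid_K_last n0 Kx.
  have i0 : i = ord0.
    by apply/ord_inj/eqP; rewrite -leqn0 leqNgt; apply/negP => /hx e; rewrite e eqxx in xi.
  have xe : (x ord0 == 0 :> nat) || (x ord0 == 4 * n :> nat)%N.
    case/existsP: Kx => j; have [->//|j0] := eqVneq j ord0.
    by rewrite hx ?lt0n //; case/orP => /eqP; lia.
  have st (e : bool) : x ord0 = (if e then 4 * n else 0)%N :> nat -> x == staircase n d 0 e.
    move=> x0; apply/eqP/ffunP => j; apply/ord_inj; rewrite staircaseE //.
    have [j0|j0] := eqVneq (j : nat) 0%N.
      by rewrite (_ : j = ord0) ?x0 //; apply: ord_inj.
    by rewrite hx ?lt0n // leqn0 (negPf j0).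
  by case/orP: xe => /eqP h; rewrite ?(st true h) ?(st false h) // orbT.
pose G (y : block n d) : F :=
  ((grid_s x)%:R + (grid_s y)%:R) * sign_iter (@grid_M F n d) (@grid_s n d) m y.
rewrite [LHS](grid_M_sum x G).
have Knb i v : odd (x i) -> grid_K (fupd x i v).
  move=> oi; case/existsP: Kx => j xj; apply/existsP; exists j.
  rewrite fupd_neq //; apply: contraTneq oi => <-.
  by case/orP: xj => /eqP ->; rewrite // mulnC oddM andbF.
have Gsame y : grid_s x = grid_s y -> G y = 0 by move=> e; rewrite /G e ch2 mul0r.
have Gdiff y : grid_s x != grid_s y -> G y = sign_iter (@grid_M F n d) (@grid_s n d) m y.
  by rewrite /G; case: (grid_s x); case: (grid_s y) => // _; rewrite ?add0r ?addr0 mul1r.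
(* A sign change puts coordinate [i] and all later ones at the centre; the facet is then a staircase
   by induction, and its noncentral coordinates force [i = m.+1]. *)
have Gnz i v : odd (x i) -> v = below (x i) \/ v = above (x i) -> G (fupd x i v) != 0 ->
    exists e, [/\ (m < d)%N, x = staircase n d m.+1 e, i = m.+1 :> nat
      & fupd x i v = staircase n d m e].
  move=> oi vE Gn; have sne : grid_s x != grid_s (fupd x i v).
    by apply: contraNneq Gn => /Gsame ->.
  have [v2 hj] := grid_s_change n0 Kx oi vE sne.
  have im : (i <= m.+1)%N.
    by rewrite leqNgt; apply: contraTN oi => /hx ->; rewrite mulnC oddM andbF.
  move: Gn; rewrite Gdiff // IH; last 2 first.
  - exact: Knb.
  - move=> j mj; rewrite fupdE; case: eqP => // ji.
    have [jm|jm] := ltnP m.+1 j; first exact: hx.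
    apply: hj; rewrite ltn_neqAle; apply/andP; split; first by apply/eqP => /ord_inj e; case: ji.
    lia.
  have [md|] := leqP m d; last by rewrite eqxx.
  case: (boolP (_ || _)) => [yE _|_]; last by rewrite eqxx.
  have {yE} [e yE] : exists e, fupd x i v = staircase n d m e.
    by case/orP: yE => /eqP ->; [exists true|exists false].
  have iE : i = m.+1 :> nat.
    apply/eqP; rewrite eqn_leq im /= ltnNge; apply/negP => le.
    by have := staircase_neq m e i n0; rewrite le -yE fupd_eq v2 eqxx.
  exists e; split => //; first by rewrite -ltnS -iE ltn_ord.
  move: sne; rewrite yE grid_s_staircase // (@grid_s_last _ _ x i) //; last first.
    by apply: contraTneq oi => ->; rewrite mulnC oddM andbF.
  move=> sne; apply/ffunP => j; apply/ord_inj; rewrite staircaseE //.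
  have [ji|ji] := eqVneq j i.
    rewrite ji iE leqnn /=; move: sne vE v2 => sne vE.
    have xl := odd_lt oi.
    have : (v = (x i).-1 :> nat \/ v = (x i).+1 :> nat).
      by case: vE => ->; [left; rewrite val_below|right; rewrite val_above].
    move: sne oi; move: (nat_of_ord (x i)) (nat_of_ord v) => a b sne oa h1 h2.
    move: sne; case: e {yE}; case: (odd m) => /=; case: ltnP => //; lia.
  have := congr1 (fun y : block n d => nat_of_ord (y j)) yE.
  rewrite fupd_neq // staircaseE // => ->.
  case: ifP => // _; rewrite (_ : (j <= m.+1)%N = (j <= m)%N) // leq_eqVlt ltnS -iE.
  by rewrite (inj_eq val_inj) (negPf ji).
have [/andP[md /orP xE]|ne] := boolP ((m < d)%N && _); last first.
  rewrite big1 // => i _; case: ifP => // oi.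
  have z v : v = below (x i) \/ v = above (x i) -> G (fupd x i v) = 0.
    move=> vE; apply/eqP; apply: contraNT ne => /(Gnz _ _ oi vE) [e [-> -> _ _]].
    by case: e; rewrite eqxx ?orbT.
  by rewrite !z ?addr0; [|right|left].
have {xE} [e xE] : exists e, x = staircase n d m.+1 e.
  by case: xE => /eqP ->; [exists true|exists false].
have i1E : (inord m.+1 : 'I_d.+1) = m.+1 :> nat by rewrite inordK.
pose i1 : 'I_d.+1 := inord m.+1.
rewrite (bigD1 i1) //= big1 ?addr0; last first.
  move=> i ii1; case: ifP => // oi.
  have z v : v = below (x i) \/ v = above (x i) -> G (fupd x i v) = 0.
    move=> vE; apply/eqP; apply: contraNT ii1 => /(Gnz _ _ oi vE) [? [_ _ iE _]].
    by apply/eqP/ord_inj; rewrite i1E.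
  by rewrite !z ?addr0; [|right|left].
have x1 : x i1 = (if e (+) odd m.+1 then (2 * n).+1 else (2 * n).-1) :> nat.
  by rewrite xE staircaseE // i1E leqnn.
have o1 : odd (x i1) by rewrite x1; case: ifP => _ //; lia.
rewrite o1.
have G1 (v : 'I_(4 * n).+1) : v = (2 * n)%N :> nat -> G (fupd x i1 v) = 1.
  move=> v2; have yE : fupd x i1 v = staircase n d m e.
    apply/ffunP => j; apply/ord_inj; rewrite staircaseE // fupdE.
    have [->|ji] := eqVneq j i1; first by rewrite i1E ltnn.
    rewrite xE staircaseE //; case: ifP => // _.
    by rewrite leq_eqVlt ltnS -i1E (inj_eq val_inj) (negPf ji).
  rewrite Gdiff ?IH ?yE; first last.
  - by rewrite xE !grid_s_staircase ?(ltnW md) //=; case: (e); case: (odd m).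
  - move=> j mj; apply/eqP; apply: contraTT mj; rewrite staircase_neq //.
    by rewrite leqNgt.
  - by rewrite -yE; apply: Knb.
  by rewrite (ltnW md) /=; case: (e); rewrite eqxx ?orbT.
have G0 (v : 'I_(4 * n).+1) : v = below (x i1) \/ v = above (x i1) -> v <> (2 * n)%N :> nat -> G (fupd x i1 v) = 0.
  move=> vE v2; apply: Gsame; apply: contrapT => /eqP sne.
  by have [/v2] := grid_s_change n0 Kx o1 vE sne.
move: x1; case: ifP => _ x1.
  rewrite G1 ?G0 ?addr0 //; [by right| |by rewrite val_below x1].
  by rewrite val_above ?odd_lt // x1; lia.
rewrite addrC G1 ?G0 ?addr0 //; [by left| |].
  by rewrite val_below x1; lia.
by rewrite val_above ?odd_lt // x1; lia.
Qed.

Lemma grid_eval (F : comNzRingType) n d m :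
  (0 < n)%N -> (forall x : F, x + x = 0) -> (d <= m)%N ->
  \sum_x grid_kap F x * (grid_s x)%:R * sign_iter (@grid_M F n d) (@grid_s n d) m x =
  (m == d)%:R.
Proof.
move=> n0 ch2 dm.
have it x : grid_K x -> sign_iter (@grid_M F n d) (@grid_s n d) m x =
  ((m <= d)%N && ((x == staircase n d m true) || (x == staircase n d m false)))%:R.
  move=> Kx; apply: sign_iter_grid => // j mj.
  by have := ltn_ord j; lia.
have [md|nmd] := eqVneq m d; last first.
  apply: big1 => x _; have [->|/(grid_kK n0 ch2) Kx] := eqVneq (grid_kap F x) 0.
    by rewrite !mul0r.
  by rewrite it // leqNgt ltn_neqAle dm eq_sym nmd mulr0.
(* The two staircases are antipodal, and [staircase n d d e] has sign [e (+) odd d]; this [e]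
   selects the one inside the fundamental domain. *)
subst m; pose e := ~~ odd d; pose x0 := staircase n d d e.
have s0 : grid_s x0 by rewrite grid_s_staircase // /e; case: (odd d).
have odd_st (i : 'I_d.+1) : i != ord0 -> odd (x0 i) && (x0 i != 0 :> nat) && (x0 i != 4 * n :> nat)%N.
  move=> i0; have i0' : ((i : nat) == 0%N) = false by apply: contraNF i0 => /eqP e0; apply/eqP/ord_inj.
  by rewrite staircaseE // i0' -ltnS ltn_ord; case: (_ (+) _); lia.
have ext0 : (x0 ord0 == 0 :> nat) || (x0 ord0 == 4 * n :> nat)%N.
  by rewrite staircaseE //=; case: (e); rewrite eqxx ?orbT.
have k0 : grid_kap F x0 = 1.
  rewrite grid_kapE // (bigD1 ord0) //= big1 ?addr0; last first.
    by move=> i /odd_st /andP[/andP[_ /negPf ->] /negPf ->]; rewrite andbF.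
  rewrite ext0 andbT (_ : [forall j, _]) //; apply/forallP => j; apply/implyP.
  by move=> /odd_st /andP[/andP[-> _] _].
have K0 : grid_K x0 by apply/existsP; exists ord0.
rewrite (bigD1 x0) //= k0 s0 it // leqnn /= big1 ?addr0; last first.
  move=> x xx0; have [->|/(grid_kK n0 ch2) Kx] := eqVneq (grid_kap F x) 0.
    by rewrite !mul0r.
  rewrite it // leqnn /=; case: (boolP (grid_s x)) => sx; last by rewrite mulr0 mul0r.
  case: (boolP (_ || _)) => [xE|_]; last by rewrite mulr0.
  case/negP: xx0; move: sx; rewrite /x0 /e.
  by case/orP: xE => /eqP ->; rewrite grid_s_staircase //; case: (odd d).
by rewrite mul1r /x0; case: (e); rewrite eqxx ?orbT mulr1.
Qed.

(** * Approximate common zeros on the grid *)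

Lemma Forall_map_in (J : eqType) (T : Type) (f : J -> T) (P : T -> Prop) (l : seq J) :
  {in l, forall j, P (f j)} -> List.Forall P (map f l).
Proof.
elim: l => [_|j l IH h] /=; constructor; first exact/h/mem_head.
by apply: IH => i il; apply: h; rewrite inE il orbT.
Qed.

(* Replace each sign function by the sign of g wherever |g| >= eta: a jump of
   that sign between adjacent cells then forces |g| to be small there. *)
Lemma grid_approx_zero (R : realType) (n k d : nat) (J : eqType) (l : seq J)
    (S : J -> {set 'I_k}) (g : J -> {ffun 'I_k -> block n d} -> R) (eta : R) :
  (0 < n)%N -> 0 < eta -> size l = (k * d)%N ->
  mcoeff (mmon (fun=> d)) (linear_forms 'F_2 (map S l)) != 0 ->
  {in l, forall j x b, on_cells (@grid_K n d) x ->
     g j (flip_at (@grid_nu n d) b x) = if b \in S j then - g j x else g j x} ->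
  {in l, forall j x b y, on_cells (@grid_K n d) x -> grid_M 'F_2 (x b) y != 0 ->
     `|g j x - g j (fupd x b y)| < eta} ->
  exists2 x, on_cells (@grid_K n d) x &
    {in l, forall j, `|g j x| <= (size l).+1%:R * eta}.
Proof.
move=> n0 eta0 sl lin0 godd gadj.
have anti := @grid_antipodal 'F_2 n d n0 addF2.
(* Where [g] is too small for its sign to be stable the model sign takes over; the choice is
   consistent because [|g|] is flip invariant. *)
pose t j x : 'F_2 := if eta <= `|g j x| then ((0 < g j x)%R : bool)%:R
  else char_sign 'F_2 (@grid_s n d) (S j) x.
pose l' := [seq (S j, t j) | j <- l].
have et : List.Forall (fun p => flip_equiv (@grid_K n d) (@grid_nu n d) p.1 p.2) l'.
  apply: Forall_map_in => j jl x b Kx /=; rewrite /t godd //.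
  rewrite (fun_if (fun r : R => `|r|)) normrN if_same.
  case: ifP => [ge|_]; last exact: (char_sign_equiv (S j) addF2 anti).
  have gn : g j x != 0 by rewrite -normr_gt0 (lt_le_trans eta0).
  case: (b \in S j); last by rewrite addr0.
  rewrite oppr_gt0; case: ltgtP gn => // _ _; first by rewrite add0r.
  by rewrite addF2.
have l'1 : map fst l' = map S l by rewrite -map_comp.
have nz : orient_sum (@grid_kap 'F_2 n d) (@grid_s n d)
    (comm_chain (@grid_M 'F_2 n d) (map snd l') (fun=> 1)) != 0.
  rewrite (orient_sum_chain addF2 anti et) l'1.
  rewrite (orient_sum_char (d := d) addF2) ?size_map //.
  by move=> m dm; apply: grid_eval => //; apply: addF2.
have [x [Kx fx]] : exists x : {ffun 'I_k -> block n d}, on_cells (@grid_K n d) x /\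
    comm_chain (@grid_M 'F_2 n d) (map snd l') (fun=> 1) x != 0.
  apply: contrapT => h; case/eqP: nz.
  rewrite (@eq_orient_sum _ _ _ _ _ _ (fun=> 0)); first by apply: big1 => x _; rewrite mulr0.
  move=> x kx; apply: contrapT => /eqP fx; apply: h; exists x; split => //.
  by apply/forallP => b; apply: (anti_kK anti).
exists x => // j jl.
have {et nz sl lin0 l'1 fx} : comm_chain (@grid_M 'F_2 n d) (map t l) (fun=> 1) x != 0.
  by move: fx; rewrite /l' -map_comp.
clear l'.
(* Unrolling the nonzero composite gives a path of facets with one step per constraint, the step of
   [i] crossing a jump of [t i]. One end of that step has [|g i| < eta], and each step back to the
   start costs at most another [eta]. *)
elim: l x j Kx jl godd gadj => // i l IH x j Kx jl godd gadj /=.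
rewrite /comm_bdry => /eqP sn0.
have [b [y]] : exists b y, grid_M 'F_2 (x b) y *
    ((t i x + t i (fupd x b y)) *
      comm_chain (@grid_M 'F_2 n d) (map t l) (fun=> 1) (fupd x b y)) != 0.
  apply: contrapT => h; apply: sn0; apply: big1 => b _; apply: big1 => y _.
  by apply: contrapT => /eqP e; apply: h; exists b, y.
rewrite !mulf_eq0 !negb_or => /and3P[Mn tn cn].
have Ky : on_cells (@grid_K n d) (fupd x b y).
  by apply: on_cells_fupd => //; apply: (anti_MK anti Mn); apply: (forallP Kx).
have adj := gadj _ _ _ _ _ Kx Mn.
have e0 := ltW eta0.
have tri (u v : R) : `|u - v| < eta -> `|v| <= (size l).+1%:R * eta -> `|u| <= (size l).+2%:R * eta.
  move=> uv vl; rewrite -(subrK v u) (le_trans (ler_normD _ _)) //.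
  by rewrite -[(size l).+2]addn1 natrD mulrDl mul1r addrC lerD // ltW.
move: jl; rewrite inE => /orP[/eqP -> {j}|jl]; last first.
  apply: (tri _ (g j (fupd x b y))); first by apply: adj; rewrite inE jl orbT.
  apply: IH => //.
  - by move=> i' il'; apply: godd; rewrite inE il' orbT.
  - by move=> i' il'; apply: gadj; rewrite inE il' orbT.
have ai := adj _ (mem_head _ _).
have e1 m : eta <= m.+1%:R * eta by rewrite ler_peMl // ler1n.
have [gx|gx] := ltP `|g i x| eta; first exact: le_trans (ltW gx) (e1 _).
apply: (tri _ (g i (fupd x b y))) => //.
have [gy|gy] := ltP `|g i (fupd x b y)| eta; first exact: le_trans (ltW gy) (e1 _).
(* Two values of size at least [eta] and less than [eta] apart have the same sign, so [t i] would
   not jump. *)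
case/eqP: tn; rewrite /t gx gy (_ : (0 < g i x) = (0 < g i (fupd x b y))) ?addF2 //.
move: gx gy ai; move: (g i x) (g i (fupd x b y)) => u v; rewrite ltr_norml => hu hv /andP[h1 h2].
case: (ltP 0 u) hu => u0; case: (ltP 0 v) hv => v0 //.
  by rewrite (gtr0_norm u0) (ler0_norm v0) => *; exfalso; lra.
by rewrite (gtr0_norm v0) (ler0_norm u0) => *; exfalso; lra.
Qed.

(** * From the grid to Lipschitz functions on the cube *)

Definition flip_row (R : realType) (k m : nat) (b : 'I_k) (h : 'M[R]_(k, m)) :=
  \matrix_(a, i) if a == b then - h a i else h a i.

Definition in_cube (R : realType) (k m : nat) (h : 'M[R]_(k, m)) :=
  forall a i, `|h a i| <= 1.

(** Restricted to the cube because products of Lipschitz functions are Lipschitz only where they are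
    bounded. The same constant gives the estimate between adjacent cells and continuity for the
    compactness argument. *)
Definition cube_lip (R : realType) (k m : nat) (g : 'M[R]_(k, m) -> R) :=
  exists2 C, 0 <= C & forall h h' e, in_cube h -> in_cube h' -> 0 <= e ->
    (forall a i, `|h a i - h' a i| <= e) -> `|g h - g h'| <= C * e.

Lemma cube_lip_bounded (R : realType) k m (g : 'M[R]_(k, m) -> R) :
  cube_lip g -> exists2 B, 0 <= B & forall h, in_cube h -> `|g h| <= B.
Proof.
move=> [C C0 gl]; exists (`|g 0| + C); first by rewrite addr_ge0.
move=> h hc; have h0 : in_cube (0 : 'M[R]_(k, m)) by move=> a i; rewrite mxE normr0.
have := gl h 0 1 hc h0 ler01; rewrite mulr1 => le.
rewrite -(subrK (g 0) (g h)) (le_trans (ler_normD _ _)) // addrC lerD2l le // => a i.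
by rewrite mxE subr0.
Qed.

Lemma cube_lip_cst (R : realType) k m (c : R) : cube_lip (fun _ : 'M[R]_(k, m) => c).
Proof. by exists 0 => // h h' e *; rewrite subrr normr0 mul0r. Qed.

Lemma cube_lip_coord (R : realType) k m a i : cube_lip (fun h : 'M[R]_(k, m) => h a i).
Proof. by exists 1 => // h h' e _ _ _ he; rewrite mul1r. Qed.

Lemma cube_lipN (R : realType) k m (f : 'M[R]_(k, m) -> R) :
  cube_lip f -> cube_lip (fun h => - f h).
Proof.
move=> [C C0 fl]; exists C => // h h' e hc hc' e0 he.
by rewrite -opprD normrN; apply: fl.
Qed.

Lemma cube_lip_norm (R : realType) k m (f : 'M[R]_(k, m) -> R) :
  cube_lip f -> cube_lip (fun h => `|f h|).
Proof.
move=> [C C0 fl]; exists C => // h h' e hc hc' e0 he.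
by apply: le_trans (ler_dist_dist _ _) _; apply: fl.
Qed.

Lemma cube_lipD (R : realType) k m (f g : 'M[R]_(k, m) -> R) :
  cube_lip f -> cube_lip g -> cube_lip (fun h => f h + g h).
Proof.
move=> [C C0 fl] [D D0 gl]; exists (C + D); first exact: addr_ge0.
move=> h h' e hc hc' e0 he; rewrite opprD addrACA mulrDl.
by apply: le_trans (ler_normD _ _) _; apply: lerD; [apply: fl|apply: gl].
Qed.

Lemma cube_lipM (R : realType) k m (f g : 'M[R]_(k, m) -> R) :
  cube_lip f -> cube_lip g -> cube_lip (fun h => f h * g h).
Proof.
move=> lf lg; have [A A0 fA] := cube_lip_bounded lf; have [B B0 gB] := cube_lip_bounded lg.
case: lf lg => [C C0 fl] [D D0 gl]; exists (A * D + B * C).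
  by rewrite addr_ge0 // mulr_ge0.
move=> h h' e hc hc' e0 he.
rewrite (_ : _ - _ = f h * (g h - g h') + g h' * (f h - f h')); last by ring.
apply: le_trans (ler_normD _ _) _; rewrite !normrM mulrDl -!mulrA.
by apply: lerD; apply: ler_pM => //; [exact: fA|exact: gl|exact: gB|exact: fl].
Qed.

Lemma cube_lip_sum (R : realType) k m (J : Type) (r : seq J) (P : pred J)
    (f : J -> 'M[R]_(k, m) -> R) :
  (forall j, P j -> cube_lip (f j)) -> cube_lip (fun h => \sum_(j <- r | P j) f j h).
Proof.
move=> fl; elim: r => [|j r [C C0 IH]].
  by exists 0 => // h h' e *; rewrite !big_nil subrr normr0 mul0r.
have [pj|pj] := boolP (P j); last first.
  by exists C => // h h' e *; rewrite !big_cons (negPf pj); apply: IH.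
have [D D0 gl] := cube_lipD (fl j pj) (ex_intro2 _ _ C C0 IH).
by exists D => // h h' e *; rewrite !big_cons pj; apply: gl.
Qed.

Lemma cube_lip_prod (R : realType) k m (J : Type) (r : seq J) (P : pred J)
    (f : J -> 'M[R]_(k, m) -> R) :
  (forall j, P j -> cube_lip (f j)) -> cube_lip (fun h => \prod_(j <- r | P j) f j h).
Proof.
move=> fl; elim: r => [|j r [C C0 IH]].
  by exists 0 => // h h' e *; rewrite !big_nil subrr normr0 mul0r.
have [pj|pj] := boolP (P j); last first.
  by exists C => // h h' e *; rewrite !big_cons (negPf pj); apply: IH.
have [D D0 gl] := cube_lipM (fl j pj) (ex_intro2 _ _ C C0 IH).
by exists D => // h h' e *; rewrite !big_cons pj; apply: gl.
Qed.

Lemma cube_lip_sum_in (R : realType) k m (J : eqType) (r : seq J)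
    (f : J -> 'M[R]_(k, m) -> R) :
  {in r, forall j, cube_lip (f j)} -> cube_lip (fun h => \sum_(j <- r) f j h).
Proof.
move=> fl; have [C C0 h] := @cube_lip_sum R k m J r (fun j => j \in r) f fl.
by exists C => // *; rewrite ![\sum_(j <- r) _]big_seq; apply: h.
Qed.

(** The centre value [2 * n] goes to 0, so that antipodality of cells becomes negation of rows. *)
Definition cell_pt (R : realType) (n k d : nat) (x : {ffun 'I_k -> block n d}) :
  'M[R]_(k, d.+1) := \matrix_(a, i) ((x a i)%:R / (2 * n)%:R - 1).

Lemma cell_pt_in_cube (R : realType) n k d (x : {ffun 'I_k -> block n d}) :
  (0 < n)%N -> in_cube (cell_pt R x).
Proof.
move=> n0 a i; rewrite mxE ler_norml.
have n1 : 0 < (2 * n)%:R :> R by rewrite ltr0n muln_gt0.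
have := ltn_ord (x a i); rewrite ltnS => xn.
rewrite lerBlDr lerBrDr addNr divr_ge0 //= ler_pdivrMr // -[1 + 1]/(2%:R : R) -natrM ler_nat.
by lia.
Qed.

Lemma cell_pt_boundary (R : realType) n k d (x : {ffun 'I_k -> block n d}) a :
  (0 < n)%N -> grid_K (x a) -> exists i, `|cell_pt R x a i| = 1.
Proof.
move=> n0 /existsP[i xi]; exists i; rewrite mxE.
have n1 : (2 * n)%:R != 0 :> R by rewrite pnatr_eq0; lia.
case/orP: xi => /eqP ->; first by rewrite mul0r add0r normrN1.
have -> : (4 * n)%:R = 2 * (2 * n)%:R :> R by rewrite -natrM mulnA.
by rewrite mulfK // addrK normr1.
Qed.

Lemma cell_pt_flip (R : realType) n k d (x : {ffun 'I_k -> block n d}) b :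
  (0 < n)%N -> cell_pt R (flip_at (@grid_nu n d) b x) = flip_row b (cell_pt R x).
Proof.
move=> n0; apply/matrixP => a i; rewrite !mxE /flip_at fupdE.
case: eqP => [->|//]; rewrite ffunE val_rev.
have n1 : (2 * n)%:R != 0 :> R by rewrite pnatr_eq0; lia.
have := ltn_ord (x b i); rewrite ltnS => xn; rewrite natrB //.
have -> : (4 * n)%:R = 2 * (2 * n)%:R :> R by rewrite -natrM mulnA.
by rewrite mulrBl mulfK //; ring.
Qed.

Lemma cell_pt_adj (R : realType) n k d (x : {ffun 'I_k -> block n d}) b y a i :
  (0 < n)%N -> grid_M 'F_2 (x b) y != 0 ->
  `|cell_pt R x a i - cell_pt R (fupd x b y) a i| <= (2 * n)%:R^-1.
Proof.
move=> n0 /grid_M_neq0[j oj yE]; rewrite !mxE fupdE.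
have n1 : 0 < (2 * n)%:R :> R by rewrite ltr0n muln_gt0.
have z : `|0 : R| <= (2 * n)%:R^-1 by rewrite normr0 invr_ge0 ltW.
case: eqP => [->|_]; last by rewrite subrr.
rewrite (_ : forall u v w : R, u - v - (w - v) = u - w); last by move=> *; ring.
have xl := odd_lt oj.
have [ij|ij] := eqVneq i j; last first.
  by case: yE => ->; rewrite fupd_neq // subrr.
rewrite ij -mulrBl normrM [X in _ * X]gtr0_norm ?invr_gt0 //.
apply: ler_piMl; first by rewrite invr_ge0 ltW.
case: yE => ->; rewrite fupd_eq ?val_below ?val_above //.
  case: (nat_of_ord _) oj => // u _ /=.
  by rewrite -natr1 addrAC subrr add0r normr1.
by rewrite -natr1 opprD addrA subrr add0r normrN1.
Qed.

Lemma cube_lip_uniform (R : realType) k m (J : eqType) (l : seq J)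
    (g : J -> 'M[R]_(k, m) -> R) :
  {in l, forall j, cube_lip (g j)} ->
  exists2 C, 0 < C & {in l, forall j h h' e, in_cube h -> in_cube h' -> 0 <= e ->
    (forall a i, `|h a i - h' a i| <= e) -> `|g j h - g j h'| <= C * e}.
Proof.
elim: l => [_|j l IH gl]; first by exists 1.
have [i il|C C0 hC] := IH; first by apply: gl; rewrite inE il orbT.
have [D D0 hD] := gl j (mem_head _ _).
exists (C + D); first exact: ltr_pwDl.
move=> i; rewrite inE => /orP[/eqP->|il] h h' e hc hc' e0 he; rewrite mulrDl.
  by rewrite ler_wpDl ?mulr_ge0 ?(ltW C0) // hD.
by rewrite ler_wpDr ?mulr_ge0 // hC.
Qed.

Lemma cube_lip_within_continuous (R : realType) k m (g : 'M[R]_(k, m) -> R) :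
  cube_lip g ->
  {within [set v : 'rV[R]_(k * m) | forall i, `[-1, 1]%classic (v ord0 i)],
    continuous (fun v => g (vec_mx v))}.
Proof.
move=> [C C0 gl]; apply/subspace_continuousP => v vA.
have cube (w : 'rV[R]_(k * m)) : (forall i, `[-1, 1]%classic (w ord0 i)) -> in_cube (vec_mx w : 'M[R]_(k, m)).
  by move=> h a i; rewrite mxE ler_norml; have := h (mxvec_index a i); rewrite /= in_itv.
apply/cvgrPdist_le => e e0 /=.
have C1 : 0 < C + 1 by rewrite ltr_wpDl.
rewrite near_withinE; apply/nbhs_ballP.
exists (e / (C + 1)) => /=; first exact: divr_gt0.
move=> w bw wA; apply: le_trans (gl _ _ (e / (C + 1)) (cube _ vA) (cube _ wA) _ _) _.
- by rewrite ltW // divr_gt0.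
- by case: bw => _ bw a i; rewrite !mxE ltW //; have := bw ord0 (mxvec_index a i).
- by rewrite mulrCA ler_piMr ?(ltW e0) // ler_pdivrMr // mul1r lerDl.
Qed.

Theorem multi_borsuk_ulam (R : realType) (k d : nat) (J : eqType) (l : seq J)
    (S : J -> {set 'I_k}) (g : J -> 'M[R]_(k, d.+1) -> R) :
  size l = (k * d)%N ->
  mcoeff (mmon (fun=> d)) (linear_forms 'F_2 (map S l)) != 0 ->
  {in l, forall j h b, g j (flip_row b h) = if b \in S j then - g j h else g j h} ->
  {in l, forall j, cube_lip (g j)} ->
  exists h : 'M[R]_(k, d.+1),
    (forall a, exists i, `|h a i| = 1) /\ {in l, forall j, g j h = 0}.
Proof.
move=> sl lin0 godd glip.
(* On the cube [pen] vanishes exactly when every row has an entry of absolute value 1, so the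
   surface condition becomes one more nonnegative function to be minimised. *)
pose pen (h : 'M[R]_(k, d.+1)) := \sum_a \prod_i (1 - `|h a i|).
pose tot h := \sum_(j <- l) `|g j h|.
have penl : cube_lip pen.
  apply: cube_lip_sum => a _; apply: cube_lip_prod => i _.
  by apply: cube_lipD; [exact: cube_lip_cst|apply/cube_lipN/cube_lip_norm/cube_lip_coord].
have totl : cube_lip tot.
  by apply: cube_lip_sum_in => j jl; apply: cube_lip_norm; apply: glip.
have [C C0 hC] := cube_lip_uniform glip.
have approx n : exists2 h, in_cube h & pen h = 0 /\
    tot h <= (size l)%:R * (size l).+1%:R * C / n.+1%:R.
  pose G j (x : {ffun 'I_k -> block n.+1 d}) := g j (cell_pt R x).
  have adj : {in l, forall j x b y, on_cells (@grid_K n.+1 d) x ->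
      grid_M 'F_2 (x b) y != 0 -> `|G j x - G j (fupd x b y)| < C / n.+1%:R}.
    move=> j jl x b y Kx Mn.
    apply: le_lt_trans (hC _ jl _ _ (2 * n.+1)%:R^-1 _ _ _ _) _.
    - exact: cell_pt_in_cube.
    - exact: cell_pt_in_cube.
    - by rewrite invr_ge0.
    - by move=> a i; apply: cell_pt_adj.
    - by rewrite ltr_pM2l // ltf_pV2 ?posrE ?ltr0n // ltr_nat; lia.
  have flp : {in l, forall j x b, on_cells (@grid_K n.+1 d) x ->
      G j (flip_at (@grid_nu n.+1 d) b x) = if b \in S j then - G j x else G j x}.
    by move=> j jl x b Kx; rewrite /G cell_pt_flip // godd.
  have [x Kx hx] := grid_approx_zero (ltn0Sn n) (divr_gt0 C0 (ltr0Sn _ n)) sl lin0 flp adj.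
  exists (cell_pt R x); first exact: cell_pt_in_cube.
  split.
    apply: big1 => a _; have [i xi] := @cell_pt_boundary R _ _ _ x a isT (forallP Kx a).
    by rewrite (bigD1 i) //= xi subrr mul0r.
  rewrite /tot big_seq; apply: le_trans (ler_sum _ hx) _.
  rewrite -big_seq big_const_seq count_predT iter_addr_0.
  by rewrite -[leLHS]mulr_natl !mulrA.
pose A := [set v : 'rV[R]_(k * d.+1) | forall i, `[-1, 1]%classic (v ord0 i)].
have cA : compact A by apply: (@rV_compact R _ (fun=> `[-1, 1]%classic)) => i; exact: segment_compact.
have A0 : A !=set0.
  by exists 0 => i /=; rewrite mxE in_itv /= oppr_le0 ler01.
(* [approx] makes [pen + tot] arbitrarily small, so its minimum over the compact cube is 0 and both
   terms vanish there. *)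
have [c cc cmin] := EVT_min_rV A0 cA
  (cube_lip_within_continuous (cube_lipD penl totl)).
have cube : in_cube (vec_mx c : 'M[R]_(k, d.+1)).
  move=> a i; rewrite mxE ler_norml; move: cc; rewrite inE => /(_ (mxvec_index a i)).
  by rewrite /= in_itv.
have tot0 h : 0 <= tot h by apply: sumr_ge0.
have pen0 h : in_cube h -> 0 <= pen h.
  by move=> hc; apply: sumr_ge0 => a _; apply: prodr_ge0 => i _; rewrite subr_ge0.
pose h := vec_mx c : 'M[R]_(k, d.+1).
pose D := (size l)%:R * (size l).+1%:R * C.
have small n : pen h + tot h <= D / n.+1%:R.
  have [h' hc' [p0 t0]] := approx n.
  have hA : mxvec h' \in A.
    rewrite inE => i /=; rewrite in_itv /= -ler_norml.
    by case/mxvec_indexP: i => a i; rewrite mxvecE.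
  by have := cmin _ hA; rewrite mxvecK p0 add0r => /le_trans; apply.
have z : pen h + tot h <= 0.
  apply/ler_addgt0Pl => e e0; rewrite addr0.
  have D0 : 0 <= D by rewrite !mulr_ge0 // ltW.
  pose n := Num.truncn (D / e).
  apply: le_trans (small n) _; rewrite ler_pdivrMr ?ltr0n // mulrC -ler_pdivrMr //.
  by apply/ltW/truncnS_gt.
have pz : pen h = 0 by apply/le_anti; rewrite pen0 // andbT; have := tot0 h; lra.
have tz : tot h = 0 by apply/le_anti; rewrite tot0 // andbT; have := pen0 h cube; lra.
exists h; split.
  move=> a; have : \prod_i (1 - `|h a i|) = 0.
    have := pz; rewrite /pen => /eqP; rewrite psumr_eq0; last first.
      by move=> b _; apply: prodr_ge0 => i _; rewrite subr_ge0.
    by move=> /allP/(_ a (mem_index_enum _))/eqP.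
  by move=> /eqP/prodf_eq0[i _]; rewrite subr_eq0 => /eqP e; exists i.
move=> j jl; apply/eqP; rewrite -normr_eq0; apply/eqP.
have := tz; rewrite /tot => /eqP; rewrite psumr_eq0 // => /allP/(_ j jl)/eqP.
by [].
Qed.

(** * Odd coefficients of powers of the Vandermonde product *)

Lemma idem_char2 (F : comNzRingType) : (forall x : F, x * x = x) -> forall x : F, x + x = 0.
Proof.
move=> idem x; have := idem (x + x); rewrite mulrDl mulrDr idem => h.
by apply: (addrI (x + x)); rewrite addr0.
Qed.

Definition cf (F : comNzRingType) (k : nat) (p : mpoly k F) (e : 'I_k -> nat) : F :=
  mcoeff (mmon e) p.

Lemma eq_cf (F : comNzRingType) k (p : mpoly k F) e f : e =1 f -> cf p e = cf p f.
Proof. by move=> ef; congr mcoeff; apply/mnmP => a; rewrite !mmonE. Qed.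

Lemma cfXM (F : comNzRingType) k (p : mpoly k F) (f e : 'I_k -> nat) :
  cf (mpolyX F (mmon f) * p) e =
  if [forall a, (f a <= e a)%N] then cf p (fun a => e a - f a)%N else 0.
Proof.
case: ifP => [/forallP fe|/negbT/forallPn[a fa]].
  rewrite mulrC /cf (_ : mmon e = mnm_add (mmon f) (mmon (fun a => e a - f a)%N)).
    exact: mcoeffMX.
  by apply/mnmP => a; rewrite mnmDE !mmonE subnKC.
rewrite /cf mcoeffM big1 // => -[m1 m2] /= /eqP e12.
rewrite mcoeffX; case: eqP => [fm|]; last by rewrite mul0r.
have := congr1 (fun m : multinom k => m a) e12; rewrite mmonE mnmDE -fm mmonE => ea.
by move: fa; rewrite ea leq_addr.
Qed.

Lemma cfX (F : comNzRingType) k (f e : 'I_k -> nat) :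
  cf (mpolyX F (mmon f)) e = [forall a, f a == e a]%:R.
Proof.
rewrite /cf mcoeffX; congr (_%:R); congr nat_of_bool.
apply/eqP/forallP => [fe a|fe]; last by apply/mnmP => a; rewrite !mmonE; apply/eqP.
by have := congr1 (fun m : multinom k => m a) fe; rewrite !mmonE => ->.
Qed.

(** Squaring is additive in characteristic 2 and fixes idempotent coefficients, so it merely doubles
    exponents. *)
Lemma cf_sqr (F : comNzRingType) k (p : mpoly k F) e :
  (forall x : F, x * x = x) ->
  cf (p ^+ 2) e = if [forall a, ~~ odd (e a)] then cf p (fun a => (e a)./2) else 0.
Proof.
move=> idem; have ch2 := idem_char2 idem.
have ch2p (q : mpoly k F) : q + q = 0 by apply/mpolyP => m; rewrite mcoeffD mcoeff0.
have sqrD (q r : mpoly k F) : (q + r) ^+ 2 = q ^+ 2 + r ^+ 2.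
  by rewrite sqrrD mulr2n ch2p addr0.
have cfD (q r : mpoly k F) f : cf (q + r) f = cf q f + cf r f by rewrite /cf mcoeffD.
rewrite (mpolyE p); elim: (msupp p) => [|m s IH].
  by rewrite !big_nil expr2 mulr0 /cf !mcoeff0 if_same.
rewrite !big_cons sqrD !cfD IH.
case: ifP => [/forallP ev|/negbT/forallPn[a oa]]; last first.
  rewrite addr0 exprZn /cf mcoeffZ mcoeffXn; case: eqP => [em|]; last by rewrite mulr0.
  have := congr1 (fun m : multinom k => m a) em; rewrite mmonE mulmnE => ea.
  by move: oa; rewrite -ea muln2 odd_double.
congr (_ + _); rewrite exprZn /cf !mcoeffZ mcoeffXn mcoeffX expr2 idem; congr (_ * _%:R).
congr nat_of_bool; apply/eqP/eqP => em; apply/mnmP => a.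
  have ea : (m a * 2)%N = e a.
    by have := congr1 (fun m : multinom k => m a) em; rewrite mulmnE mmonE.
  by rewrite mmonE -ea muln2 doubleK.
rewrite em mulmnE [LHS](congr1 (muln^~ 2) (mmonE _ _)) mmonE muln2.
by rewrite -[RHS]odd_double_half (negPf (ev a)).
Qed.

Definition forms (F : comNzRingType) (k r : nat) : mpoly k F :=
  \prod_(S : {set 'I_k} | #|S| == r) \sum_(a in S) mpolyX F (mnm1 a).

Lemma forms_sym (F : comNzRingType) k r : forms F k r \is symmetric.
Proof.
apply/issymP => s; rewrite /forms rmorph_prod /=.
rewrite [RHS](reindex_inj (imset_inj (@perm_inj _ s))) /=.
apply: eq_big => [S|S _]; first by rewrite card_imset //; exact: perm_inj.
rewrite big_imset /=; last by move=> ? ? _ _; apply: perm_inj.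
rewrite raddf_sum /=; apply: eq_bigr => a _; rewrite msymX; congr mpolyX.
by apply/mnmP => b; rewrite mnmE !mnm1E -(inj_eq (@perm_inj _ s)) permKV.
Qed.

Lemma cf_sym (F : comNzRingType) k (p : mpoly k F) (s : 'S_k) e :
  p \is symmetric -> cf p (fun a => e (s a)) = cf p e.
Proof.
move=> ps; rewrite /cf -[RHS](msym_coeff _ s ps); congr mcoeff.
by apply/mnmP => a; rewrite mnmE !mmonE.
Qed.

Lemma prod_pairs (T : comNzRingType) k (G : {set 'I_k} -> T) :
  \prod_(S : {set 'I_k} | #|S| == 2) G S =
  \prod_(i < k) \prod_(j < k | (i < j)%N) G [set i; j]%SET.
Proof.
rewrite pair_big_dep /=.
have inj2 : {in [set p : 'I_k * 'I_k | (p.1 < p.2)%N]%SET &,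
    injective (fun p : 'I_k * 'I_k => [set p.1; p.2]%SET)}.
  move=> [a b] [c e]; rewrite !inE /= => ab ce /setP eqs.
  have := eqs a; rewrite !inE eqxx /= => /esym/orP ha.
  have := eqs b; rewrite !inE eqxx orbT => /esym/orP hb.
  case: ha => /eqP ha; case: hb => /eqP hb; subst => //.
  - by rewrite ltnn in ab.
  - by have := ltn_trans ab ce; rewrite ltnn.
  - by rewrite ltnn in ab.
rewrite [RHS](eq_bigl (fun p => p \in [set p : 'I_k * 'I_k | (p.1 < p.2)%N]%SET)); last first.
  by move=> p; rewrite inE.
rewrite -(big_imset G inj2) /=; apply: eq_bigl => S.
apply/idP/idP => [/cards2P[a [b]]|/imsetP[[a b]]]; last first.
  rewrite inE /= => ab ->; apply/cards2P; exists a, b; split=> //.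
  by apply: contraTneq ab => ->; rewrite ltnn.
move=> [ab ->]; apply/imsetP; move: ab; rewrite -(inj_eq val_inj) /= neq_ltn => /orP[ab|ba].
  by exists (a, b); rewrite ?inE.
by exists (b, a); rewrite ?inE //= finset.setUC.
Qed.

(** Signs disappear in characteristic 2: the product over pairs is the Vandermonde determinant, and
    each permutation contributes its monomial once. *)
Lemma forms2_expand (F : comNzRingType) k :
  (forall x : F, x + x = 0) ->
  forms F k 2 = \sum_(s : 'S_k) mpolyX F (mmon (fun a => s a)).
Proof.
move=> ch2; have ch2p (q : mpoly k F) : q + q = 0 by apply/mpolyP => m; rewrite mcoeffD mcoeff0.
have opp (q : mpoly k F) : - q = q by apply/eqP; rewrite eq_sym -subr_eq0 opprK ch2p.
rewrite /forms prod_pairs.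
pose v : 'rV[mpoly k F]_k := \row_i mpolyX F (mnm1 i).
have -> : \prod_(i < k) \prod_(j < k | (i < j)%N) \sum_(a in [set i; j]%SET) mpolyX F (mnm1 a) =
    \det (Vandermonde k v).
  rewrite det_Vandermonde; apply: eq_bigr => i _; apply: eq_bigr => j ij.
  rewrite !mxE big_setU1 /=; last first.
    by rewrite inE; apply: contraTneq ij => ->; rewrite ltnn.
  by rewrite big_set1 opp addrC.
rewrite -det_tr; apply: eq_bigr => s _.
rewrite -signr_odd (_ : (-1) ^+ _ = 1) ?mul1r; last by case: odd => //; rewrite expr1 opp.
rewrite mpolyXE_id; apply: eq_bigr => i _.
by rewrite !mxE mmonE.
Qed.

Lemma cf_forms2M (F : comNzRingType) k (p : mpoly k F) e :
  (forall x : F, x + x = 0) ->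
  cf (forms F k 2 * p) e = \sum_(s : 'S_k)
    if [forall a, (s a <= e a)%N] then cf p (fun a => e a - s a)%N else 0.
Proof.
move=> ch2; rewrite forms2_expand // mulr_suml /cf raddf_sum /=.
by apply: eq_bigr => s _; apply: cfXM.
Qed.

(* Vandermonde times a symmetric polynomial is alternating; in characteristic 2
   this says that exponents with a repetition do not occur. *)
Lemma cf_alternating (F : comNzRingType) k (p : mpoly k F) e a b :
  (forall x : F, x + x = 0) -> p \is symmetric -> a != b -> e a = e b ->
  cf (forms F k 2 * p) e = 0.
Proof.
move=> ch2 ps ab eab; rewrite cf_forms2M //.
have et c : e (tperm a b c) = e c by case: tpermP => [->|->|].
apply: (sum_free_invol ch2 (phi := fun s => (tperm a b * s)%g) (P := fun s : 'S_k => odd_perm s)).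
- by move=> s; rewrite mulgA tperm2 mul1g.
- move=> s; have -> : [forall c, ((tperm a b * s)%g c <= e c)%N] = [forall c, (s c <= e c)%N].
    apply/forallP/forallP => h c; have := h (tperm a b c); rewrite permM ?tpermK et //.
  case: ifP => // _; rewrite -[RHS](cf_sym (tperm a b) _ ps).
  by apply: eq_cf => c; rewrite permM et.
- by move=> s _; rewrite odd_permM odd_tperm ab.
Qed.
(* Comparing sums of squares: the midpoint of two permutations is a permutation
   only if they agree. *)
Lemma perm_midpoint k (s t f : 'S_k) :
  (forall a, (2 * f a = s a + t a)%N) -> s = t.
Proof.
move=> mid; pose Q := \sum_(a < k) (a%:Z ^+ 2).
have sq (u : 'S_k) : \sum_a ((u a)%:Z ^+ 2) = Q.
  by rewrite [RHS](reindex_inj (@perm_inj _ u)).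
have : \sum_a (((s a)%:Z - (t a)%:Z) ^+ 2) = 0.
  rewrite (eq_bigr (fun a => ((s a)%:Z ^+ 2 + (t a)%:Z ^+ 2) *+ 2 - (f a)%:Z ^+ 2 *+ 4)).
    by rewrite sumrB !sumrMnl big_split /= !sq; lia.
  move=> a _; have : 2 * (f a)%:Z = (s a)%:Z + (t a)%:Z.
    by rewrite -PoszD -mid PoszM.
  move: (f a)%:Z (s a)%:Z (t a)%:Z => x y z h.
  have -> : x ^+ 2 *+ 4 = (2 * x) ^+ 2 by ring.
  by rewrite h; ring.
move=> /eqP; rewrite psumr_eq0; last by move=> a _; apply: sqr_ge0.
move=> /allP h; apply/permP => a; apply/ord_inj.
by have := h a (mem_index_enum _); rewrite /= sqrf_eq0 subr_eq0 => /eqP[].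
Qed.

Lemma cf_sqrM_sum (F : comNzRingType) k (p : mpoly k F) e :
  (forall x : F, x * x = x) ->
  cf (forms F k 2 * p ^+ 2) e = \sum_(s : 'S_k)
    if [forall a, (s a <= e a)%N && ~~ odd (e a - s a)]
    then cf p (fun a => (e a - s a)./2)%N else 0.
Proof.
move=> idem; rewrite cf_forms2M ?idem_char2 //; last exact: idem_char2.
apply: eq_bigr => s _; rewrite cf_sqr //.
case: ifP => [/forallP h1|/negbT/forallPn[a h1]].
  case: ifP => [/forallP h2|/negbT/forallPn[a h2]].
    by rewrite ifT //; apply/forallP => a; rewrite h1 h2.
  by rewrite ifF //; apply/negbTE/forallPn; exists a; rewrite h1 h2.
by rewrite ifF //; apply/negbTE/forallPn; exists a; rewrite negb_and h1.
Qed.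

(** A permutation [t] from the Vandermonde factor leaves exponents [c + f a] for [p], where [2 * f]
    is [s] plus the reversal of [t]. Alternation kills every non-injective [f], and a bijective [f]
    is a midpoint of permutations, so exactly one [t] survives. *)
Lemma vandermonde_step (F : comNzRingType) k (p : mpoly k F) (c : nat) :
  (forall x : F, x * x = x) ->
  (forall e a b, a != b -> e a = e b -> cf p e = 0) ->
  (forall s : 'S_k, cf p (fun a => c + s a)%N = 1) ->
  forall s : 'S_k, cf (forms F k 2 * p ^+ 2) (fun a => 2 * c + k.-1 + s a)%N = 1.
Proof.
move=> idem alt one s; rewrite cf_sqrM_sum //.
have k0 (a : 'I_k) : (a < k)%N by [].
pose rv : 'S_k := perm (@rev_ord_inj k).
have rvE (a : 'I_k) : rv a = (k.-1 - a)%N :> nat by rewrite permE /=; have := k0 a; lia.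
have le1 (a : 'I_k) : (a <= k.-1)%N by have := k0 a; lia.
(* The surviving term: the reversal of [s], for which [f] is [s] itself. *)
pose s0 : 'S_k := (s * rv)%g.
have s0E a : s0 a = (k.-1 - s a)%N :> nat by rewrite permM rvE.
rewrite (bigD1 s0) //= big1 ?addr0.
  rewrite ifT; last by apply/forallP => a; rewrite s0E; have := le1 (s a); lia.
  rewrite -[RHS](one s); apply: eq_cf => a; rewrite s0E; have := le1 (s a); lia.
move=> t ts0; case: ifP => // /forallP h.
pose f a := ((k.-1 - t a + s a)./2)%N.
have fk a : (f a < k)%N.
  by rewrite /f; have := le1 (s a); have := le1 (t a); have := k0 a; lia.
have fE a : ((2 * c + k.-1 + s a - t a)./2 = c + f a)%N.
  have /= /andP[h1 h2] := h a; rewrite /f; have := le1 (t a); lia.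
case: (boolP (injectiveb (fun a => Ordinal (fk a)))) => [/injectiveP fi|].
  case/eqP: ts0; rewrite /s0; have -> : s = (t * rv)%g.
    apply: (@perm_midpoint _ _ _ (perm fi)) => a.
    rewrite permE permM rvE /= /f; move: (h a) (le1 (t a)).
    move: (nat_of_ord (t a)) (nat_of_ord (s a)) (k.-1) => x y z; clear.
    by case/andP => h1 h2 h3; lia.
  apply/permP => a; apply/ord_inj; rewrite !permM !rvE; have := le1 (t a); lia.
case/injectivePn => a [b ab] [fab]; apply: (alt _ a b ab).
by rewrite !fE fab.
Qed.

Lemma forms2_pow (F : comNzRingType) k q :
  (forall x : F, x * x = x) ->
  forall s : 'S_k, cf (forms F k 2 ^+ (2 ^ q.+1 - 1)) (fun a => (2 ^ q - 1) * k.-1 + s a)%N = 1.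
Proof.
move=> idem; have ch2 := idem_char2 idem; elim: q => [|q IH] s.
  rewrite subn1 /= expr1 forms2_expand // /cf raddf_sum /= (bigD1 s) //=.
  rewrite big1 ?addr0; last first.
    move=> t ts; rewrite [LHS](cfX F) (_ : [forall _, _] = false) //.
    apply: contraNF ts => /forallP h; apply/eqP/permP => a; apply/ord_inj/eqP.
    by have := h a; rewrite mul0n add0n.
  by rewrite [LHS](cfX F) (_ : [forall _, _]) //; apply/forallP => a; rewrite mul0n add0n.
have -> : (2 ^ q.+2 - 1 = (2 ^ q.+1 - 1) * 2 + 1)%N by rewrite expnS; have := expn_gt0 2 q.+1; lia.
rewrite exprD expr1 exprM mulrC.
have alt e a b : a != b -> e a = e b -> cf (forms F k 2 ^+ (2 ^ q.+1 - 1)) e = 0.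
  rewrite (_ : (2 ^ q.+1 - 1 = (2 ^ q.+1 - 2).+1)%N); last first.
    by rewrite expnS; have := expn_gt0 2 q; lia.
  by rewrite exprS; apply: cf_alternating => //; rewrite rpredX // forms_sym.
rewrite -[RHS](vandermonde_step idem alt IH s); apply: eq_cf => a.
rewrite expnS; have := expn_gt0 2 q; nia.
Qed.

(** * Four variables: adding the product over triples *)

Lemma big_setC1 (T : Type) (idx : T) (op : Monoid.com_law idx) k (G : {set 'I_k.+1} -> T) :
  \big[op/idx]_(S : {set 'I_k.+1} | #|S| == k) G S = \big[op/idx]_(a < k.+1) G (~: [set a])%SET.
Proof.
have inj1 : {in [set: 'I_k.+1]%SET &, injective (fun a : 'I_k.+1 => (~: [set a])%SET)}.
  by move=> a b _ _ /finset.setC_inj/finset.set1_inj.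
rewrite [RHS](eq_bigl (fun a => a \in [set: 'I_k.+1]%SET)); last by move=> a; rewrite inE.
rewrite -(big_imset G inj1) /=.
apply: eq_bigl => S; apply/idP/imsetP => [Sk|[a _ ->]]; last by rewrite cardsC1 card_ord.
have : #|(~: S)%SET| == 1%N by have := cardsC S; rewrite (eqP Sk) card_ord => h; apply/eqP; lia.
by move=> /cards1P[a aS]; exists a; rewrite ?inE // -aS finset.setCK.
Qed.

Definition form_of (F : comNzRingType) (s : seq nat) : mpoly 4 F :=
  \sum_(i <- s) mpolyX F (mmon (fun a : 'I_4 => (a == i :> nat) : nat)).

(** Polynomials as lists of exponent lists, repetitions standing for multiplicity: the expansion
    becomes computable and only parities have to be read off. *)
Definition poly_of (F : comNzRingType) (L : seq (seq nat)) : mpoly 4 F :=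
  \sum_(e <- L) mpolyX F (mmon (fun a : 'I_4 => nth 0%N e a)).

Definition expand_forms (ss : seq (seq nat)) : seq (seq nat) :=
  foldr (fun s L => [seq [seq ((j == i) + nth 0 e j)%N | j <- iota 0 4] | i <- s, e <- L])
    [:: [:: 0; 0; 0; 0]%N] ss.

Lemma expand_formsE (F : comNzRingType) ss :
  \prod_(s <- ss) form_of F s = poly_of F (expand_forms ss).
Proof.
elim: ss => [|s ss IH] /=.
  rewrite big_nil /poly_of big_seq1 -mpolyX0; congr mpolyX; apply/mnmP => a.
  by rewrite mmonE mnm0E; case: a => -[|[|[|[|?]]]].
rewrite big_cons IH /poly_of big_allpairs_dep /= mulr_suml; apply: eq_bigr => i _.
rewrite mulr_sumr; apply: eq_bigr => e _; rewrite -mpolyXD; congr mpolyX.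
apply/mnmP => a; rewrite mnmDE !mmonE.
by case: a => -[|[|[|[|?]]]].
Qed.

Definition pairs4 : seq (seq nat) :=
  [:: [:: 0; 1]; [:: 0; 2]; [:: 0; 3]; [:: 1; 2]; [:: 1; 3]; [:: 2; 3]]%N.

Definition triples4 : seq (seq nat) :=
  [:: [:: 1; 2; 3]; [:: 0; 2; 3]; [:: 0; 1; 3]; [:: 0; 1; 2]]%N.

Lemma mnm1_mmon (F : comNzRingType) (a : 'I_4) :
  mpolyX F (mnm1 a) = mpolyX F (mmon (fun b : 'I_4 => (b == a :> nat) : nat)).
Proof.
by congr mpolyX; apply/mnmP => b; rewrite mnm1E mmonE eq_sym -(inj_eq val_inj).
Qed.

Lemma forms2_pairs4 (F : comNzRingType) :
  forms F 4 2 = \prod_(s <- pairs4) form_of F s.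
Proof.
rewrite /forms prod_pairs.
transitivity (\prod_(i < 4) \prod_(j < 4 | (i < j)%N) form_of F [:: i : nat; j : nat]).
  apply: eq_bigr => i _; apply: eq_bigr => j ij.
  rewrite big_setU1 /= ?big_set1; last by rewrite inE; apply: contraTneq ij => ->; rewrite ltnn.
  by rewrite /form_of !mnm1_mmon !big_cons big_nil addr0.
transitivity (\prod_(i < 4) \prod_(j < 4)
    if (i < j)%N then form_of F [:: i : nat; j : nat] else 1).
  by apply: eq_bigr => i _; rewrite -big_mkcond.
rewrite !big_ord_recl !big_ord0 /= /pairs4 !big_cons !big_nil.
by rewrite !(mul1r, mulr1) !mulrA.
Qed.

Lemma forms3_triples4 (F : comNzRingType) :
  forms F 4 3 = \prod_(s <- triples4) form_of F s.
Proof.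
rewrite /forms big_setC1.
transitivity (\prod_(a < 4) \sum_(b < 4 | b != a) mpolyX F (mmon (fun c : 'I_4 => (c == b :> nat) : nat))).
  apply: eq_bigr => a _; apply: eq_big => [b|b _]; last exact: mnm1_mmon.
  by rewrite !inE.
transitivity (\prod_(a < 4) \sum_(b < 4)
    if b != a then mpolyX F (mmon (fun c : 'I_4 => (c == b :> nat) : nat)) else 0).
  by apply: eq_bigr => i _; rewrite -big_mkcond.
rewrite !big_ord_recl !big_ord0 /=.
rewrite /triples4 /form_of !big_cons !big_nil.
by rewrite !(mul1r, mulr1, add0r, addr0) !mulrA.
Qed.

(* With exponents 2c + 4 + a in place of e, the term x^de of V * P3 contributes
   1 if de is good, and 0 by parity or by alternation if it is bad. *)
Definition good_exp (de : seq nat) : bool :=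
  all (fun a => (nth 0 de a <= 4 + a) && ~~ odd (4 + a - nth 0 de a) &&
                ((4 + a - nth 0 de a)./2 < 4))%N (iota 0 4) &&
  uniq [seq ((4 + a - nth 0 de a)./2)%N | a <- iota 0 4].

Definition bad_exp (de : seq nat) : bool :=
  has (fun a => odd (a + nth 0 de a)%N) (iota 0 4) ||
  has (fun a => has (fun b => (a != b) && (a + nth 0 de b == b + nth 0 de a)%N) (iota 0 4)) (iota 0 4).

(** Checked by running through the 2^6 * 3^4 terms of the expansion. *)
Lemma good_or_bad :
  let L := expand_forms (pairs4 ++ triples4) in
  all (fun de => good_exp de || bad_exp de) L && odd (count good_exp L).
Proof. by vm_compute. Qed.

Lemma natr_odd (F : comNzRingType) m : (forall x : F, x + x = 0) -> m%:R = (odd m)%:R :> F.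
Proof.
by move=> ch2; rewrite -[in LHS](odd_double_half m) natrD -addnn natrD ch2 addr0.
Qed.

Lemma cf_sum (F : comNzRingType) k (J : Type) (r : seq J) (p : J -> mpoly k F) e :
  cf (\sum_(j <- r) p j) e = \sum_(j <- r) cf (p j) e.
Proof. by rewrite /cf raddf_sum. Qed.

(** The shift 4 is dictated by degrees: 6 and 4 for the two products, and [2 * (4 * c + 6)] for the
    square, make [4 * (2 * c + 4) + 6] in all. The identity ordering is enough, since symmetry gives
    the others. *)
Lemma triple_step (F : comNzRingType) (p : mpoly 4 F) (c : nat) :
  (forall x : F, x * x = x) ->
  (forall e a b, a != b -> e a = e b -> cf p e = 0) ->
  (forall s : 'S_4, cf p (fun a => c + s a)%N = 1) ->
  cf (forms F 4 2 * forms F 4 3 * p ^+ 2) (fun a => 2 * c + 4 + a)%N = 1.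
Proof.
move=> idem alt one; have ch2 := idem_char2 idem.
rewrite forms2_pairs4 forms3_triples4 -big_cat expand_formsE /poly_of mulr_suml cf_sum.
have /andP[] := good_or_bad; move: (expand_forms _) => L /allP gb oddg.
rewrite (eq_big_seq (fun de => (good_exp de)%:R)).
  rewrite -natr_sum (_ : (\sum_(de <- _) good_exp de)%N = count good_exp L).
    by rewrite (natr_odd _ ch2) oddg.
  by rewrite -sum1_count [RHS]big_mkcond; apply: eq_bigr => de _; case: good_exp.
move=> de /gb; rewrite cfXM; have [gd _|/negPf gd /= bd] := boolP (good_exp de).
  have /andP[/allP h1 un] := gd.
  have h (a : 'I_4) : [&& (nth 0%N de a <= 4 + a)%N, ~~ odd (4 + a - nth 0%N de a)%N &
      ((4 + a - nth 0%N de a)./2 < 4)%N].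
    by have := h1 a; rewrite mem_iota ltn_ord -andbA; apply.
  rewrite ifT; last by apply/forallP => a; move: (h a) => /and3P[/= h2 _ _]; rewrite /=; clear -h2; lia.
  rewrite cf_sqr // ifT; last by apply/forallP => a; move: (h a) => /and3P[/=]; move: (nth 0%N de a) (nat_of_ord a) => x y; clear; lia.
  pose f (a : 'I_4) : 'I_4 := inord ((4 + a - nth 0%N de a)./2)%N.
  have fE a : f a = ((4 + a - nth 0%N de a)./2)%N :> nat.
    by rewrite inordK //; have /and3P[] := h a.
  have fi : injective f.
    move=> a b fab; apply/ord_inj/eqP.
    rewrite -(nth_uniq 0%N _ _ un) ?size_map ?size_iota //.
    by rewrite !(nth_map 0%N) ?size_iota // !nth_iota // !add0n -!fE fab.
  rewrite -[RHS](one (perm fi)); apply: eq_cf => a.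
  by rewrite permE fE; move: (h a) => /and3P[/=]; move: (nth 0%N de a) (nat_of_ord a) => x y; clear; lia.
case: ifP => // /forallP le; rewrite cf_sqr //; case: ifP => // /forallP ev.
have ev' (a : 'I_4) : odd (a + nth 0%N de a)%N = false.
  have := le a; have := ev a => /=; move: (nat_of_ord a) (nth _ _ _) => x y; lia.
case/orP: bd => [/hasP[x]|/hasP[x xi /hasP[y yi /andP[xy /eqP e]]]].
  rewrite mem_iota /= => x4; by have := ev' (Ordinal x4) => /= ->.
move: xi yi; rewrite !mem_iota /= => x4 y4.
apply: (alt _ (Ordinal x4) (Ordinal y4)) => //=.
have := le (Ordinal x4); have := le (Ordinal y4) => /=.
move: e; clear; move: (nth _ _ _) (nth _ _ _) => u v e h1 h2.
by congr (_./2); lia.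
Qed.

(** Induction on the binary digits of [n]: with [W] the case of [n./2], an even [n] gives the
    Vandermonde product times the square of [W], and an odd [n] brings one extra triple product. *)
Lemma forms23_pow (F : comNzRingType) q n :
  (forall x : F, x * x = x) -> (n < 2 ^ q.+1)%N ->
  forall s : 'S_4, cf (forms F 4 2 ^+ (2 ^ q.+1 - 1) * forms F 4 3 ^+ n)
    (fun a => (2 ^ q - 1) * 3 + n + s a)%N = 1.
Proof.
move=> idem; have ch2 := idem_char2 idem; elim: q n => [|q IH] n nq s.
  case: n nq => [|[|//]] _.
    rewrite expr0 mulr1 -[RHS](forms2_pow 0 idem s).
    by apply: eq_cf => a; rewrite addn0.
  (* The case [q = 0], [n = 1]: the coefficient at exponents 1, 2, 3, 4, whose parity is
     computed. *)
  have st : cf (forms F 4 2 * forms F 4 3) (fun a : 'I_4 => (1 + a)%N) = 1.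
    rewrite forms2_pairs4 forms3_triples4 -big_cat expand_formsE /poly_of cf_sum.
    rewrite (eq_bigr (fun de => ([:: 1; 2; 3; 4] == [seq nth 0 de a | a <- iota 0 4])%N%:R)); last first.
      move=> de _; rewrite cfX; congr (_%:R); congr nat_of_bool.
      apply/forallP/eqP => [h|[h0 h1 h2 h3]]; last first.
        by case=> -[|[|[|[|//]]]] /= i; rewrite -?h0 -?h1 -?h2 -?h3.
      have := h (@Ordinal 4 0 isT); have := h (@Ordinal 4 1 isT).
      have := h (@Ordinal 4 2 isT); have := h (@Ordinal 4 3 isT) => /=.
      by move=> /eqP -> /eqP -> /eqP -> /eqP ->.
    rewrite -natr_sum natr_odd //.
    rewrite (_ : (\sum_(de <- _) _)%N = count (fun de =>
        [:: 1; 2; 3; 4] == [seq nth 0 de a | a <- iota 0 4])%N (expand_forms (pairs4 ++ triples4))).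
      by have -> : odd (count (fun de => [:: 1; 2; 3; 4] == [seq nth 0 de a | a <- iota 0 4])%N
        (expand_forms (pairs4 ++ triples4))) by vm_compute.
    by rewrite -sum1_count [RHS]big_mkcond; apply: eq_bigr => de _; case: eqP.
  rewrite subn1 /= !expr1; rewrite -[RHS]st -[RHS](cf_sym s).
    by apply: eq_cf => a; rewrite mul0n add0n.
  by rewrite rpredM ?forms_sym.
have -> : (2 ^ q.+2 - 1 = (2 ^ q.+1 - 1) * 2 + 1)%N by rewrite expnS; have := expn_gt0 2 q.+1; lia.
set W := forms F 4 2 ^+ (2 ^ q.+1 - 1) * forms F 4 3 ^+ n./2.
have n2 : (n./2 < 2 ^ q.+1)%N by move: nq; rewrite [(2 ^ q.+2)%N]expnS; lia.
have Wsym : W \is symmetric by rewrite rpredM // rpredX // forms_sym.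
have alt e a b : a != b -> e a = e b -> cf W e = 0.
  rewrite /W (_ : (2 ^ q.+1 - 1 = (2 ^ q.+1 - 2).+1)%N); last first.
    by rewrite expnS; have := expn_gt0 2 q; lia.
  rewrite exprS -mulrA; apply: cf_alternating => //.
  by rewrite rpredM // rpredX // forms_sym.
have q0 := expn_gt0 2 q.
rewrite exprD expr1 -[in forms F 4 3 ^+ n](odd_double_half n) exprD.
have WE : forms F 4 2 ^+ ((2 ^ q.+1 - 1) * 2) * forms F 4 3 ^+ (n./2).*2 = W ^+ 2.
  by rewrite /W exprMn -!exprM -muln2.
have [no|ne] := boolP (odd n).
  rewrite expr1 (_ : _ * _ = forms F 4 2 * forms F 4 3 * W ^+ 2); last first.
    by rewrite -WE; ring.
  rewrite -[RHS](triple_step idem alt (IH _ n2)) -[RHS](cf_sym s).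
    by apply: eq_cf => a; rewrite expnS; lia.
  by rewrite !rpredM ?rpredX ?forms_sym.
rewrite expr0 mul1r (_ : _ * _ = forms F 4 2 * W ^+ 2); last by rewrite -WE; ring.
rewrite -[RHS](vandermonde_step idem alt (IH _ n2) s); apply: eq_cf => a.
by rewrite expnS; lia.
Qed.

(** * Weights on the faces of the cube; the case of four members *)

(** Only the coordinates of [x] in [T] matter: the pair stands for the face through the vertex [x]
    whose free directions lie outside [T], and every vertex of a face represents it. *)
Definition cube_weight (R : realType) (I : finType) (k : nat) (p : I -> 'I_k -> bool -> R)
    (T : {set 'I_k}) (x : {ffun 'I_k -> bool}) : R :=
  \sum_A \prod_(a in T) p A a (x a).

Definition cube_char (R : realType) (k : nat) (S : {set 'I_k}) (x : {ffun 'I_k -> bool}) : R :=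
  \prod_(a in S) (if x a then 1 else -1).

Definition weight_fourier (R : realType) (I : finType) (k l : nat)
    (p : I -> 'I_k -> bool -> R) (S : {set 'I_k}) : R :=
  \sum_x cube_char R S x * \sum_(T : {set 'I_k} | #|T| == l) cube_weight p T x.

Definition sign_separated (R : realType) (I : finType) (k : nat) (p : I -> 'I_k -> bool -> R)
    (A B : I) : Prop := exists a s, 0 < p A a s /\ 0 < p B a (~~ s).

Definition bflip (k : nat) (b : 'I_k) (x : {ffun 'I_k -> bool}) : {ffun 'I_k -> bool} :=
  fupd x b (~~ x b).

Lemma bflipK k (b : 'I_k) : involutive (bflip b).
Proof. by move=> x; rewrite /bflip fupd_fupd fupd_eq negbK; apply: fupd_id. Qed.

Lemma cube_char_flip (R : realType) k (S : {set 'I_k}) b x :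
  cube_char R S (bflip b x) = if b \in S then - cube_char R S x else cube_char R S x.
Proof.
rewrite /cube_char; case: ifP => bS.
  rewrite (bigD1 b) //= [in RHS](bigD1 b) //= /bflip fupd_eq -mulNr; congr (_ * _).
    by case: (x b); rewrite ?opprK.
  by apply: eq_bigr => a /andP[_ ab]; rewrite fupd_neq.
by apply: eq_bigr => a aS; rewrite fupd_neq //; apply: contraTneq aS => ->; rewrite bS.
Qed.

Lemma cube_weight_flip (R : realType) (I : finType) k (p : I -> 'I_k -> bool -> R)
    (T : {set 'I_k}) b x : b \notin T -> cube_weight p T (bflip b x) = cube_weight p T x.
Proof.
move=> bT; apply: eq_bigr => A _; apply: eq_bigr => a aT.
by rewrite fupd_neq //; apply: contraTneq aT => ->.
Qed.

(** Flipping a coordinate in [S] but outside [T] negates the character and preserves the weight. *)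
Lemma cube_weight_orth (R : realType) (I : finType) k (p : I -> 'I_k -> bool -> R)
    (S T : {set 'I_k}) : ~~ (S \subset T) -> \sum_x cube_char R S x * cube_weight p T x = 0.
Proof.
move=> /subsetPn[b bS bT].
set s := \sum_x _; suff : s = - s by move=> h; lra.
rewrite {1}/s (reindex_inj (inv_inj (bflipK b))) /= -sumrN; apply: eq_bigr => x _.
by rewrite cube_char_flip bS cube_weight_flip // mulNr.
Qed.

Lemma weight_fourierE (R : realType) (I : finType) k l (p : I -> 'I_k -> bool -> R)
    (S : {set 'I_k}) : weight_fourier l p S =
  \sum_(T : {set 'I_k} | (#|T| == l) && (S \subset T)) \sum_x cube_char R S x * cube_weight p T x.
Proof.
rewrite /weight_fourier; under eq_bigr do rewrite mulr_sumr.
rewrite exchange_big /= (bigID (fun T : {set 'I_k} => S \subset T)) /=.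
by rewrite [X in _ + X]big1 ?addr0 // => T /andP[_ ST]; apply: cube_weight_orth.
Qed.

Lemma cube_weight_ge0 (R : realType) (I : finType) k (p : I -> 'I_k -> bool -> R) T x :
  (forall A a s, 0 <= p A a s) -> 0 <= cube_weight p T x.
Proof. by move=> p0; apply: sumr_ge0 => A _; apply: prodr_ge0. Qed.

Lemma cube_weight_gt0 (R : realType) (I : finType) k (p : I -> 'I_k -> bool -> R) T x :
  (forall A a s, 0 <= p A a s) -> cube_weight p T x != 0 ->
  exists A, {in T, forall a, 0 < p A a (x a)}.
Proof.
move=> p0; rewrite psumr_neq0; last by move=> A _; apply: prodr_ge0.
case/hasP => A _ /= pA; exists A => a aT.
rewrite lt_neqAle p0 andbT eq_sym; apply: contraTneq pA => pa.
by rewrite (bigD1 a) //= pa mul0r ltxx.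
Qed.

Lemma cube_weight_eq0 (R : realType) (I : finType) k (p : I -> 'I_k -> bool -> R) T x A :
  (forall A a s, 0 <= p A a s) -> cube_weight p T x = 0 ->
  exists2 a, a \in T & p A a (x a) = 0.
Proof.
move=> p0 /eqP; rewrite psumr_eq0; last by move=> B _; apply: prodr_ge0.
by move=> /allP/(_ A (mem_index_enum _))/prodf_eq0[a aT /eqP pa]; exists a.
Qed.

Definition two_separated (R : realType) (I : finType) (k : nat)
    (p : I -> 'I_k -> bool -> R) (a : 'I_k) (s : bool) : Prop :=
  exists A B, [/\ sign_separated p A B, 0 < p A a s & 0 < p B a s].

(* Two separated members on each of the two sides would be four in all. *)
Lemma side_without_two (R : realType) (I : finType) k (p : I -> 'I_k -> bool -> R) :
  ~ (exists f : 'I_4 -> I, forall i j, i != j -> sign_separated p (f i) (f j)) ->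
  forall a, exists e, ~ two_separated p a (~~ e).
Proof.
move=> no4 a; apply: contrapT => h.
have both s : two_separated p a s.
  by apply: contrapT => hs; apply: h; exists (~~ s); rewrite negbK.
have [A [B [AB A1 B1]]] := both true; have [C [D [CD C1 D1]]] := both false.
have sym U V : sign_separated p U V -> sign_separated p V U.
  by move=> [c [s [U0 V0]]]; exists c, (~~ s); rewrite negbK.
have cross U V : 0 < p U a true -> 0 < p V a false -> sign_separated p U V.
  by move=> U0 V0; exists a, true.
apply: no4; exists (fun i : 'I_4 => nth A [:: A; B; C; D] i).
move=> [[|[|[|[|//]]]] hi] [[|[|[|[|//]]]] hj] //= _;
  solve [done | exact: cross | exact: sym | apply: sym; exact: cross].
Qed.

Lemma no_four_weights (R : realType) (I : finType) k (p : I -> 'I_k -> bool -> R) :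
  (forall A a s, 0 <= p A a s) ->
  ~ (exists f : 'I_4 -> I, forall i j, i != j -> sign_separated p (f i) (f j)) ->
  (forall S : {set 'I_k}, (0 < #|S| <= 2)%N -> weight_fourier 2 p S = 0) ->
  forall (T : {set 'I_k}) x, #|T| = 2 -> cube_weight p T x = 0.
Proof.
(* Two separated members can share only the side [e a] of row [a]; [sg] counts that side as
   positive. *)
move=> p0 /side_without_two/choice[e he] four.
pose sg (x : {ffun 'I_k -> bool}) a : R := if x a == e a then 1 else -1.
pose se a : R := if e a then 1 else -1.
have seK a : se a * se a = 1 by rewrite /se; case: (e a); rewrite ?mulr1 // mulrNN mulr1.
have sgE x a : sg x a = se a * (if x a then 1 else -1).
  by rewrite /sg /se; case: (e a); case: (x a); rewrite /= ?mul1r ?mulN1r ?opprK.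
pose W a b x := cube_weight p [set a; b]%SET x.
have W0 a b x : 0 <= W a b x by apply: cube_weight_ge0.
have Wsym a b x : W a b x = W b a x by rewrite /W finset.setUC.
have mem a b x : W a b x != 0 -> exists A, 0 < p A a (x a) /\ 0 < p A b (x b).
  move=> /(cube_weight_gt0 p0)[A hA]; exists A.
  by split; apply: hA; rewrite !inE eqxx ?orbT.
(* No other 2-element set contains [{a, b}], so the coefficient of degree 2 isolates the weight of
   this pair. *)
have pair a b : a != b -> \sum_x sg x a * sg x b * W a b x = 0.
  move=> ab; have ab2 : #|[set a; b]%SET| = 2 by rewrite cards2 ab.
  have := four [set a; b]%SET; rewrite ab2 => /(_ isT); rewrite weight_fourierE.
  rewrite (big_pred1 [set a; b]%SET) => [h|T]; last first.
    rewrite /= andbC; apply/andP/eqP => [[sT /eqP cT]|->]; last by rewrite ab2 subxx.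
    by apply/esym/eqP; rewrite eqEcard sT cT ab2.
  transitivity (se a * se b * (\sum_x cube_char R [set a; b]%SET x * W a b x)).
    rewrite mulr_sumr; apply: eq_bigr => x _.
    rewrite /cube_char big_setU1 /= ?inE // big_set1 !sgE.
    by move: (se a) (se b) (W a b x) (if x a then 1 else -1) (if x b then 1 else -1) => *; ring.
  by rewrite [X in _ * X]h mulr0.
(* A member [A] negative for both [a] and [b] excludes mixed signs: a member with mixed signs would
   be separated from [A] by one row and share the negative side of the other. The alternating sum
   [pair] would then be positive. *)
have mm a b (x : {ffun 'I_k -> bool}) : a != b -> x a != e a -> x b != e b -> W a b x = 0.
  move=> ab xa xb; apply: contrapT => /eqP Wx.
  have [A [Aa Ab]] := mem _ _ _ Wx.
  have odd0 (y : {ffun 'I_k -> bool}) : sg y a * sg y b = -1 -> W a b y = 0.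
    move=> sy; apply: contrapT => /eqP /mem [B [Ba Bb]].
    have na (c : 'I_k) (z : {ffun 'I_k -> bool}) : z c != e c -> z c = ~~ e c.
      by case: (z c); case: (e c).
    move: sy; rewrite /sg; case: (eqVneq (y a) (e a)) => ya; case: (eqVneq (y b) (e b)) => yb.
    - by rewrite mulr1 => h; exfalso; lra.
    - move=> _; apply: (he b); exists A, B; split.
      + exists a, (x a); split=> //; by rewrite (na _ _ xa) negbK -ya.
      + by rewrite -(na _ _ xb).
      + by rewrite -(na _ _ yb).
    - move=> _; apply: (he a); exists A, B; split.
      + exists b, (x b); split=> //; by rewrite (na _ _ xb) negbK -yb.
      + by rewrite -(na _ _ xa).
      + by rewrite -(na _ _ ya).
    - by rewrite mulrNN mulr1 => h; exfalso; lra.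
  have := pair a b ab; apply/eqP; rewrite gt_eqF // (bigD1 x) //=.
  rewrite ltr_pwDl //.
    rewrite /sg (negPf xa) (negPf xb) mulrNN !mul1r lt_neqAle W0 andbT eq_sym //.
  apply: sumr_ge0 => y _.
  have [s1|s1] := eqVneq (sg y a * sg y b) (-1); first by rewrite odd0 // mulr0.
  have -> : sg y a * sg y b = 1; last by rewrite mul1r.
  by move: s1; rewrite /sg; case: ifP => _; case: ifP => _; rewrite ?mulr1 ?mul1r ?mulrNN ?mulr1 ?eqxx.
(* Subtracting the vanishing sum [pair] turns the coefficient of degree 1 into a sum of nonnegative
   terms. *)
have one a b : a != b -> \sum_x sg x a * W a b x =
    \sum_(x : {ffun 'I_k -> bool}) (if (x a == e a) && (x b != e b) then 2 * W a b x else 0).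
  move=> ab; have h := pair a b ab; apply: etrans (_ : _ - 0 = _); first by rewrite subr0.
  rewrite -[X in _ - X]h -sumrB; apply: eq_bigr => x _.
  rewrite /sg; case: (eqVneq (x a) (e a)) => xa; case: (eqVneq (x b) (e b)) => xb /=.
  - by rewrite !mul1r subrr.
  - by ring.
  - by rewrite mulr1 subrr.
  - by rewrite mm //; ring.
have pm a b (x : {ffun 'I_k -> bool}) : a != b -> x a = e a -> x b != e b -> W a b x = 0.
  move=> ab xa xb.
  (* The coefficient at [{a}] adds these nonnegative sums over all partners of [a], so each of them
     must vanish. *)
  have E : \sum_(c | c != a) \sum_y sg y a * W a c y = 0.
    have := four [set a]%SET; rewrite cards1 => /(_ isT); rewrite weight_fourierE => h.
    transitivity (se a * \sum_(T : {set 'I_k} | (#|T| == 2) && ([set a]%SET \subset T))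
      \sum_x cube_char R [set a]%SET x * cube_weight p T x); last by rewrite h mulr0.
    rewrite mulr_sumr.
    have inj1 : {in [set c | c != a]%SET &, injective (fun c => [set a; c]%SET)}.
      move=> c c'; rewrite !inE => ca c'a /finset.setP/(_ c).
      by rewrite !inE eqxx orbT (negPf ca) /= => /esym/eqP.
    rewrite [LHS](eq_bigl (fun c => c \in [set c | c != a]%SET)); last by move=> c; rewrite inE.
    rewrite -(big_imset (fun T => \sum_y sg y a * cube_weight p T y) inj1) /=.
    apply: eq_big => [T|T _].
      apply/imsetP/andP => [[c]|[/cards2P[c [c' [cc' ->]]]]].
        rewrite inE => ca ->; have ac : a != c by rewrite eq_sym.
        rewrite cards2 ac; split=> //.
        by rewrite finset.sub1set !inE eqxx.
      rewrite finset.sub1set !inE => /orP[/eqP ->|/eqP ->].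
        by exists c'; rewrite ?inE // eq_sym.
      by exists c; rewrite ?inE // finset.setUC.
    rewrite mulr_sumr; apply: eq_bigr => y _.
    by rewrite sgE /cube_char big_set1 mulrA.
  have ge0 c (y : {ffun 'I_k -> bool}) : 0 <= (if (y a == e a) && (y c != e c) then 2 * W a c y else 0).
    by case: ifP => // _; rewrite mulr_ge0.
  move: E; rewrite (eq_bigr (fun c => \sum_(y : {ffun 'I_k -> bool})
      (if (y a == e a) && (y c != e c) then 2 * W a c y else 0))); last first.
    by move=> c ca; rewrite one // eq_sym.
  move=> /eqP; rewrite psumr_eq0; last by move=> c _; apply: sumr_ge0.
  move=> /allP/(_ b (mem_index_enum _)); rewrite eq_sym ab /= psumr_eq0 //.
  move=> /allP/(_ x (mem_index_enum _)); rewrite xa eqxx xb /=.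
  by rewrite mulf_eq0 pnatr_eq0 /= => /eqP.
have pp a b (x : {ffun 'I_k -> bool}) : a != b -> x a = e a -> x b = e b -> W a b x = 0.
  move=> ab xa xb; have := pair a b ab; rewrite (eq_bigr (fun y => W a b y)).
    move=> /eqP; rewrite psumr_eq0 // => /allP/(_ x (mem_index_enum _))/eqP; exact.
  move=> y _; case: (eqVneq (y a) (e a)) => ya; case: (eqVneq (y b) (e b)) => yb.
  - by rewrite /sg ya yb !eqxx !mul1r.
  - by rewrite pm // mulr0.
  - by rewrite Wsym pm ?mulr0 // eq_sym.
  - by rewrite mm // mulr0.
move=> T x /eqP /cards2P[a [b [ab ->]]].
rewrite -/(W a b x); case: (eqVneq (x a) (e a)) => xa; case: (eqVneq (x b) (e b)) => xb.
- exact: pp.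
- exact: pm.
- by rewrite Wsym pm // eq_sym.
- exact: mm.
Qed.

(** * Hall's marriage theorem *)

Definition nbhd (U V : finType) (e : U -> V -> bool) (X : {set U}) : {set V} :=
  [set y | [exists x in X, e x y]]%SET.

Lemma nbhdU (U V : finType) (e : U -> V -> bool) (X Y : {set U}) :
  nbhd e (X :|: Y)%SET = (nbhd e X :|: nbhd e Y)%SET.
Proof.
apply/finset.setP => y; rewrite !inE; apply/existsP/orP => [[x]|].
  rewrite inE => /andP[/orP[xX|xY] exy]; [left|right]; apply/existsP; exists x; by rewrite ?xX ?xY.
by move=> [] /existsP[x /andP[h exy]]; exists x; rewrite inE h ?orbT.
Qed.

(** Halmos-Vaughan induction on the size of [A]: a proper nonempty tight set splits the problem in
    two; if there is none, one edge can be fixed and removed. [v0] is the value of [f] when [A] is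
    empty. *)
Theorem hall_marriage (U V : finType) (v0 : V) (e : U -> V -> bool) (A : {set U}) (B : {set V}) :
  (forall X : {set U}, X \subset A -> (#|X| <= #|nbhd e X :&: B|)%N) ->
  exists2 f : U -> V, {in A &, injective f} & {in A, forall x, e x (f x) && (f x \in B)}.
Proof.
move: {2}(#|A|) (leqnn #|A|) => n; elim: n A B => [|n IH] A B.
  rewrite leqn0 cards_eq0 => /eqP -> _; exists (fun=> v0) => x; by rewrite inE.
move=> An hall; have [A0|[x xA]] := set_0Vmem A.
  by exists (fun=> v0) => x; rewrite A0 inE.
case: (boolP [exists X : {set U}, [&& X \proper A, X != finset.set0 & #|X| == #|nbhd e X :&: B|]]).
  move=> /existsP[X /and3P[XA X0 /eqP cX]].
  have XsA := proper_sub XA.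
  have [||f finj fe] := IH X B.
  - by rewrite -ltnS (leq_trans (proper_card XA)).
  - by move=> Y YX; apply: hall; apply: fintype.subset_trans YX XsA.
  have [||g ginj ge] := IH (A :\: X)%SET (B :\: nbhd e X)%SET.
  - have := cardsD A X; rewrite (finset.setIidPr XsA); have := card_gt0 X.
    by rewrite X0 => X1 ->; lia.
  - move=> Y YAX.
    have dXY : (X :&: Y)%SET = finset.set0.
      apply/finset.setP => z; rewrite !inE; apply/negbTE/negP => /andP[zX].
      by move=> /(fintype.subsetP YAX); rewrite !inE zX.
    have := hall (X :|: Y)%SET; rewrite finset.subUset XsA (fintype.subset_trans YAX (finset.subsetDl _ _)).
    move=> /(_ isT); rewrite cardsU dXY cards0 subn0 nbhdU finset.setIUl => h.
    have h2 : (#|(nbhd e X :&: B) :|: (nbhd e Y :&: B)|%SET <=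
        #|nbhd e X :&: B| + #|nbhd e Y :&: (B :\: nbhd e X)|)%N.
      apply: leq_trans (_ : #|(nbhd e X :&: B) :|: (nbhd e Y :&: (B :\: nbhd e X))|%SET <= _)%N.
        apply: subset_leq_card; apply/fintype.subsetP => z; rewrite !(finset.in_setU, finset.in_setI, finset.in_setD).
        by case: (z \in nbhd e X); case: (z \in B); case: (z \in nbhd e Y).
      by rewrite cardsU leq_subr.
    by move: (leq_trans h h2); rewrite -cX leq_add2l.
  exists (fun z => if z \in X then f z else g z) => [y z yA zA|y yA].
    have out w : w \in A -> w \notin X -> w \in (A :\: X)%SET by move=> wA wX; rewrite inE wX.
    have fN w : w \in X -> f w \in nbhd e X.
      by move=> wX; rewrite inE; apply/existsP; exists w; rewrite wX; case/andP: (fe _ wX).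
    have gN w : w \in A -> w \notin X -> g w \notin nbhd e X.
      by move=> wA wX; have /andP[_] := ge _ (out _ wA wX); rewrite inE => /andP[].
    case: ifP => yX; case: ifP => zX.
    - exact: finj.
    - by move=> fg; have := gN _ zA (negbT zX); rewrite -fg fN.
    - by move=> fg; have := gN _ yA (negbT yX); rewrite fg fN.
    - by apply: ginj; apply: out => //; rewrite ?yX ?zX.
  case: ifP => yX; first exact: fe.
  have := ge y; rewrite inE yX yA => /(_ isT) /andP[->]; by rewrite inE => /andP[].
rewrite negb_exists => /forallP tight.
have [y] : exists y, y \in (nbhd e [set x] :&: B)%SET.
  apply/finset.set0Pn; rewrite -card_gt0; apply: leq_trans (hall [set x]%SET _); rewrite ?cards1 //.
  by rewrite finset.sub1set.
rewrite inE => /andP[]; rewrite inE => /existsP[x' /andP[]].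
rewrite inE => /eqP -> {x'} exy yB.
have [||f finj fe] := IH (A :\ x)%SET (B :\ y)%SET.
- by have := cardsD1 x A; rewrite xA; lia.
- move=> Y YA; have [->|Y0] := eqVneq Y finset.set0; first by rewrite cards0.
  have YpA : Y \proper A.
    apply/fintype.properP; split; first exact: fintype.subset_trans YA (finset.subsetDl _ _).
    by exists x => //; apply: contraTN isT => /(fintype.subsetP YA); rewrite !inE eqxx.
  have := tight Y; rewrite YpA Y0 /= => ne.
  have lt := hall Y (proper_sub YpA).
  have : (#|nbhd e Y :&: B| <= #|nbhd e Y :&: (B :\ y)| + 1)%N.
    rewrite finset.setIDA; have := cardsD1 y (nbhd e Y :&: B); case: (_ \in _); lia.
  by move: ne lt; lia.
exists (fun z => if z == x then y else f z) => [z w zA wA|z zA].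
  have yf u : u \in A -> u != x -> f u != y.
    by move=> uA ux; have := fe u; rewrite !inE ux uA => /(_ isT)/andP[_ /andP[]].
  case: eqVneq => [->|zx]; case: eqVneq => [->//|wx].
  - by move=> h; have := yf _ wA wx; rewrite -h eqxx.
  - by move=> h; have := yf _ zA zx; rewrite h eqxx.
  - by apply: finj; rewrite !inE ?zx ?wx.
case: eqVneq => [->|zx]; first by rewrite exy.
by have := fe z; rewrite !inE zx zA => /(_ isT) /andP[-> /andP[_ ->]].
Qed.

(** * Perfect matchings of the 4-cube; the case of eight members *)

Lemma cube_char_orth (R : realType) k (x y : {ffun 'I_k -> bool}) :
  \sum_(S : {set 'I_k}) cube_char R S x * cube_char R S y = if x == y then 2 ^+ k else 0.
Proof.
rewrite (eq_bigr (fun S : {set 'I_k} => \prod_a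
    (if a \in S then (if x a then 1 else -1) * (if y a then 1 else -1) else 1))); last first.
  move=> S _; rewrite -big_split /= big_mkcond /=; apply: eq_bigr => a _.
  by case: ifP.
rewrite -(@bigA_distr _ _ _ _ _ _ (fun a => (if x a then 1 else -1) * (if y a then 1 else -1)) (fun=> 1)) /=.
case: eqP => [->|/eqP xy].
  rewrite (eq_bigr (fun=> 2)); first by rewrite prodr_const card_ord.
  by move=> a _; case: (y a); rewrite ?mulrNN mulr1.
have [a xya] : exists a, x a != y a.
  by apply/existsP; rewrite -negb_forall; apply: contra xy => /forallP h; apply/eqP/ffunP => a; apply/eqP.
by rewrite (bigD1 a) //=; case: (x a) xya; case: (y a) => // _; rewrite ?mul1r ?mulr1 addNr mul0r.
Qed.

Definition cube_even (k : nat) (x : {ffun 'I_k -> bool}) : bool := ~~ odd (\sum_a x a).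

Lemma cube_even_flip k (b : 'I_k) x : cube_even (bflip b x) = ~~ cube_even x.
Proof.
rewrite /cube_even (bigD1 b) //= [in RHS](bigD1 b) //= /bflip fupd_eq.
rewrite (eq_bigr (fun a => x a : nat)); last by move=> a ab; rewrite fupd_neq.
by rewrite !oddD !oddb; case: (x b); case: (odd _).
Qed.

(** Distinct even vertices differ in an even number of coordinates, hence in both [b] and [c]. So
    two edges that no coordinate off their directions distinguishes share their odd endpoint. *)
Lemma bflip_eq k (b c : 'I_k) (x y : {ffun 'I_k -> bool}) :
  cube_even x -> cube_even y -> x <> y ->
  (forall a, a != b -> a != c -> x a = y a) -> bflip b x = bflip c y.
Proof.
move=> ex ey xy same.
have [bc|bc] := eqVneq b c.
  subst c; case: xy; have off : (\sum_(a | a != b) x a = \sum_(a | a != b) y a)%N.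
    by apply: eq_bigr => a ab; rewrite same.
  move: ex ey; rewrite /cube_even (bigD1 b) //= (bigD1 (F := fun a => nat_of_bool (y a)) b) //=.
  rewrite off !oddD !oddb => ex ey; apply/ffunP => a.
  case: (eqVneq a b) => [->|ab]; last exact: same.
  by move: ex ey; case: (x b); case: (y b); case: (odd _).
have off : (\sum_(a | (a != b) && (a != c)) x a = \sum_(a | (a != b) && (a != c)) y a)%N.
  by apply: eq_bigr => a /andP[ab ac]; rewrite same.
have cb : c != b by rewrite eq_sym.
move: ex ey; rewrite /cube_even (bigD1 b) //= (bigD1 c) //=.
rewrite (bigD1 (F := fun a => nat_of_bool (y a)) b) //=.
rewrite (bigD1 (F := fun a => nat_of_bool (y a)) c) //= off !oddD !oddb => ex ey.
have ne : ~ (x b = y b /\ x c = y c).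
  move=> [xb xc]; apply: xy; apply/ffunP => a; have [->//|ab] := eqVneq a b.
  by have [->//|ac] := eqVneq a c; apply: same.
apply/ffunP => a; rewrite !fupdE; have [ab|ab] := eqVneq a b; have [ac|ac] := eqVneq a c.
- by rewrite -ab ac eqxx in bc.
- by rewrite ab; move: ex ey ne; case: (x b); case: (y b); case: (x c); case: (y c); case: (odd _) => //= _ _ [].
- by rewrite ac; move: ex ey ne; case: (x b); case: (y b); case: (x c); case: (y c); case: (odd _) => //= _ _ [].
- exact: same.
Qed.

Lemma card_cube_even k : #|[set x : {ffun 'I_k.+1 -> bool} | cube_even x]%SET| = (2 ^ k)%N.
Proof.
set E := [set x | _]%SET.
have : #|E| = #|(~: E)%SET|.
  rewrite -(card_imset _ (inv_inj (@bflipK k.+1 ord0))); congr #|pred_of_set _|.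
  apply/finset.setP => x; rewrite !inE; apply/imsetP/idP => [[y]|nx].
    by rewrite inE => ey ->; rewrite cube_even_flip ey.
  by exists (bflip ord0 x); rewrite ?bflipK // inE cube_even_flip.
have := cardsC E; rewrite card_ffun card_bool card_ord expnS; lia.
Qed.

Lemma no_eight_weights (R : realType) (I : finType) (p : I -> 'I_4 -> bool -> R) :
  (forall A a s, 0 <= p A a s) ->
  ~ (exists f : 'I_8 -> I, forall i j, i != j -> sign_separated p (f i) (f j)) ->
  (forall S : {set 'I_4}, (0 < #|S| <= 3)%N -> weight_fourier 3 p S = 0) ->
  forall (T : {set 'I_4}) x, #|T| = 3 -> cube_weight p T x = 0.
Proof.
move=> p0 no8 four.
pose G x := \sum_(T : {set 'I_4} | #|T| == 3) cube_weight p T x.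
(* Degree 4 costs no constraint: no 3-element set contains [S]. *)
have G0 (S : {set 'I_4}) : S != finset.set0 -> \sum_x cube_char R S x * G x = 0.
  move=> S0; have [S3|S4] := leqP #|S| 3.
    by have := four S; rewrite S3 card_gt0 S0 => /(_ isT).
  have := weight_fourierE 3 p S; rewrite /weight_fourier => ->.
  apply: big_pred0 => T; apply/negP => /andP[/eqP T3 /subset_leq_card].
  by rewrite T3 leqNgt S4.
pose c := G [ffun=> true].
(* Fourier inversion: only the coefficient at the empty set is left. *)
have Gc y : G y = c.
  have inv z : G z * 2 ^+ 4 = \sum_x cube_char R finset.set0 x * G x.
    transitivity (\sum_x \sum_(S : {set 'I_4}) cube_char R S z * (cube_char R S x * G x)).
      rewrite (bigD1 z) //= [X in _ + X]big1 ?addr0; last first.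
        move=> x xz; transitivity ((\sum_(S : {set 'I_4}) cube_char R S x * cube_char R S z) * G x).
          by rewrite mulr_suml; apply: eq_bigr => S _; ring.
        by rewrite cube_char_orth (negPf xz) mul0r.
      transitivity ((\sum_(S : {set 'I_4}) cube_char R S z * cube_char R S z) * G z).
        by rewrite cube_char_orth eqxx mulrC.
      by rewrite mulr_suml; apply: eq_bigr => S _; ring.
    rewrite exchange_big /= (bigD1 finset.set0) //= [X in _ + X]big1 ?addr0.
      by apply: eq_bigr => x _; rewrite /cube_char !big_set0 mul1r.
    by move=> S S0; rewrite -mulr_sumr G0 // mulr0.
  by apply: (mulIf (_ : 2 ^+ 4 != 0)); rewrite ?inv // expf_neq0.
(* The weight of the edge at [x] in direction [d]. These add up to [c] at every vertex, so after
   division by [c] they form a fractional perfect matching. *)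
pose w x d := cube_weight p (~: [set d])%SET x.
have w0 x d : 0 <= w x d by apply: cube_weight_ge0.
have wflip x d : w (bflip d x) d = w x d by apply: cube_weight_flip; rewrite !inE eqxx.
have Gw x : \sum_d w x d = c.
  by rewrite -(Gc x) /G big_setC1.
have c0 : 0 <= c by rewrite -(Gw [ffun=> true]); apply: sumr_ge0.
have [cz|cn] := eqVneq c 0.
  move=> T x T3; have := Gc x; rewrite cz => /eqP; rewrite psumr_eq0; last first.
    by move=> S _; apply: cube_weight_ge0.
  by move=> /allP/(_ T (mem_index_enum _)); rewrite T3 eqxx => /eqP.
have cp : 0 < c by rewrite lt_neqAle eq_sym cn.
exfalso; apply: no8.
pose e x y := [exists d, (y == bflip d x) && (w x d != 0)].
pose E := [set x : {ffun 'I_4 -> bool} | cube_even x]%SET.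
(* Hall's condition by double counting: the edges at [X] have total weight [c * #|X|], and every
   edge of positive weight among them ends in the neighbourhood of [X]. *)
have [X XE|f finj fe] := @hall_marriage _ _ [ffun=> true] e E [set: {ffun 'I_4 -> bool}]%SET.
  rewrite finset.setIT -(ler_nat R) -(ler_pM2l cp).
  have cardc (Y : {set {ffun 'I_4 -> bool}}) : c * #|Y|%:R = \sum_d \sum_(x in Y) w x d.
    by rewrite exchange_big /= (eq_bigr (fun=> c)) // sumr_const mulr_natr.
  rewrite !cardc; apply: ler_sum => d _.
  rewrite (reindex_inj (inv_inj (bflipK d))) /= big_mkcond [leRHS]big_mkcond /=.
  apply: ler_sum => y _; rewrite wflip; case: ifP => yX; last by case: ifP.
  have [->|wy] := eqVneq (w y d) 0; first by case: ifP.
  rewrite ifT // inE; apply/existsP; exists (bflip d y); rewrite yX /=.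
  by apply/existsP; exists d; rewrite bflipK eqxx wflip.
have /choice[g hg] : forall x, exists dA : 'I_4 * I, x \in E ->
    f x = bflip dA.1 x /\ forall a, a != dA.1 -> 0 < p dA.2 a (x a).
  move=> x; have [xE|xE] := boolP (x \in E); last first.
    have [A _] : exists A : I, True.
      have := cn; rewrite -(Gw x) psumr_neq0; last by move=> d _.
      by move=> /hasP[d _ /=]; rewrite lt0r => /andP[/(cube_weight_gt0 p0)[A _] _]; exists A.
    by exists (ord0, A).
  have /andP[/existsP[d /andP[/eqP fx /(cube_weight_gt0 p0)[A hA]]] _] := fe x xE.
  by exists (d, A) => _; split => // a ad; apply: hA; rewrite !inE.
have E8 : #|E| = 8 by rewrite card_cube_even.
pose x_ (i : 'I_8) : {ffun 'I_4 -> bool} := enum_val (cast_ord (esym E8) i).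
have x_E i : x_ i \in E by apply: enum_valP.
exists (fun i => (g (x_ i)).2) => i j ij.
have xij : x_ i != x_ j by rewrite (inj_eq enum_val_inj) (inj_eq (@cast_ord_inj _ _ _)).
have [fi hi] := hg _ (x_E i); have [fj hj] := hg _ (x_E j).
move: fi fj hi hj; set d := (g (x_ i)).1; set d' := (g (x_ j)).1 => fi fj hi hj.
(* A coordinate constant along both matching edges and different on them; without one they would
   share an endpoint, against injectivity of [f]. *)
have [a [ad ad' xa]] : exists a, [/\ a != d, a != d' & x_ i a != x_ j a].
  apply: contrapT => h.
  have same a : a != d -> a != d' -> x_ i a = x_ j a.
    by move=> ad ad'; apply: contrapT => /eqP xa; apply: h; exists a.
  have := xij; have := x_E i; have := x_E j; rewrite !inE => ej ei /eqP; apply.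
  apply: finj; rewrite ?inE // fi fj.
  by apply: bflip_eq => //; apply/eqP.
exists a, (x_ i a); split; first exact: hi.
by rewrite (_ : ~~ x_ i a = x_ j a) ?hj //; case: (x_ i a) xa; case: (x_ j a).
Qed.

(** * Affine functions on compact convex sets *)

Lemma coord_lip_continuous (R : realType) d (f : 'rV[R]_d -> R) (C : R) :
  0 <= C -> (forall (x y : 'rV[R]_d) e, 0 <= e -> (forall i, `|x ord0 i - y ord0 i| <= e) ->
    `|f x - f y| <= C * e) -> continuous f.
Proof.
move=> C0 fl x; have F : Filter (nbhs x) by exact: nbhs_filter.
apply/(@cvgrPdist_le R _ _ (nbhs x) F) => e e0 /=.
have C1 : 0 < C + 1 by rewrite ltr_wpDl.
apply/nbhs_ballP; exists (e / (C + 1)) => /=; first exact: divr_gt0.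
move=> y [_ bxy]; apply: le_trans (fl _ _ (e / (C + 1)) _ _) _.
- by rewrite ltW // divr_gt0.
- by move=> i; rewrite ltW //; have := bxy ord0 i.
- by rewrite mulrCA ler_piMr ?(ltW e0) // ler_pdivrMr // mul1r lerDl.
Qed.

Definition affine (R : realType) (d : nat) (v : 'rV[R]_d.+1) (x : 'rV[R]_d) : R :=
  v ord0 ord0 + \sum_(i < d) v ord0 (lift ord0 i) * x ord0 i.

Definition low (R : realType) (d : nat) (A : set 'rV[R]_d) (v : 'rV[R]_d.+1) : R :=
  inf [set affine v x | x in A].

Lemma affineN (R : realType) d (v : 'rV[R]_d.+1) x : affine (- v) x = - affine v x.
Proof.
rewrite /affine opprD -sumrN mxE; congr (_ + _).
by apply: eq_bigr => i _; rewrite mxE mulNr.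
Qed.

Lemma affine_convex (R : realType) d (v : 'rV[R]_d.+1) x y (l : R) :
  affine v (l *: x + (1 - l) *: y) = l * affine v x + (1 - l) * affine v y.
Proof.
rewrite /affine !mulrDr !mulr_sumr addrACA -mulrDl addrC [l + _]addrC subrK mul1r addrC.
congr (_ + _); rewrite -big_split /=; apply: eq_bigr => i _.
by rewrite !mxE; ring.
Qed.

Lemma affine_continuous (R : realType) d (v : 'rV[R]_d.+1) : continuous (@affine R d v).
Proof.
apply: (@coord_lip_continuous _ _ _ (\sum_(i < d) `|v ord0 (lift ord0 i)|)).
  by apply: sumr_ge0.
move=> x y e e0 xy; rewrite /affine opprD addrACA subrr add0r -sumrB mulr_suml.
apply: le_trans (ler_norm_sum _ _ _) _; apply: ler_sum => i _.
by rewrite -mulrBr normrM ler_wpM2l.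
Qed.

Lemma compact_coord_bounded (R : realType) d (A : set 'rV[R]_d) :
  A !=set0 -> compact A -> exists2 B, 0 <= B & forall x : 'rV[R]_d, A x -> \sum_i `|x ord0 i| <= B.
Proof.
move=> A0 cA; pose f (x : 'rV[R]_d) := \sum_i `|x ord0 i|.
have fc : continuous f.
  apply: (@coord_lip_continuous _ _ _ d%:R) => // x y e e0 xy.
  rewrite /f -sumrB; apply: le_trans (ler_norm_sum _ _ _) _.
  apply: le_trans (_ : \sum_(i < d) e <= _); last by rewrite sumr_const card_ord mulr_natl.
  by apply: ler_sum => i _; apply: le_trans (ler_dist_dist _ _) (xy i).
have [c cA' cmax] := EVT_max_rV A0 cA (continuous_subspaceT fc).
exists (f c); first by apply: sumr_ge0.
by move=> x Ax; apply: cmax; rewrite inE.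
Qed.

Lemma low_le (R : realType) d (A : set 'rV[R]_d) v x :
  compact A -> A x -> low A v <= affine v x.
Proof.
move=> cA Ax; have A0 : A !=set0 by exists x.
have [c _ cmin] := EVT_min_rV A0 cA (continuous_subspaceT (@affine_continuous R d v)).
apply: ge_inf; last by exists x.
by exists (affine v c) => _ [y Ay <-]; apply: cmin; rewrite inE.
Qed.

Lemma low_attained (R : realType) d (A : set 'rV[R]_d) v :
  A !=set0 -> compact A -> exists2 x, A x & low A v = affine v x.
Proof.
move=> A0 cA.
have [c cA' cmin] := EVT_min_rV A0 cA (continuous_subspaceT (@affine_continuous R d v)).
rewrite inE in cA'; exists c => //; apply/le_anti; rewrite low_le //=.
apply: lb_le_inf; first by case: A0 => y Ay; exists (affine v y); exists y.
by move=> _ [y Ay <-]; apply: cmin; rewrite inE.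
Qed.

Lemma low_missed (R : realType) d (A : set 'rV[R]_d) v :
  A !=set0 -> compact A -> Defs.convex_set A ->
  A `&` [set x | affine v x = 0] = set0 -> 0 < low A v \/ 0 < low A (- v).
Proof.
move=> A0 cA convA miss.
have nz x : A x -> affine v x != 0.
  move=> Ax; apply/eqP => vx; have : (A `&` [set x | affine v x = 0]) x by [].
  by rewrite miss.
have [x Ax lx] := low_attained v A0 cA; have [y Ay ly] := low_attained (- v) A0 cA.
have [x0|x0] := ltP 0 (affine v x); first by left; rewrite lx.
right; rewrite ly affineN oppr_gt0 lt_neqAle nz //= leNgt; apply/negP => y0.
have xneg : affine v x < 0 by rewrite lt_neqAle nz.
pose D := affine v y - affine v x.
have D0 : 0 < D by rewrite subr_gt0 (lt_trans xneg).
(* The point of the segment where the affine function, negative at [x] and positive at [y],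
   vanishes. *)
pose l := affine v y / D.
have l0 : 0 <= l by rewrite divr_ge0 // ltW.
have l1 : l <= 1 by rewrite ler_pdivrMr // mul1r /D lerDl oppr_ge0 ltW.
have := nz _ (convA x y Ax Ay l l0 l1).
rewrite affine_convex /l => /eqP; apply.
have Dn : D != 0 by rewrite gt_eqF.
by move: Dn; rewrite /D => Dn; field.
Qed.

(** Evaluating at a minimiser for [w] bounds [low A v - low A w] by a difference of affine functions
    at a point of [A], where coordinates are bounded. *)
Lemma low_lip (R : realType) d (A : set 'rV[R]_d) :
  A !=set0 -> compact A -> exists2 C, 0 <= C & forall (v w : 'rV[R]_d.+1) e, 0 <= e ->
    (forall i, `|v ord0 i - w ord0 i| <= e) -> `|low A v - low A w| <= C * e.
Proof.
move=> A0 cA; have [B B0 hB] := compact_coord_bounded A0 cA.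
exists (1 + B); first exact: addr_ge0.
have half (v w : 'rV[R]_d.+1) e : 0 <= e -> (forall i, `|v ord0 i - w ord0 i| <= e) ->
    low A v - low A w <= (1 + B) * e.
  move=> e0 vw; have [x Ax ->] := low_attained w A0 cA.
  apply: le_trans (_ : affine v x - affine w x <= _); first by rewrite lerD2r low_le.
  rewrite /affine opprD addrACA -sumrB mulrDl mul1r; apply: lerD.
    by apply: le_trans (ler_norm _) (vw _).
  apply: le_trans (_ : (\sum_i `|x ord0 i|) * e <= _); last by rewrite ler_wpM2r // hB.
  rewrite mulr_suml; apply: ler_sum => i _; rewrite -mulrBl.
  apply: le_trans (ler_norm _) _; rewrite normrM mulrC ler_wpM2l //.
move=> v w e e0 vw; rewrite ler_norml half // andbT lerNl opprB half // => i.
by rewrite distrC.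
Qed.

(* The positive part of min_A of the affine function in row a of h, or of its
   opposite: positive iff A lies strictly on side s of that hyperplane. *)
Definition side_weight (R : realType) (k d : nat) (h : 'M[R]_(k, d.+1)) (A : set 'rV[R]_d)
    (a : 'I_k) (s : bool) : R :=
  Num.max 0 (low A (if s then row a h else - row a h)).

Lemma side_weight_ge0 (R : realType) k d (h : 'M[R]_(k, d.+1)) A a s :
  0 <= side_weight h A a s.
Proof. by rewrite /side_weight le_max lexx. Qed.

Lemma side_weight_gt0 (R : realType) k d (h : 'M[R]_(k, d.+1)) A a s x :
  compact A -> A x -> 0 < side_weight h A a s ->
  if s then 0 < affine (row a h) x else affine (row a h) x < 0.
Proof.
move=> cA Ax; rewrite /side_weight lt_max ltxx /= => l0.
have := lt_le_trans l0 (low_le _ cA Ax); case: s {l0} => //.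
by rewrite affineN oppr_gt0.
Qed.

Lemma side_weight_disjoint (R : realType) k d (h : 'M[R]_(k, d.+1)) A B a s :
  compact A -> compact B -> 0 < side_weight h A a s -> 0 < side_weight h B a (~~ s) ->
  A `&` B = set0.
Proof.
move=> cA cB As Bs; apply/seteqP; split=> // x [Ax Bx].
have := side_weight_gt0 cA Ax As; have := side_weight_gt0 cB Bx Bs.
by case: s {As Bs} => /= h1 h2; have := lt_trans h1 h2; rewrite ltxx.
Qed.

Lemma side_weight_missed (R : realType) k d (h : 'M[R]_(k, d.+1)) A a :
  A !=set0 -> compact A -> Defs.convex_set A ->
  A `&` [set x | affine (row a h) x = 0] = set0 -> exists s, 0 < side_weight h A a s.
Proof.
move=> A0 cA convA /(low_missed A0 cA convA)[l0|l0]; [exists true|exists false];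
  by rewrite /side_weight lt_max l0 orbT.
Qed.

Lemma side_weight_flip (R : realType) k d (h : 'M[R]_(k, d.+1)) A b a s :
  side_weight (flip_row b h) A a s = side_weight h A a (if a == b then ~~ s else s).
Proof.
rewrite /side_weight; congr (Num.max 0 (low A _)).
have rE : row a (flip_row b h) = if a == b then - row a h else row a h.
  by apply/rowP => i; rewrite !mxE; case: ifP; rewrite !mxE.
by rewrite rE; case: (a == b); case: s; rewrite ?opprK.
Qed.

Lemma side_weight_lip (R : realType) k d (A : set 'rV[R]_d) a s :
  A !=set0 -> compact A -> cube_lip (fun h : 'M[R]_(k, d.+1) => side_weight h A a s).
Proof.
move=> A0 cA; have [C C0 lC] := low_lip A0 cA.
exists C => // h h' e _ _ e0 he; rewrite /side_weight.
have l : `|low A (if s then row a h else - row a h) -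
    low A (if s then row a h' else - row a h')| <= C * e.
  apply: lC => // i; case: (s); rewrite !mxE //.
  by rewrite -opprD normrN.
move: l; move: (low A _) (low A _) => u v; rewrite !ler_norml => /andP[l1 l2].
have Ce : 0 <= C * e by rewrite mulr_ge0.
by case: (ltP 0 u) => u0; case: (ltP 0 v) => v0; apply/andP; split; lra.
Qed.

(** * The system of equivariant constraints *)

Lemma weight_fourier_flip (R : realType) (I : finType) k l (p p' : I -> 'I_k -> bool -> R)
    (b : 'I_k) (S : {set 'I_k}) :
  (forall A a s, p' A a s = p A a (if a == b then ~~ s else s)) ->
  weight_fourier l p' S = if b \in S then - weight_fourier l p S else weight_fourier l p S.
Proof.
move=> pE; rewrite /weight_fourier (reindex_inj (inv_inj (bflipK b))) /=.
have wE T x : cube_weight p' T (bflip b x) = cube_weight p T x.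
  apply: eq_bigr => A _; apply: eq_bigr => a _; rewrite pE /bflip fupdE.
  by case: eqP => // ->; rewrite negbK.
transitivity (\sum_x cube_char R S (bflip b x) *
    \sum_(T : {set 'I_k} | #|T| == l) cube_weight p T x).
  by apply: eq_bigr => x _; congr (_ * _); apply: eq_bigr => T _.
case: ifP => bS; last by apply: eq_bigr => x _; rewrite cube_char_flip bS.
by rewrite -sumrN; apply: eq_bigr => x _; rewrite cube_char_flip bS mulNr.
Qed.

Lemma weight_fourier_lip (R : realType) (I : finType) k d l (f : I -> set 'rV[R]_d)
    (S : {set 'I_k}) :
  (forall A, f A !=set0) -> (forall A, compact (f A)) ->
  cube_lip (fun h : 'M[R]_(k, d.+1) => weight_fourier l (fun A => side_weight h (f A)) S).
Proof.
move=> f0 fc; apply: cube_lip_sum => x _; apply: cube_lipM; first exact: cube_lip_cst.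
apply: cube_lip_sum => T _; apply: cube_lip_sum => A _; apply: cube_lip_prod => a _.
exact: side_weight_lip.
Qed.

(** In order: a Fourier coefficient of a family, a vacuous constraint, an incidence with the fixed
    point. *)
Definition constraint (m k : nat) : eqType := (('I_m * {set 'I_k}) + {set 'I_k} + 'I_k)%type.

Definition constraint_char (m k : nat) (j : constraint m k) : {set 'I_k} :=
  match j with inl (inl p) => p.2 | inl (inr T) => T | inr a => [set a]%SET end.

(* Besides the Fourier coefficients of the families, t - 1 vacuous constraints per
   pair of rows and a copies of "hyperplane a passes through p": they bring the
   total degree to k * d. *)
Definition constraints (m k l t : nat) : seq (constraint m k) :=
  [seq inl (inl (i, T)) | i <- enum 'I_m, T <- enum [set T : {set 'I_k} | (0 < #|T| <= l)%N]%SET] ++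
  [seq inl (inr T) | _ <- iota 0 t.-1, T <- enum [set T : {set 'I_k} | #|T| == 2]%SET] ++
  [seq inr a | a : 'I_k <- enum 'I_k, _ : nat <- iota 0 a].

Definition constraint_fun (R : realType) (m k d l : nat) (N : 'I_m -> nat)
    (f : forall i, 'I_(N i) -> set 'rV[R]_d) (p : 'rV[R]_d) (j : constraint m k)
    (h : 'M[R]_(k, d.+1)) : R :=
  match j with
  | inl (inl ip) => weight_fourier l (fun A => side_weight h (f ip.1 A)) ip.2
  | inl (inr _) => 0
  | inr a => affine (row a h) p
  end.

Lemma constraint_zero (R : realType) (m k d l t : nat) (N : 'I_m -> nat)
    (f : forall i, 'I_(N i) -> set 'rV[R]_d) (p : 'rV[R]_d) :
  (forall i A, f i A !=set0) -> (forall i A, compact (f i A)) ->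
  size (constraints m k l t) = (k * d)%N ->
  mcoeff (mmon (fun=> d))
    (linear_forms 'F_2 (map (@constraint_char m k) (constraints m k l t))) != 0 ->
  exists h : 'M[R]_(k, d.+1),
    [/\ forall a, exists i, `|h a i| = 1,
        forall i (S : {set 'I_k}), (0 < #|S| <= l)%N ->
          weight_fourier l (fun A => side_weight h (f i A)) S = 0
      & forall a : 'I_k, (0 < a)%N -> affine (row a h) p = 0].
Proof.
move=> f0 fc sl nz.
have [j jl h b|j jl|h [hb hz]] := @multi_borsuk_ulam R k d (constraint m k) _ _
    (constraint_fun l f p) sl nz.
- case: j {jl} => [[[i S]|S]|a] /=.
  + by apply: weight_fourier_flip => A a s; apply: side_weight_flip.
  + by rewrite oppr0 if_same.
  + rewrite inE eq_sym; case: eqP => [->|ab]; last first.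
      by congr affine; apply/rowP => i; rewrite !mxE; case: eqP.
    rewrite -affineN; congr affine; apply/rowP => i; rewrite !mxE eqxx //.
- case: j {jl} => [[[i S]|S]|a] /=.
  + exact: weight_fourier_lip.
  + exact: cube_lip_cst.
  + change (cube_lip (fun h : 'M[R]_(k, d.+1) => affine (row a h) p)).
    rewrite (_ : (fun h : 'M[R]_(k, d.+1) => affine (row a h) p) =
        fun h => h a ord0 + \sum_(i < d) h a (lift ord0 i) * p ord0 i).
      apply: cube_lipD; first exact: cube_lip_coord.
      by apply: cube_lip_sum => i _; apply: cube_lipM; [exact: cube_lip_coord|exact: cube_lip_cst].
    apply/funext => h; rewrite /affine mxE; congr (_ + _).
    by apply: eq_bigr => i _; rewrite mxE.
exists h; split=> // [i S Sl|a a0].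
  apply: (hz (inl (inl (i, S)))); rewrite mem_cat; apply/orP; left.
  by apply/allpairsP; exists (i, S); rewrite !mem_enum !inE.
apply: (hz (inr a)); rewrite !mem_cat; apply/orP; right; apply/orP; right.
by apply/allpairsPdep; exists a, 0%N; rewrite mem_enum mem_iota.
Qed.

Lemma constraints_forms (F : comNzRingType) (m k l t : nat) :
  linear_forms F (map (@constraint_char m k) (constraints m k l t)) =
  (\prod_(S : {set 'I_k} | (0 < #|S| <= l)%N) \sum_(a in S) mpolyX F (mnm1 a)) ^+ m *
  forms F k 2 ^+ t.-1 * mpolyX F (mmon (fun a : 'I_k => a)).
Proof.
rewrite /linear_forms /constraints !map_cat !big_cat /= -mulrA; congr (_ * (_ * _)).
- rewrite map_allpairs big_allpairs_dep /= big_enum /= prodr_const card_ord; congr (_ ^+ _).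
  by rewrite big_enum; apply: eq_bigl => S; rewrite inE.
- rewrite map_allpairs big_allpairs_dep /= big_const_seq count_predT size_iota.
  rewrite -Monoid.iteropE /= big_enum; congr (_ ^+ _).
  by apply: eq_bigl => S; rewrite inE.
rewrite map_allpairs big_allpairs_dep /= big_enum mpolyXE_id /=; apply: eq_bigr => a _.
by rewrite big_set1 big_const_seq count_predT size_iota -Monoid.iteropE mmonE.
Qed.

Lemma size_constraints (m k l t : nat) :
  size (constraints m k l t) =
  (m * #|[set S : {set 'I_k} | (0 < #|S| <= l)%N]%SET| + t.-1 * 'C(k, 2) + 'C(k, 2))%N.
Proof.
rewrite !size_cat !size_allpairs size_allpairs_dep -addnA; congr (_ + (_ + _))%N.
- by rewrite -!cardE card_ord.
- by rewrite size_iota -cardE card_draws card_ord.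
rewrite sumnE big_map big_enum /=; under eq_bigr do rewrite size_iota.
by rewrite -(big_mkord xpredT (fun i => i)) -bin2_sum.
Qed.

(** * Degree and parity of the constraint systems *)

Lemma idem_F2 (x : 'F_2) : x * x = x.
Proof. by case: x => [[|[|?]] ?] //; apply/val_inj. Qed.

Lemma forms1E (F : comNzRingType) k : forms F k 1 = mpolyX F (mmon (fun=> 1)%N).
Proof.
have inj1 : {in [set: 'I_k]%SET &, injective (fun a : 'I_k => [set a]%SET)}.
  by move=> a b _ _ /finset.set1_inj.
rewrite mpolyXE_id [RHS](eq_bigl (fun a => a \in [set: 'I_k]%SET)); last first.
  by move=> a; rewrite inE.
rewrite (eq_bigr (fun a => \sum_(b in [set a]%SET) mpolyX F (mnm1 b))); last first.
  by move=> a _; rewrite big_set1 mmonE expr1.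
rewrite -(big_imset (fun S : {set 'I_k} => \sum_(b in S) mpolyX F (mnm1 b)) inj1) /=.
apply: eq_bigl => S; apply/cards1P/imsetP => [[a ->]|[a _ ->]]; by exists a; rewrite ?inE.
Qed.

Lemma card_small_sets k l :
  #|[set S : {set 'I_k} | (0 < #|S| <= l.+1)%N]%SET| =
  (#|[set S : {set 'I_k} | (0 < #|S| <= l)%N]%SET| + 'C(k, l.+1))%N.
Proof.
rewrite -[k in 'C(k, _)]card_ord -card_draws -!sum1_card.
rewrite !(big_mkcond (fun S : {set 'I_k} => S \in _)) -big_split /=.
apply: eq_bigr => S _; rewrite !inE; move: #|S| => c.
by case: ifP => h1; case: ifP => h2; case: eqP => h3 //=; lia.
Qed.

Lemma prod_small_sets (T : comNzRingType) k l (G : {set 'I_k} -> T) :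
  \prod_(S : {set 'I_k} | (0 < #|S| <= l.+1)%N) G S =
  \prod_(S : {set 'I_k} | (0 < #|S| <= l)%N) G S * \prod_(S : {set 'I_k} | #|S| == l.+1) G S.
Proof.
rewrite big_mkcond [X in _ = X * _]big_mkcond [X in _ = _ * X]big_mkcond -big_split /=.
apply: eq_bigr => S _; move: (G S) #|S| => x c.
by case: ifP => h1; case: ifP => h2; case: eqP => h3; rewrite ?mul1r ?mulr1 //; lia.
Qed.

Lemma prod_small_sets0 (T : comNzRingType) k (G : {set 'I_k} -> T) :
  \prod_(S : {set 'I_k} | (0 < #|S| <= 0)%N) G S = 1.
Proof. by apply: big_pred0 => S; case: #|S|. Qed.

Lemma card_small_sets0 k : #|[set S : {set 'I_k} | (0 < #|S| <= 0)%N]%SET| = 0%N.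
Proof. by apply: eq_card0 => S; rewrite !inE; case: #|S|. Qed.

Lemma forms1_powM (F : comNzRingType) k m (e : 'I_k -> nat) :
  forms F k 1 ^+ m * mpolyX F (mmon e) = mpolyX F (mmon (fun a => m + e a)%N).
Proof.
rewrite forms1E mpolyXn -mpolyXD; congr mpolyX; apply/mnmP => a.
by rewrite mnmDE mulmnE !mmonE mul1n.
Qed.

Lemma two_constraints (q t k d : nat) :
  (0 < k)%N -> (0 < t)%N -> (t <= 2 ^ q)%N -> d = (2 ^ q * (k + 1) - t)%N ->
  size (constraints (2 ^ q.+1 - t) k 2 t) = (k * d)%N /\
  mcoeff (mmon (fun=> d)) (linear_forms 'F_2
    (map (@constraint_char _ k) (constraints (2 ^ q.+1 - t) k 2 t))) != 0.
Proof.
move=> k0 t0 tq ->; split.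
  rewrite size_constraints !card_small_sets card_small_sets0 add0n bin1.
  have := bin2_sum k; have C2 : (2 * 'C(k, 2) = k * (k - 1))%N.
    by rewrite mul2n bin2 -[RHS]odd_double_half oddM; case: k {k0} => //= k; rewrite subn1 /= andNb add0n.
  move: tq; rewrite expnS; move: (2 ^ q)%N ('C(k, 2)) C2 => M C C2 tM _; nia.
rewrite constraints_forms !prod_small_sets prod_small_sets0 mul1r -/(forms _ _ 1) -/(forms _ _ 2).
set m := (2 ^ q.+1 - t)%N.
have q0 := expn_gt0 2 q; have q2 : (2 ^ q.+1 = 2 * 2 ^ q)%N by rewrite expnS.
set V := forms _ _ 2.
rewrite (_ : _ * _ = (forms 'F_2 k 1 ^+ m * mpolyX 'F_2 (mmon (fun a : 'I_k => a))) *
    V ^+ (2 ^ q.+1 - 1)); last first.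
  rewrite (_ : (2 ^ q.+1 - 1 = m + t.-1)%N) ?exprD ?exprMn; first by ring.
  by rewrite /m; lia.
rewrite forms1_powM -/(cf _ _) cfXM.
have ak (a : 'I_k) : (a <= k.-1)%N by have := ltn_ord a; lia.
have dE : (2 ^ q * (k + 1) - t = m + 2 ^ q * k.-1)%N.
  by rewrite /m q2; case: k k0 {V ak} => // k _ /=; nia.
rewrite ifT; last first.
  apply/forallP => a; rewrite dE leq_add2l (leq_trans (ak a)) //.
  by rewrite -[X in (X <= _)%N]mul1n leq_mul2r orbC; lia.
(* Removing the monomials leaves exponents [d - m - a]; as [d = m + 2 ^ q * k.-1], they form a
   shifted reversal, the shape required by [forms2_pow]. *)
rewrite (eq_cf _ (f := fun a => (2 ^ q - 1) * k.-1 + perm (@rev_ord_inj k) a)%N); last first.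
  move=> a; rewrite dE subnDl permE /= mulnBl mul1n; have := ak a.
  have : (k.-1 <= 2 ^ q * k.-1)%N by rewrite -[X in (X <= _)%N]mul1n leq_mul2r orbC; lia.
  by move: (2 ^ q * _)%N k0 => M; lia.
by rewrite forms2_pow //; apply: idem_F2.
Qed.

Lemma three_constraints (q t d : nat) :
  (0 < t)%N -> (t <= 2 ^ q)%N -> d = (7 * 2 ^ q - 2 * t)%N ->
  size (constraints (2 ^ q.+1 - t) 4 3 t) = (4 * d)%N /\
  mcoeff (mmon (fun=> d)) (linear_forms 'F_2
    (map (@constraint_char _ 4) (constraints (2 ^ q.+1 - t) 4 3 t))) != 0.
Proof.
move=> t0 tq ->; split.
  rewrite size_constraints !card_small_sets card_small_sets0 add0n bin1.
  by rewrite (_ : 'C(4, 2) = 6)%N // (_ : 'C(4, 3) = 4)%N // expnS; lia.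
rewrite constraints_forms !prod_small_sets prod_small_sets0 mul1r.
rewrite -/(forms _ _ 1) -/(forms _ _ 2) -/(forms _ _ 3).
set m := (2 ^ q.+1 - t)%N.
have q0 := expn_gt0 2 q; have q2 : (2 ^ q.+1 = 2 * 2 ^ q)%N by rewrite expnS.
set V := forms _ _ 2; set Q := forms _ _ 3.
rewrite (_ : _ * _ = (forms 'F_2 4 1 ^+ m * mpolyX 'F_2 (mmon (fun a : 'I_4 => a))) *
    (V ^+ (2 ^ q.+1 - 1) * Q ^+ m)); last first.
  rewrite (_ : (2 ^ q.+1 - 1 = m + t.-1)%N) ?exprD ?exprMn; first by ring.
  by rewrite /m; lia.
rewrite forms1_powM -/(cf _ _) cfXM.
have ak (a : 'I_4) : (a <= 3)%N by have := ltn_ord a; lia.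
rewrite ifT; last first.
  by apply/forallP => a; have := ak a; rewrite /m q2; lia.
(* Here [d - m - a = 5 * 2 ^ q - t - a], which is the shape of [forms23_pow] with [n = m];
   positivity of [t] gives [m < 2 ^ q.+1]. *)
rewrite (eq_cf _ (f := fun a => (2 ^ q - 1) * 3 + m + perm (@rev_ord_inj 4) a)%N); last first.
  by move=> a; rewrite permE /= /m q2; have := ak a; lia.
rewrite forms23_pow //; first exact: idem_F2.
by rewrite /m; lia.
Qed.

(** * Hyperplanes from a common zero *)

Lemma zero_set_hyperplane (R : realType) d (v : 'rV[R]_d.+1) :
  (exists i, v ord0 (lift ord0 i) != 0) -> is_hyperplane [set x | affine v x = 0].
Proof.
move=> [i vi]; exists (\row_j v ord0 (lift ord0 j)), (- v ord0 ord0); split.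
  by apply: contraNneq vi => /rowP/(_ i); rewrite !mxE => ->.
have dE x : dotv (\row_j v ord0 (lift ord0 j)) x = affine v x - v ord0 ord0.
  rewrite /affine addrC addKr; apply: eq_bigr => j _; by rewrite mxE.
apply/seteqP; split=> x /=; rewrite dE; first by move=> ->; rewrite sub0r.
by move=> /(congr1 (+%R^~ (v ord0 ord0))); rewrite subrK addNr.
Qed.

(** A normalised row without linear part has constant term 1 or -1: the hyperplane at infinity. *)
Lemma zero_set_empty (R : realType) d (v : 'rV[R]_d.+1) :
  (exists i, `|v ord0 i| = 1) -> is_hyperplane [set x | affine v x = 0] \/
    [set x | affine v x = 0] = set0.
Proof.
move=> [i vi]; have [[j vj]|h] := pselect (exists j, v ord0 (lift ord0 j) != 0).
  by left; apply: zero_set_hyperplane; exists j.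
right; have z j : v ord0 (lift ord0 j) = 0.
  by apply: contrapT => /eqP vj; apply: h; exists j.
apply/seteqP; split=> // x; rewrite /= /affine big1 ?addr0; last by move=> j _; rewrite z mul0r.
case: (unliftP ord0 i) vi => [j ->|->]; first by rewrite z normr0 => /eqP; rewrite eq_sym oner_eq0.
by move=> vi v0; move: vi; rewrite v0 normr0 => /eqP; rewrite eq_sym oner_eq0.
Qed.

Lemma finite_family_index (T : Type) (F : set (set T)) : finite_set F ->
  exists N (f : 'I_N -> set T), forall A, F A <-> exists i, f i = A.
Proof.
move=> /finite_seqP[s ->]; exists (size s), (fun i => nth set0 s i) => A /=; split.
  by move=> As; exists (Ordinal (etrans (index_mem A s) As)); rewrite /= nth_index.
by move=> [i <-]; apply: mem_nth.
Qed.

(** The combinatorial statement about weights enters as a hypothesis, so that one argument serves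
    both parts of the theorem. *)
Lemma pointed_piercing (R : realType) (m k d l t n : nat)
    (F : 'I_m -> set (set 'rV[R]_d)) (p : 'rV[R]_d) :
  size (constraints m k l t) = (k * d)%N ->
  mcoeff (mmon (fun=> d))
    (linear_forms 'F_2 (map (@constraint_char m k) (constraints m k l t))) != 0 ->
  (forall (I : finType) (w : I -> 'I_k -> bool -> R),
    (forall A a s, 0 <= w A a s) ->
    ~ (exists f : 'I_n -> I, forall i j, i != j -> sign_separated w (f i) (f j)) ->
    (forall S : {set 'I_k}, (0 < #|S| <= l)%N -> weight_fourier l w S = 0) ->
    forall (T : {set 'I_k}) x, #|T| = l -> cube_weight w T x = 0) ->
  (forall i, good_family (F i)) -> (forall i, no_n_pairwise_disjoint n (F i)) ->
  exists H : 'I_k -> set 'rV[R]_d,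
    [/\ forall a : 'I_k, (0 < a)%N -> is_hyperplane (H a) /\ H a p,
        forall a, is_hyperplane (H a) \/ H a = set0
      & forall i, any_pierce l H (F i)].
Proof.
move=> sz nz weights good nodis.
have idx i : {N : nat & {f : 'I_N -> set 'rV[R]_d | forall A, F i A <-> exists j, f j = A}}.
  have [N hN] := cid (finite_family_index (proj1 (good i))).
  by have [f fE] := cid hN; exists N, f.
pose N i := projT1 (idx i); pose f i : 'I_(N i) -> set 'rV[R]_d := sval (projT2 (idx i)).
have fE i A : F i A <-> exists j, f i j = A := svalP (projT2 (idx i)) A.
have fF i j : F i (f i j) by apply/fE; exists j.
have f0 i j : f i j !=set0 by have [? ? ?] := proj2 (good i) _ (fF i j).
have fc i j : compact (f i j) by have [? ? ?] := proj2 (good i) _ (fF i j).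
have fv i j : Defs.convex_set (f i j) by have [? ? ?] := proj2 (good i) _ (fF i j).
have [h [hb hf hp]] := constraint_zero p f0 fc sz nz.
have hb' a : exists i, `|(row a h) ord0 i| = 1.
  by have [i hi] := hb a; exists i; rewrite mxE.
exists (fun a => [set x | affine (row a h) x = 0]); split.
- move=> a a0; split; last exact: hp.
  have [//|e] := zero_set_empty (hb' a).
  by have : [set x | affine (row a h) x = 0] p; [exact: hp|rewrite e].
- by move=> a; apply: zero_set_empty.
move=> i S Sl A /fE[j <-]; apply: contrapT => miss.
have no a : a \in S -> f i j `&` [set x | affine (row a h) x = 0] = set0.
  move=> aS; apply: contrapT => /eqP/set0P ne; apply: miss; exists a => //.
(* A member missed by all hyperplanes of [S] lies strictly on one side of each, so the face given by
   these sides has positive weight. *)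
have /choice[s hs] : forall a, exists s, a \in S -> 0 < side_weight h (f i j) a s.
  move=> a; have [aS|aS] := boolP (a \in S); last by exists true.
  have [s hs] := side_weight_missed (f0 i j) (fc i j) (fv i j) (no a aS).
  by exists s.
have w0 (B : 'I_(N i)) a u : 0 <= side_weight h (f i B) a u by apply: side_weight_ge0.
have nosep : ~ exists g : 'I_n -> 'I_(N i), forall u v, u != v ->
    sign_separated (fun A => side_weight h (f i A)) (g u) (g v).
  move=> [g hg]; apply: (nodis i); exists (fun u => f i (g u)); split=> [u|u v uv].
    exact: fF.
  have [a [s' [h1 h2]]] := hg u v uv.
  exact: (side_weight_disjoint (fc i _) (fc i _) h1 h2).
have := weights _ (fun A => side_weight h (f i A)) w0 nosep (hf i) S (finfun s) Sl.
move=> /(cube_weight_eq0 j w0)[a aS]; rewrite ffunE => e.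
by have := hs a aS; rewrite e ltxx.
Qed.

(** * Points in general position and families of distinct hyperplanes *)

Lemma poly_nonroot (R : realType) (P : {poly R}) : P != 0 -> exists s, P.[s] != 0.
Proof.
move=> P0; apply: contrapT => h.
have all_root : all (root P) [seq i%:R | i <- iota 0 (size P)].
  apply/allP => _ /mapP[i _ ->]; apply/eqP; apply: contrapT => /eqP r.
  by apply: h; exists i%:R.
have un : uniq [seq i%:R : R | i <- iota 0 (size P)].
  by rewrite map_inj_uniq ?iota_uniq // => i j /eqP; rewrite eqr_nat => /eqP.
by have := max_poly_roots P0 all_root un; rewrite size_map size_iota ltnn.
Qed.

(* A point of the moment curve lies on finitely many hyperplanes only at the
   roots of finitely many polynomials. *)
Lemma avoid_hyperplanes (R : realType) d n (G : nat -> set 'rV[R]_d) :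
  (forall i, (i < n)%N -> is_hyperplane (G i)) ->
  exists p, forall i, (i < n)%N -> ~ G i p.
Proof.
move=> hG.
have /choice[Q hQ] : forall i, exists Q : {poly R}, (i < n)%N ->
    Q != 0 /\ forall s, G i (\row_j s ^+ j.+1) -> Q.[s] = 0.
  move=> i; have [lt|ge] := ltnP i n; last by exists 0.
  have [a [b [a0 GE]]] := hG i lt.
  have [j aj] : exists j, a ord0 j != 0.
    apply: contrapT => h; case/eqP: a0; apply/rowP => j; rewrite mxE.
    by apply: contrapT => /eqP aj; apply: h; exists j.
  pose Q := \sum_(j < d) a ord0 j *: 'X^(j.+1) - b%:P.
  exists Q => _; split.
    apply: contraNneq aj => Q0; have : Q`_(j.+1) = 0 by rewrite Q0 coef0.
    rewrite /Q coefB coefC /= subr0 coef_sum (bigD1 j) //= coefZ coefXn eqxx mulr1.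
    rewrite big1 ?addr0 => [->//|k kj]; rewrite coefZ coefXn eqSS.
    by rewrite (_ : (j == k :> nat) = false) ?mulr0 //; apply/negbTE; rewrite eq_sym.
  move=> s; rewrite GE /= /dotv => h.
  rewrite /Q hornerD hornerN hornerC horner_sum; apply/eqP; rewrite subr_eq0 -h; apply/eqP.
  by apply: eq_bigr => k _; rewrite hornerZ hornerXn mxE.
have [s hs] : exists s, (\prod_(i < n) Q i).[s] != 0.
  by apply: poly_nonroot; apply/prodf_neq0 => i _; have [] := hQ i (ltn_ord i).
exists (\row_j s ^+ j.+1) => i lt Gp; have [_ hr] := hQ i lt.
case/eqP: hs; rewrite horner_prod (bigD1 (Ordinal lt)) //= hr ?mul0r //.
Qed.

(** Each new [p] is taken off all earlier hyperplanes, so the new pair differs from them. Within a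
    pair [X i = Y i] stays possible, and the caller has to treat it. *)
Lemma hyperplane_pairs (R : realType) d (P : set 'rV[R]_d -> set 'rV[R]_d -> Prop) :
  (forall p, exists X Y, [/\ is_hyperplane X, is_hyperplane Y, X p, Y p & P X Y]) ->
  forall n, exists X Y : nat -> set 'rV[R]_d,
    (forall i, (i < n)%N -> [/\ is_hyperplane (X i), is_hyperplane (Y i) & P (X i) (Y i)]) /\
    (forall i j, (i < n)%N -> (j < n)%N -> i <> j ->
      [/\ X i <> X j, X i <> Y j & Y i <> Y j]).
Proof.
move=> hP; elim=> [|n [X [Y [hXY dis]]]]; first by exists (fun=> setT), (fun=> setT).
pose G i := if (i < n)%N then X i else Y (i - n)%N.
have [|p hp] := @avoid_hyperplanes R d (n + n) G.
  move=> i lt; rewrite /G; case: ltnP => h; first by have [] := hXY i h.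
  by have [] := hXY (i - n)%N; first by lia.
have [X' [Y' [hX hY Xp Yp PXY]]] := hP p.
have Xn i : (i < n)%N -> ~ X i p.
  move=> lt; have GE : G i = X i by rewrite /G lt.
  by rewrite -GE; apply: hp; lia.
have Yn i : (i < n)%N -> ~ Y i p.
  move=> lt; have GE : G (n + i)%N = Y i by rewrite /G ltnNge leq_addr /= addKn.
  by rewrite -GE; apply: hp; lia.
exists (fun i => if i == n then X' else X i), (fun i => if i == n then Y' else Y i); split.
  by move=> i; rewrite ltnS leq_eqVlt; case: eqVneq => //= _; apply: hXY.
move=> i j; rewrite (ltnS i) (leq_eqVlt i) (ltnS j) (leq_eqVlt j); case: eqVneq => [->|_]; case: eqVneq => [->|_] //= h1 h2 ij.
- by split=> e; [apply: (Xn _ h2)|apply: (Yn _ h2)|apply: (Yn _ h2)]; rewrite -e.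
- by split=> e; [apply: (Xn _ h1)|apply: (Xn _ h1)|apply: (Yn _ h1)]; rewrite e.
- exact: dis.
Qed.

(** * Repairing coincidences *)

(** Only index 0 may fail to pass through [p]: an empty set must be that one, and of two coinciding
    hyperplanes at least one has positive index and contains [p]. *)
Lemma distinct_or_pierced (R : realType) d k (H : 'I_k -> set 'rV[R]_d) (p : 'rV[R]_d) :
  (forall a : 'I_k, (0 < a)%N -> is_hyperplane (H a) /\ H a p) ->
  (forall a, is_hyperplane (H a) \/ H a = set0) ->
  [\/ injective H /\ (forall a, is_hyperplane (H a)),
      exists2 a : 'I_k, ~~ (0 < a)%N & H a = set0
    | exists a b : 'I_k, [/\ a != b, (0 < b)%N & H a = H b]].
Proof.
move=> Hp H0; have [hyp|nhyp] := pselect (forall a, is_hyperplane (H a)); last first.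
  constructor 2; have [a na] : exists a, ~ is_hyperplane (H a).
    by apply: contrapT => h; apply: nhyp => a; apply: contrapT => na; apply: h; exists a.
  exists a; first by apply/negP => /Hp[].
  by case: (H0 a).
have [inj|ninj] := pselect (injective H); first by constructor 1.
constructor 3; have [a [b [ab e]]] : exists a b : 'I_k, a != b /\ H a = H b.
  apply: contrapT => h; apply: ninj => a b e; apply: contrapT => /eqP ab.
  by apply: h; exists a, b.
have [b0|b0] := posnP b; last by exists a, b.
exists b, a; split=> //; first by rewrite eq_sym.
by rewrite lt0n; apply: contraNneq ab => a0; apply/eqP/ord_inj; rewrite a0 b0.
Qed.

Lemma distinct_two_piercing (R : realType) (m k d : nat)
    (F : 'I_m -> set (set 'rV[R]_d)) :
  (2 <= k)%N ->
  (forall p, exists H : 'I_k -> set 'rV[R]_d,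
    [/\ forall a : 'I_k, (0 < a)%N -> is_hyperplane (H a) /\ H a p,
        forall a, is_hyperplane (H a) \/ H a = set0
      & forall i, any_pierce 2 H (F i)]) ->
  exists H : 'I_k -> set 'rV[R]_d,
    [/\ injective H, (forall j, is_hyperplane (H j)) & forall i, any_pierce 2 H (F i)].
Proof.
move=> k2 hH; apply: contrapT => none.
(* If no distinct system exists, each [p] lies on a single hyperplane meeting every member: the
   partner of an empty or repeated one. It serves as both entries of the pair. *)
pose P (X Y : set 'rV[R]_d) := forall i A, F i A -> A `&` X !=set0.
have hP p : exists X Y, [/\ is_hyperplane X, is_hyperplane Y, X p, Y p & P X Y].
  have [H [Hp H0 pierce]] := hH p.
  have pair a b i A : a != b -> F i A -> A `&` H a !=set0 \/ A `&` H b !=set0.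
    move=> ab FA; have ab2 : #|[set a; b]%SET| = 2 by rewrite cards2 ab.
    have [c] := pierce i _ ab2 A FA; rewrite !inE => /orP[/eqP ->|/eqP ->]; by [left|right].
  have [[inj hyp]|[a a0 e]|[a [b [ab b0 e]]]] := distinct_or_pierced Hp H0.
  - by case: none; exists H.
  - pose b : 'I_k := Ordinal k2; have [hb pb] := Hp b isT.
    exists (H b), (H b); split=> // i A FA.
    have ab : a != b by apply: contraNneq a0 => ->.
    by have [|//] := pair a b i A ab FA; rewrite e setI0 => -[].
  - have [hb pb] := Hp b b0; exists (H b), (H b); split=> // i A FA.
    by have [] := pair a b i A ab FA; rewrite ?e.
have [X [Y [hXY dis]]] := hyperplane_pairs hP k.
case: none; exists (fun a : 'I_k => X a); split=> [a b e|a|i S S2 A FA].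
- apply: contrapT => ab; have [] := dis a b (ltn_ord a) (ltn_ord b); last by [].
  by move=> /ord_inj.
- by have [] := hXY a (ltn_ord a).
have /card_gt0P[a aS] : (0 < #|S|)%N by rewrite S2.
exists a => //; have [_ _ PX] := hXY a (ltn_ord a); exact: PX FA.
Qed.

Lemma distinct_three_piercing (R : realType) (m d : nat)
    (F : 'I_m -> set (set 'rV[R]_d)) :
  (forall p, exists H : 'I_4 -> set 'rV[R]_d,
    [/\ forall a : 'I_4, (0 < a)%N -> is_hyperplane (H a) /\ H a p,
        forall a, is_hyperplane (H a) \/ H a = set0
      & forall i, any_pierce 3 H (F i)]) ->
  exists H : 'I_4 -> set 'rV[R]_d,
    [/\ injective H, (forall j, is_hyperplane (H j)) & forall i, any_pierce 3 H (F i)].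
Proof.
move=> hH; apply: contrapT => none.
(* With triples, losing one hyperplane to infinity or to a coincidence leaves two through [p] that
   together meet every member. *)
pose P (X Y : set 'rV[R]_d) := forall i A, F i A -> A `&` X !=set0 \/ A `&` Y !=set0.
have hP p : exists X Y, [/\ is_hyperplane X, is_hyperplane Y, X p, Y p & P X Y].
  have [H [Hp H0 pierce]] := hH p.
  have triple a b c i A : a != b -> a != c -> b != c -> F i A ->
      [\/ A `&` H a !=set0, A `&` H b !=set0 | A `&` H c !=set0].
    move=> ab ac bc FA; have abc : #|[set a; b; c]%SET| = 3.
      by rewrite -finset.setUA cardsU1 cards2 bc !inE negb_or ab ac.
    have [e] := pierce i _ abc A FA.
    by rewrite !inE => /orP[/orP[]|] /eqP ->; [constructor 1|constructor 2|constructor 3].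
  have [[inj hyp]|[a a0 e]|[a [b [ab b0 e]]]] := distinct_or_pierced Hp H0.
  - by case: none; exists H.
  - pose b : 'I_4 := @Ordinal 4 1 isT; pose c : 'I_4 := @Ordinal 4 2 isT.
    have [hb pb] := Hp b isT; have [hc pc] := Hp c isT.
    exists (H b), (H c); split=> // i A FA.
    have ab : a != b by apply: contraNneq a0 => ->.
    have ac : a != c by apply: contraNneq a0 => ->.
    by have [||] := triple a b c i A ab ac isT FA; [rewrite e setI0 => -[]|left|right].
  (* There are three positive indices and only [a] and [b] to avoid. *)
  - have [c [c0 ca cb]] : exists c : 'I_4, [/\ (0 < c)%N, c != a & c != b].
      apply: contrapT => h; have {}h (c : 'I_4) : (0 < c)%N -> c = a :> nat \/ c = b :> nat.
        move=> c0; have [->|ca] := eqVneq c a; first by left.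
        have [->|cb] := eqVneq c b; first by right.
        by case: h; exists c.
      have h1 := h (@Ordinal 4 1 isT) isT; have h2 := h (@Ordinal 4 2 isT) isT.
      have h3 := h (@Ordinal 4 3 isT) isT.
      by move: h1 h2 h3 => /= [h1|h1] [h2|h2] [h3|h3]; lia.
    have [hb pb] := Hp b b0; have [hc pc] := Hp c c0.
    exists (H b), (H c); split=> // i A FA.
    have [ac bc] : a != c /\ b != c by rewrite ![_ == c]eq_sym.
    have [||] := triple a b c i A ab ac bc FA; rewrite ?e; by [left|left|right].
have [X [Y [hXY dis]]] := hyperplane_pairs hP 4.
(* Two genuine pairs give four hyperplanes, any three of which contain a whole pair. Otherwise at
   most one index has [X i <> Y i], every other [X i] alone meets all members, and any three of the
   four [X i] include such a one. *)
have [[i [j [i4 j4 ij [Xi Xj]]]]|h] := pselect (exists i j : nat,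
    [/\ (i < 4)%N, (j < 4)%N, i <> j & X i <> Y i /\ X j <> Y j]).
  pose H (a : 'I_4) := nth set0 [:: X i; Y i; X j; Y j] a.
  have [hXi hYi Pi] := hXY i i4; have [hXj hYj Pj] := hXY j j4.
  have [d1 d2 d3] := dis i j i4 j4 ij.
  have [_ d4 _] := dis j i j4 i4 (nesym ij).
  case: none; exists H; split.
  - by move=> [[|[|[|[|//]]]] ha] [[|[|[|[|//]]]] hb] //= e; apply/ord_inj => //=;
      exfalso; move: e; rewrite /H /=; first [exact | move=> /esym; exact].
  - by move=> [[|[|[|[|//]]]] ha].
  move=> u S S3 A FA.
  pose a0 : 'I_4 := @Ordinal 4 0 isT; pose a1 : 'I_4 := @Ordinal 4 1 isT.
  pose a2 : 'I_4 := @Ordinal 4 2 isT; pose a3 : 'I_4 := @Ordinal 4 3 isT.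
  have SC : #|(~: S)%SET| = 1%N by have := cardsC S; rewrite S3 card_ord; lia.
  have one a b : a \notin S -> b \notin S -> a = b.
    move: SC => /eqP/cards1P[c cE] aS bS.
    have : a \in (~: S)%SET by rewrite inE.
    have : b \in (~: S)%SET by rewrite inE.
    by rewrite cE !inE => /eqP -> /eqP ->.
  have [a0S|a0S] := boolP (a0 \in S); have [a1S|a1S] := boolP (a1 \in S).
  - by case: (Pi u A FA) => ?; [exists a0|exists a1].
  - have a2S : a2 \in S by apply: contraT => /(one _ _ a1S).
    have a3S : a3 \in S by apply: contraT => /(one _ _ a1S).
    by case: (Pj u A FA) => ?; [exists a2|exists a3].
  - have a2S : a2 \in S by apply: contraT => /(one _ _ a0S).
    have a3S : a3 \in S by apply: contraT => /(one _ _ a0S).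
    by case: (Pj u A FA) => ?; [exists a2|exists a3].
  - by have := one _ _ a0S a1S.
case: none; exists (fun a : 'I_4 => X a); split=> [a b e|a|i S S3 A FA].
- apply: contrapT => ab; have [] := dis a b (ltn_ord a) (ltn_ord b); last by [].
  by move=> /ord_inj.
- by have [] := hXY a (ltn_ord a).
have /card_gt1P[a [b [aS bS ab]]] : (1 < #|S|)%N by rewrite S3.
have full (c : 'I_4) : X c = Y c -> A `&` X c !=set0.
  move=> e; have [_ _ PX] := hXY c (ltn_ord c).
  by case: (PX i A FA) => //; rewrite e.
have [ea|na] := pselect (X a = Y a); first by exists a => //; apply: full.
exists b => //; apply: full; apply: contrapT => nb; apply: h.
exists a, b; split=> // /ord_inj e; by rewrite e eqxx in ab.
Qed.

Unset Implicit Arguments.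

Theorem theorem1p7 (R : realType) (q t : nat) :
  (1 <= t)%N -> (t <= 2 ^ q)%N ->
  (* (a) *)
  (forall (k d : nat), (2 <= k)%N -> d = (2 ^ q * (k + 1) - t)%N ->
     forall F : 'I_(2 ^ q.+1 - t) -> set (set 'rV[R]_d),
       (forall i, good_family (F i)) ->
       (forall i, no_n_pairwise_disjoint 4 (F i)) ->
       exists H : 'I_k -> set 'rV[R]_d,
         [/\ injective H, (forall j, is_hyperplane (H j))
           & forall i, any_pierce 2 H (F i)]) /\
  (* (b) *)
  (forall d : nat, d = (7 * 2 ^ q - 2 * t)%N ->
     forall F : 'I_(2 ^ q.+1 - t) -> set (set 'rV[R]_d),
       (forall i, good_family (F i)) ->
       (forall i, no_n_pairwise_disjoint 8 (F i)) ->
       exists H : 'I_4 -> set 'rV[R]_d,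
         [/\ injective H, (forall j, is_hyperplane (H j))
           & forall i, any_pierce 3 H (F i)]).
Proof.
move=> t0 tq; split=> [k d k2 dE|d dE] F good nodis.
  have [sz nz] := two_constraints (ltnW k2) t0 tq dE.
  apply: distinct_two_piercing k2 _ => p.
  exact: (pointed_piercing p sz nz (@no_four_weights R ^~ k) good nodis).
have [sz nz] := three_constraints t0 tq dE.
apply: distinct_three_piercing => p.
exact: (pointed_piercing p sz nz (@no_eight_weights R) good nodis).
Qed.
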